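(* Let $1<p<\infty$ and let $w$ and $v$ be weights on $\mathbb{R}^d$ such that $w\in A_1$, $v\in A_p$ and $a:=\big(\frac{w^p}{v}\big)^{\frac1{p-1}}\in A_\infty$. Let $T$ be a Calderón–Zygmund operator on $\mathbb{R}^d$ (in the sense of the context). Then there is a constant $C>0$ such that for every function $f\in L^1(w)$ with $Tf\in L^1(w)$ and every $s>0$ there exists a function $u^{(s)}\in L^1(w)$ satisfying $$\|u^{(s)}\|_{L^p(v)}\le C s,$$ $$\|f-u^{(s)}\|_{L^1(w)}\le C\,\mathrm{dist}_{L^1(w)}(f,B_{L^p(v)}(s)),$$ $$\|Tf-Tu^{(s)}\|_{L^1(w)}\le C\big(\mathrm{dist}_{L^1(w)}(f,B_{L^p(v)}(s))+\mathrm{dist}_{L^1(w)}(Tf,B_{L^p(v)}(s))\big).$$ The constant $C$ does not depend on $f$ and $s$.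
   Context: For a weight $w$ on $\mathbb{R}^d$, $L^p(w)=L^p(\mathbb{R}^d;w)$ is the space of measurable functions with $\|f\|_{L^p(w)}=\big(\int_{\mathbb{R}^d}|f|^pw\,dx\big)^{1/p}<\infty$. $A_p$ $(1\le p\le\infty)$ are the Muckenhoupt classes on $\mathbb{R}^d$. A Calderón–Zygmund (singular integral) operator is a linear operator $T$ bounded on $L^2(\mathbb{R}^d)$ possessing a kernel, i.e. a function $K(x,y)$ such that $(Tf)(x)=\int_{\mathbb{R}^d}K(x,y)f(y)\,dy$ for all $f$ with compact support and all $x$ outside this support, where for some $C>0$ and $\alpha>0$ $$|K(x,y_1)-K(x,y_2)|\le C\frac{|y_1-y_2|^\alpha}{|x-y_1|^{d+\alpha}}$$ whenever $y_1,y_2$ lie in some cube $Q$ and $x\notin 5Q$ ($5Q$ is the cube with the same center and 5 times the side length). As is standard for Calderón–Zygmund operators, $T$ is taken to be bounded on $L^q(u)$ for every $1<q<\infty$ and $u\in A_q$, and of weak type $(1,1)$ with respect to every weight $u\in A_1$ (i.e. bounded from $L^1(u)$ to weak-$L^1(u)$). For $f$ in $L^1(w)$ or $L^p(v)$, $Tf$ is understood via the corresponding extension by continuity (e.g. from bounded compactly supported functions). For $f\in L^1(w)$ and $s>0$, $\mathrm{dist}_{L^1(w)}(f,B_{L^p(v)}(s)):=\inf\{\|f-g\|_{L^1(w)}:\|g\|_{L^p(v)}\le s\}$. *)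

(* Defs.v *)
From HB Require Import structures.
From mathcomp Require Import all_boot all_order all_algebra.
From mathcomp Require Import all_classical all_reals all_analysis.
From mathcomp Require Import complex.

Set Implicit Arguments.
Unset Strict Implicit.
Unset Printing Implicit Defensive.

Import Order.TTheory GRing.Theory Num.Theory.
Import numFieldNormedType.Exports.

Local Open Scope classical_set_scope.
Local Open Scope ring_scope.

Definition rV_display : measure_display. Proof. exact: default_measure_display. Qed.

(* The sigma-algebra on R^n generated by the coordinates, i.e. the Borel one,
   as the library does for [n.-tuple R]. *)
Section measurable_rV.
Variables (R : realType) (n : nat).

Let coord : 'I_n -> 'rV[R]_n -> measurableTypeR R := fun i x => x ord0 i.

Let rV_set0 : g_sigma_preimage coord set0.
Proof. exact: sigma_algebra0. Qed.

Let rV_setC A : g_sigma_preimage coord A -> g_sigma_preimage coord (~` A).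
Proof. exact: sigma_algebraC. Qed.

Let rV_bigcup (F : _^nat) : (forall i, g_sigma_preimage coord (F i)) ->
  g_sigma_preimage coord (\bigcup_i (F i)).
Proof. exact: sigma_algebra_bigcup. Qed.

HB.instance Definition _ := @isMeasurable.Build rV_display
  'rV[R]_n (g_sigma_preimage coord) rV_set0 rV_setC rV_bigcup.

Lemma measurable_coord_rV (i : 'I_n) :
  measurable_fun [set: 'rV[R]_n] (fun x : 'rV[R]_n => x ord0 i).
Proof.
move=> _ Y mY; rewrite setTI; apply: sub_sigma_algebra => /=.
rewrite -bigcup_seq/=; exists i => /=; first by rewrite mem_index_enum.
by exists Y => //; rewrite setTI.
Qed.

Lemma measurable_fun_rVP d (T : measurableType d) (f : T -> 'rV[R]_n) :
  measurable_fun [set: T] f <->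
  forall i, measurable_fun [set: T] (fun x => f x ord0 i).
Proof.
split=> [mf i|mf].
  exact: (measurableT_comp (measurable_coord_rV i) mf).
move=> _ A mA; rewrite setTI.
suff : g_sigma_preimage coord `<=` [set B | measurable (f @^-1` B)] by exact.
apply: smallest_sub.
  split=> /=.
  - by rewrite preimage_set0.
  - by move=> B mB; rewrite setTD preimage_setC; exact: measurableC.
  - by move=> F mF; rewrite preimage_bigcup; exact: bigcup_measurable.
rewrite -bigcup_seq/=; apply: bigcup_sub => i _ B [Y mY <-]/=.
by rewrite setTI; have := mf i measurableT Y mY; rewrite setTI.
Qed.

End measurable_rV.

Section cons_rV.
Variables (R : realType) (n : nat).

Definition cons_rV (x : measurableTypeR R * 'rV[R]_n) : 'rV[R]_n.+1 :=
  \row_i oapp (fun j => x.2 ord0 j) x.1 (unlift ord0 i).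

Definition uncons_rV (v : 'rV[R]_n.+1) : measurableTypeR R * 'rV[R]_n :=
  (v ord0 ord0, \row_j v ord0 (lift ord0 j)).

Lemma cons_rVK : cancel cons_rV uncons_rV.
Proof.
case=> a v; rewrite /uncons_rV mxE unlift_none/=; congr pair.
by apply/rowP => j; rewrite !mxE liftK.
Qed.

Lemma measurable_cons_rV : measurable_fun [set: measurableTypeR R * 'rV[R]_n] cons_rV.
Proof.
apply/measurable_fun_rVP => i.
case: (unliftP ord0 i) => [j|] ->.
  rewrite (_ : (fun x => _) = (fun v : 'rV[R]_n => v ord0 j) \o snd).
    by apply: measurableT_comp => //; exact: measurable_coord_rV.
  by apply/funext => x /=; rewrite mxE liftK.
rewrite (_ : (fun x => _) = fst)//.
by apply/funext => x /=; rewrite mxE unlift_none.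
Qed.

Lemma measurable_uncons_rV : measurable_fun [set: 'rV[R]_n.+1] uncons_rV.
Proof.
apply/measurable_fun_pairP; split=> /=; first exact: measurable_coord_rV.
apply/measurable_fun_rVP => i.
under eq_fun do rewrite mxE.
exact: measurable_coord_rV.
Qed.

End cons_rV.

Section cons_measure.
Variables (R : realType) (n : nat).
Variable mu : {sigma_finite_measure set 'rV[R]_n -> \bar R}.
Local Open Scope ereal_scope.

Definition cons_measure : set 'rV[R]_n.+1 -> \bar R :=
  pushforward (lebesgue_measure \x mu) (@cons_rV R n).

Let cons_measure0 : cons_measure set0 = 0.
Proof. by rewrite /cons_measure /pushforward preimage_set0 measure0. Qed.

Let cons_measure_ge0 A : 0 <= cons_measure A.
Proof.
by rewrite /cons_measure; apply: measure_ge0; exact: measurable_cons_rV.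
Qed.

Let cons_measure_sigma_additive : semi_sigma_additive cons_measure.
Proof.
rewrite /cons_measure.
by apply: measure_semi_sigma_additive; exact: measurable_cons_rV.
Qed.

HB.instance Definition _ := isMeasure.Build _ _ _ cons_measure
  cons_measure0 cons_measure_ge0 cons_measure_sigma_additive.

Let cons_measure_sigma_finite : sigma_finite setT cons_measure.
Proof.
have /sigma_finiteP[F [TF ndF Foo]] := sigma_finiteT (@lebesgue_measure R).
have /sigma_finiteP[G [TG ndG Goo]] := sigma_finiteT mu.
exists (fun k => @uncons_rV R n @^-1` (F k `*` G k)) => [|k].
  rewrite -preimage_bigcup (_ : \bigcup_i _ = setT) ?preimage_setT//.
  apply/seteqP; split=> // -[x y] _.
  have [i _ Fix] : (\bigcup_i F i) x by rewrite -TF.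
  have [j _ Gjy] : (\bigcup_i G i) y by rewrite -TG.
  exists (maxn i j) => //; split.
    by move: x Fix; exact/subsetPset/ndF/leq_maxl.
  by move: y Gjy; exact/subsetPset/ndG/leq_maxr.
have [mF Fk] := Foo k; have [mG Gk] := Goo k.
split.
  rewrite -[X in measurable X]setTI.
  by apply: measurable_uncons_rV => //; exact: measurableX.
rewrite /cons_measure /pushforward -comp_preimage.
rewrite (_ : _ \o _ = id); last by apply/funext => x; exact: cons_rVK.
by rewrite preimage_id product_measure1E// lte_mul_pinfty// ge0_fin_numE.
Qed.

HB.instance Definition _ := Measure_isSigmaFinite.Build _ _ _ cons_measure
  cons_measure_sigma_finite.

End cons_measure.

(* Lebesgue measure on R^n, as the n-fold product of that of R. *)
Fixpoint lebesgue_rV (R : realType) (n : nat) :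
    {sigma_finite_measure set 'rV[R]_n -> \bar R} :=
  match n with
  | 0 => @dirac _ 'rV[R]_0 0%R R
  | n'.+1 => cons_measure (lebesgue_rV R n')
  end.

Lemma lebesgue_rV_box (R : realType) (n : nat) (a b : 'rV[R]_n) :
  (forall i, a ord0 i <= b ord0 i)%R ->
  (lebesgue_rV R n [set x | forall i, a ord0 i <= x ord0 i <= b ord0 i]%R =
   (\prod_i (b ord0 i - a ord0 i))%:E)%E.
Proof.
elim: n a b => [|n IH] a b ab.
  by rewrite big_ord0 /= diracE mem_set// => -[].
rewrite /= /cons_measure /pushforward.
rewrite (_ : _ @^-1` _ = `[a ord0 ord0, b ord0 ord0]%classic `*`
  [set x : 'rV[R]_n | forall i, (uncons_rV a).2 ord0 i <= x ord0 i
     <= (uncons_rV b).2 ord0 i]%R); last first.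
  apply/seteqP; split=> -[t v] /=.
    move=> H; split; first by have := H ord0; rewrite mxE unlift_none/= in_itv.
    by move=> i; have := H (lift ord0 i); rewrite !mxE liftK.
  move=> [tab H] i; rewrite mxE; case: unliftP => [j|] ->/=.
    by have := H j; rewrite !mxE.
  by move: tab; rewrite in_itv.
have mS : measurable [set x : 'rV[R]_n | forall i, (uncons_rV a).2 ord0 i <= x ord0 i
     <= (uncons_rV b).2 ord0 i]%R.
  rewrite (_ : mkset _ = \bigcap_(i in [set: 'I_n])
     ((fun x : 'rV[R]_n => x ord0 i) @^-1`
        `[(uncons_rV a).2 ord0 i, (uncons_rV b).2 ord0 i])); last first.
    apply/seteqP; split=> x /= H i; first by move=> _; rewrite /= in_itv/=.
    by have := H i I; rewrite /= in_itv.
  apply: fin_bigcap_measurable => // i _.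
  by rewrite -[X in measurable X]setTI; apply: measurable_coord_rV.
rewrite product_measure1E//.
rewrite [X in (X * _)%E](lebesgue_measure_itv `[a ord0 ord0, b ord0 ord0])/= IH; last by move=> i; rewrite !mxE.
rewrite big_ord_recl EFinM; congr (_ * _)%E.
  rewrite lte_fin; case: ltP => //= ba.
  by rewrite (@le_anti _ _ (b ord0 ord0) (a ord0 ord0)) ?subrr// ba ab.
by congr EFin; apply: eq_bigr => i _; rewrite !mxE.
Qed.

Section weights.
Variables (R : realType) (d : nat).
Local Notation mu := (lebesgue_rV R d).
Local Notation Rd := 'rV[R]_d.
Implicit Types (w : Rd -> R) (Q : set Rd).

(* [cube c l] has side length l, so that 5Q is [cube c (5 * l)]. *)
Definition cube (c : Rd) (l : R) : set Rd :=
  [set x | forall i, `|x ord0 i - c ord0 i| <= l / 2].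

Definition weight w :=
  [/\ measurable_fun setT w, (forall x, 0 <= w x), {ae mu, forall x, 0 < w x} &
      forall K, compact K -> (\int[mu]_(x in K) (w x)%:E < +oo)%E].

Definition average w Q : \bar R := ((mu Q)^-1 * \int[mu]_(x in Q) (w x)%:E)%E.

Definition A1 w := weight w /\
  exists C : R, forall c l, 0 < l ->
    {ae mu, forall y, cube c l y -> (average w (cube c l) <= (C * w y)%:E)%E}.

(* For 1 < p < oo. *)
Definition Ap (p : R) w := weight w /\
  exists C : R, forall c l, 0 < l ->
    (average w (cube c l) *
     average (fun x => w x `^ (- (p - 1)^-1))%R (cube c l) `^ (p - 1) <= C%:E)%E.

Definition Ainfty w := exists2 p : R, 1 < p & Ap p w.

End weights.

(* Functions are complex-valued; their real and imaginary parts are handled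
   separately since R[i] carries no measurable structure. *)
Section weighted_spaces.
Variables (R : realType) (d : nat).
Local Notation mu := (lebesgue_rV R d).
Local Notation Rd := 'rV[R]_d.
Local Notation normc := (@Normc.normc R).
Implicit Types (w v : Rd -> R) (f g h : Rd -> R[i]).

Definition Cmeasurable f :=
  measurable_fun setT (fun x => complex.Re (f x)) /\
  measurable_fun setT (fun x => complex.Im (f x)).

Definition Cintegrable f :=
  mu.-integrable setT (EFin \o (fun x => complex.Re (f x))) /\
  mu.-integrable setT (EFin \o (fun x => complex.Im (f x))).

Definition Cintegral f : R[i] :=
  Complex (Rintegral mu setT (fun x => complex.Re (f x)))
          (Rintegral mu setT (fun x => complex.Im (f x))).

Definition wLnorm (p : R) w f : \bar R :=
  ((\int[mu]_x (normc (f x) `^ p * w x)%:E) `^ p^-1)%E.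

Definition inLp (p : R) w f := Cmeasurable f /\ (wLnorm p w f < +oo)%E.

Definition weakL1norm w f : \bar R :=
  ereal_sup [set (l%:E * \int[mu]_(x in [set x | (l < normc (f x))%R]) (w x)%:E)%E
            | l in [set l : R | 0 < l]].

(* dist_{L^1(w)}(f, B_{L^p(v)}(s)) *)
Definition dist_ball w (p : R) v f (s : R) : \bar R :=
  ereal_inf [set wLnorm 1 w (fun x => f x - g x)
            | g in [set g | Cmeasurable g /\ (wLnorm p v g <= s%:E)%E]].

Definition support f : set Rd := closure [set x | f x != 0].

Definition bounded_compact_support f :=
  [/\ Cmeasurable f, (exists M : R, forall x, normc (f x) <= M) &
      compact (support f)].

End weighted_spaces.

Section calderon_zygmund.
Variables (R : realType) (d : nat).
Local Notation mu := (lebesgue_rV R d).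
Local Notation Rd := 'rV[R]_d.
Local Notation normc := (@Normc.normc R).
Local Notation one := (fun _ : Rd => 1 : R).

Definition eucl_norm (x : Rd) : R := Num.sqrt (\sum_i x ord0 i ^+ 2).

Definition CZ_kernel (K : Rd -> Rd -> R[i]) :=
  exists C alpha : R, [/\ 0 < C, 0 < alpha &
    forall c l x y1 y2, 0 < l -> cube c l y1 -> cube c l y2 ->
      ~ cube c (5 * l) x ->
      normc (K x y1 - K x y2) <=
        C * (eucl_norm (y1 - y2) `^ alpha / eucl_norm (x - y1) `^ (d%:R + alpha))].

(* T is a map between functions standing for an operator on classes modulo
   equality a.e.; only its values on L^2 are constrained. *)
Record CZ_operator (T : (Rd -> R[i]) -> Rd -> R[i]) : Prop := {
  CZ_measurable : forall f, inLp 2 one f -> Cmeasurable (T f) ;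
  CZ_linear : forall (a : R[i]) f g, inLp 2 one f -> inLp 2 one g ->
    {ae mu, forall x, T (fun y => a * f y + g y) x = a * T f x + T g x} ;
  CZ_L2 : exists C : R, forall f, inLp 2 one f ->
    (wLnorm 2 one (T f) <= C%:E * wLnorm 2 one f)%E ;
  CZ_representation : exists2 K, CZ_kernel K &
    forall f, inLp 2 one f -> compact (support f) ->
      {ae mu, forall x, ~ support f x ->
        Cintegrable (fun y => K x y * f y) /\
        T f x = Cintegral (fun y => K x y * f y)} ;
  CZ_strong_type : forall (q : R) (u : Rd -> R), 1 < q -> Ap q u ->
    exists C : R, forall f, bounded_compact_support f ->
      (wLnorm q u (T f) <= C%:E * wLnorm q u f)%E ;
  CZ_weak_type : forall u : Rd -> R, A1 u ->
    exists C : R, forall f, bounded_compact_support f ->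
      (weakL1norm u (T f) <= C%:E * wLnorm 1 u f)%E
}.

(* [CZ_ext T w f h]: h is (a version of) Tf, for the continuous extension of T
   from the bounded compactly supported functions to an operator from L^1(w) to
   weak L^1(w). *)
Definition CZ_ext (T : (Rd -> R[i]) -> Rd -> R[i]) (w : Rd -> R)
    (f h : Rd -> R[i]) :=
  Cmeasurable h /\
  exists f_ : nat -> Rd -> R[i],
    [/\ forall n, bounded_compact_support (f_ n),
        (fun n => wLnorm 1 w (fun x => f_ n x - f x)) @ \oo --> (0 : \bar R)%E &
        (fun n => weakL1norm w (fun x => T (f_ n) x - h x)) @ \oo
          --> (0 : \bar R)%E].

End calderon_zygmund.

(* Main.v *)
From HB Require Import structures.
From mathcomp Require Import all_boot all_order all_algebra.
From mathcomp Require Import all_classical all_reals all_analysis.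
From mathcomp Require Import complex ring lra measurable_realfun.
Require Import Defs.

(** Put [a = (w^p / v)^(1/(p-1))], so that [a^(p-1) v = w^p] almost everywhere.
    For [X = |F|] the integrands [X^p v] and [lam^(p-1) X w] then agree where
    [X w = lam a]; the first is dominated by the second below this threshold and
    dominates it above ([below_threshold], [above_threshold]).  Thus [a dx]
    is the measure with respect to which an element of L^1(w) has to be cut in
    order to produce an element of L^p(v), and [A_infty] makes it doubling.

    Let [g] in the ball nearly realize the distance from [f], put [b = f - g] and
    let [be] be the L^1(w) norm of [b].  The height [lam] is chosen so that
    [lam^(p-1) be = s^p].  The maximal dyadic cubes [D_j] on which the integral of
    [|b| w] exceeds [lam a(D_j)] form a Calderon-Zygmund decomposition
    ([cz_decomposition]): [|b| w <= lam a] off their union [Omega].  Let [bad] be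
    [b] minus its mean on each [D_j], and zero off [Omega].  The approximant is
    [u = g + (b - bad)], so that [f - u = bad].  Four estimates carry the proof.

    - By A_1, a mean over [D_j] times [w(D_j)] is controlled by the integral of
      [|b| w] over [D_j]; hence the L^1(w) norm of [bad] is at most a multiple of
      [be] ([nmass_bad_le]).

    - The function [b - bad] is [b] off [Omega], where it is below the threshold,
      and a mean on each [D_j].  The comparison
      [a(Q)^(p-1) v(Q) <= C w(Q)^p] on cubes ([weights_comparison]) gives for
      these means the same bound as below the threshold, so that the p-th power of
      the L^p(v) norm of [b - bad] is at most a multiple of [lam^(p-1) be = s^p]
      ([pmass_good_le]).

    - Every piece of [bad] has mean zero, so its image under [T] decays away from
      its cube, and A_1 sums this decay over dyadic annuli ([T_tail]).  Off the
      union [Omega_star] of the cubes dilated by 5, the L^1(w) norm of [T bad] is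
      therefore at most a multiple of [be] ([nmass_T_bad_trunc_le]).

    - On [Omega_star] one writes [Tf - Tu = (Tf - h) + (h - Tu)], where [h] in the
      ball nearly realizes the distance from [Tf].  The L^p(v) norm of [h - Tu] is
      at most a multiple of [s] because [T] is bounded on L^p(v).  Its L^1(w) norm
      on [Omega_star] is then, by the threshold inequality ([threshold_split]), at
      most [lam a(Omega_star)] plus a multiple of [lam^(1-p) s^p = be], and
      [lam a(Omega_star)] is at most a multiple of [be] by the choice of the cubes
      ([mass_Omega_star_le]).

    If the distance from [f] to the ball vanishes there is no [be > 0] to work
    with; but the ball is closed under convergence in L^1(w), so [f] lies in it
    and [u = f] will do ([dist_ball_eq0]).

    The image [Tu] is a limit in weak L^1(w), which is complete
    ([weak_complete]).  All bounds for [T] are proved on bounded functions of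
    compact support and reach [Tu] and [Tf - Tu] by Fatou, along subsequences
    converging almost everywhere. *)

Set Implicit Arguments.
Unset Strict Implicit.
Unset Printing Implicit Defensive.

Import Order.TTheory GRing.Theory Num.Theory.
Import numFieldNormedType.Exports.

Local Open Scope classical_set_scope.
Local Open Scope ring_scope.

(** * Masses of sets with respect to a density *)

Section mass.
Context {dT : measure_display} {T : measurableType dT} {R : realType}.
Variable mu : {measure set T -> \bar R}.
Implicit Types (f g : T -> R) (E F : set T).

Definition nnmeas f := measurable_fun [set: T] f /\ forall x, 0 <= f x.

Definition mass f E : \bar R := (\int[mu]_(x in E) (f x)%:E)%E.

Lemma nnmeas_cst (k : R) : 0 <= k -> nnmeas (fun=> k).
Proof. by move=> k0; split. Qed.

Lemma nnmeasD f g : nnmeas f -> nnmeas g -> nnmeas (fun x => f x + g x).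
Proof.
move=> [mf f0] [mg g0]; split; first exact: measurable_funD.
by move=> x; exact: addr_ge0.
Qed.

Lemma nnmeasM f g : nnmeas f -> nnmeas g -> nnmeas (fun x => f x * g x).
Proof.
move=> [mf f0] [mg g0]; split; first exact: measurable_funM.
by move=> x; exact: mulr_ge0.
Qed.

Lemma nnmeasZ (k : R) f : 0 <= k -> nnmeas f -> nnmeas (fun x => k * f x).
Proof. by move=> k0 nf; apply: nnmeasM => //; exact: nnmeas_cst. Qed.

Lemma nnmeas_powR (q : R) f : measurable_fun [set: T] f ->
  nnmeas (fun x => f x `^ q).
Proof.
move=> mf; split=> [|x]; last exact: powR_ge0.
by apply: (measurableT_comp (measurable_powR _)).
Qed.

Lemma nnmeas_indic E : measurable E -> nnmeas (\1_E : T -> R).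
Proof. by move=> mE; split. Qed.

Lemma nnmeas_mEFin f E : nnmeas f -> measurable_fun E (fun x => (f x)%:E).
Proof.
by move=> [mf _]; apply: measurable_funTS; exact/measurable_EFinP.
Qed.
Hint Resolve nnmeas_mEFin : core.

Lemma mass_ge0 f E : nnmeas f -> (0 <= mass f E)%E.
Proof. by move=> [_ f0]; apply: integral_ge0 => x _; rewrite lee_fin. Qed.

Lemma mass_set0 f : mass f set0 = 0%E.
Proof. exact: integral_set0. Qed.

Lemma mass_aele f g E : nnmeas f -> nnmeas g -> measurable E ->
  {ae mu, forall x, E x -> f x <= g x} -> (mass f E <= mass g E)%E.
Proof.
move=> nf ng mE fg; apply: ae_ge0_le_integral => //.
- by move=> x _; rewrite lee_fin; exact: nf.2.
- exact: nnmeas_mEFin.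
- by move=> x _; rewrite lee_fin; exact: ng.2.
- exact: nnmeas_mEFin.
Qed.

Lemma mass_le f g E : nnmeas f -> nnmeas g -> measurable E ->
  (forall x, E x -> f x <= g x) -> (mass f E <= mass g E)%E.
Proof. by move=> nf ng mE fg; apply: mass_aele => //; exact: nearW. Qed.

Lemma mass_aeeq f g E : nnmeas f -> nnmeas g -> measurable E ->
  {ae mu, forall x, E x -> f x = g x} -> (mass f E = mass g E)%E.
Proof.
move=> nf ng mE fg; apply/eqP; rewrite eq_le; apply/andP; split.
  by apply: mass_aele => //; apply: filterS fg => x h /h ->.
by apply: mass_aele => //; apply: filterS fg => x h /h ->.
Qed.

Lemma eq_mass f g E : (forall x, E x -> f x = g x) -> (mass f E = mass g E)%E.
Proof.
by move=> fg; apply: eq_integral => x; rewrite inE => Ex; rewrite fg.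
Qed.

Lemma mass_sub f E F : nnmeas f -> measurable E -> measurable F ->
  E `<=` F -> (mass f E <= mass f F)%E.
Proof.
move=> nf mE mF EF; apply: ge0_subset_integral => //; first exact: nnmeas_mEFin.
by move=> x _; rewrite lee_fin; exact: nf.2.
Qed.

Lemma massZ (k : R) f E : 0 <= k -> nnmeas f -> measurable E ->
  mass (fun x => k * f x) E = (k%:E * mass f E)%E.
Proof.
move=> k0 nf mE; rewrite /mass -ge0_integralZl_EFin//; last 2 first.
- by move=> x _; rewrite lee_fin; exact: nf.2.
- exact: nnmeas_mEFin.
Qed.

Lemma massD f g E : nnmeas f -> nnmeas g -> measurable E ->
  mass (fun x => f x + g x) E = (mass f E + mass g E)%E.
Proof.
move=> nf ng mE; rewrite /mass -ge0_integralD//.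
- by move=> x _; rewrite lee_fin; exact: nf.2.
- exact: nnmeas_mEFin.
- by move=> x _; rewrite lee_fin; exact: ng.2.
- exact: nnmeas_mEFin.
Qed.

Lemma mass_cst (k : R) E : measurable E -> mass (fun=> k) E = (k%:E * mu E)%E.
Proof. by move=> mE; rewrite /mass integral_cst. Qed.

Lemma mass_setU f E F : nnmeas f -> measurable E -> measurable F ->
  E `&` F = set0 -> mass f (E `|` F) = (mass f E + mass f F)%E.
Proof.
move=> nf mE mF EF; apply: ge0_integral_setU => //; first exact: nnmeas_mEFin.
  by move=> x _; rewrite lee_fin; exact: nf.2.
by rewrite disj_set2E EF.
Qed.

Lemma mass_split f E F : nnmeas f -> measurable E -> measurable F ->
  mass f E = (mass f (E `&` F) + mass f (E `\` F))%E.
Proof.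
move=> nf mE mF; rewrite -[in LHS](setUIDK E F) mass_setU//.
- exact: measurableI.
- exact: measurableD.
- by rewrite setDE setIACA setICr setI0.
Qed.

Lemma mass_bigcup f (E : nat -> set T) : nnmeas f ->
  (forall j, measurable (E j)) -> trivIset setT E ->
  mass f (\bigcup_j E j) = (\sum_(j <oo) mass f (E j))%E.
Proof.
move=> nf mE tE; apply: ge0_integral_bigcup => //; first exact: nnmeas_mEFin.
by move=> x _; rewrite lee_fin; exact: nf.2.
Qed.

Lemma mass_patch f E F : measurable E -> measurable F ->
  mass (fun x => \1_F x * f x) E = mass f (E `&` F).
Proof.
move=> mE mF; rewrite /mass integral_mkcondr; apply: eq_integral => x _.
rewrite patchE indicE; case: (x \in F); rewrite ?mul1r ?mul0r//.
Qed.

(** A weight is positive almost everywhere, so that a set without [w]-mass is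
    Lebesgue null: this brings statements about weak L^1(w) back to Lebesgue
    almost everywhere. *)
Lemma mass_null_set f E : nnmeas f -> measurable E ->
  {ae mu, forall x, 0 < f x} -> mass f E = 0%E -> mu E = 0%E.
Proof.
move=> nf mE fp f0.
have : mass f E = 0%E by [].
rewrite /mass; under eq_integral do rewrite -[f _]ger0_norm ?nf.2// -abse_EFin.
move/ae_eq_integral_abs => /(_ mE (nnmeas_mEFin nf)) h.
apply/eqP; rewrite eq_le measure_ge0 andbT.
have [N [mN N0 sN]] : {ae mu, forall x, ~ E x}.
  move: h fp; apply: filterS2 => x /= h fx Ex.
  by have := h Ex => -[] /eqP; rewrite gt_eqF.
rewrite -N0; apply: le_measure; rewrite ?inE//.
by move=> x Ex; apply: sN => /=; exact.
Qed.

End mass.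
#[global] Hint Extern 0 (measurable_fun _ (fun x => (_ x)%:E)) =>
  (solve [apply: nnmeas_mEFin]) : core.

(** * Cubes and Muckenhoupt weights *)

Section cubes.
Context {R : realType} {d : nat}.
Local Notation mu := (lebesgue_rV R d).
Local Notation Rd := 'rV[R]_d.
Implicit Types (w v a : Rd -> R) (c : Rd) (l theta : R) (E : set Rd).

Lemma cubeE c l : cube c l =
  [set x : Rd | forall i, c ord0 i - l / 2 <= x ord0 i <= c ord0 i + l / 2].
Proof.
by apply/seteqP; split=> x /= h i; have := h i; rewrite ler_distl.
Qed.

Lemma compact_cube c l : compact (cube c l).
Proof.
rewrite cubeE.
have := @rV_compact R d (fun i => `[c ord0 i - l / 2, c ord0 i + l / 2]%classic).
rewrite (_ : mkset _ =
    [set x : Rd | forall i, c ord0 i - l / 2 <= x ord0 i <= c ord0 i + l / 2]).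
  by apply => i; exact: segment_compact.
by apply/seteqP; split=> x /= h i; have := h i; rewrite in_itv.
Qed.

Lemma closed_cube c l : closed (cube c l).
Proof.
by apply: compact_closed; [exact: norm_hausdorff | exact: compact_cube].
Qed.

Lemma measurable_cube c l : measurable (cube c l).
Proof.
rewrite cubeE.
rewrite (_ : mkset _ = \bigcap_(i in [set: 'I_d])
     ((fun x : 'rV[R]_d => x ord0 i) @^-1`
        `[c ord0 i - l / 2, c ord0 i + l / 2])); last first.
  apply/seteqP; split=> x /= H i; first by move=> _; rewrite /= in_itv/=.
  by have := H i I; rewrite /= in_itv.
apply: fin_bigcap_measurable => // i _.
by rewrite -[X in measurable X]setTI; apply: measurable_coord_rV.
Qed.

Lemma cube_volume c l : 0 <= l -> mu (cube c l) = (l ^+ d)%:E.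
Proof.
move=> l0; rewrite cubeE.
have := @lebesgue_rV_box R d (\row_i (c ord0 i - l / 2)) (\row_i (c ord0 i + l / 2)).
set S := (X in mu X = (\prod_i (_ - _))%:E); have -> : S =
    [set x : Rd | forall i, c ord0 i - l / 2 <= x ord0 i <= c ord0 i + l / 2].
  by apply/seteqP; split=> x /= h i; have := h i; rewrite !mxE.
move=> ->; last by move=> i; rewrite !mxE; lra.
congr EFin; rewrite (eq_bigr (fun=> l)); last by move=> i _; rewrite !mxE; lra.
by rewrite prodr_const card_ord.
Qed.

Lemma cube_sub c c' l l' :
  (forall i, `|c ord0 i - c' ord0 i| <= (l' - l) / 2) -> cube c l `<=` cube c' l'.
Proof.
move=> h x /= cx i; have := h i; have := cx i.
rewrite !ler_distl => /andP[? ?] /andP[? ?]; apply/andP; split; lra.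
Qed.

(** Real-valued, since a weight is integrable on compact sets; see [cmassE]. *)
Definition cmass w c l : R := fine (mass mu w (cube c l)).

Lemma weight_nnmeas w : weight w -> nnmeas w.
Proof. by case. Qed.

Lemma cmassE w c l : weight w -> mass mu w (cube c l) = (cmass w c l)%:E.
Proof.
move=> [mw w0 _ fw]; rewrite fineK// ge0_fin_numE; last exact: mass_ge0.
exact/fw/compact_cube.
Qed.

Lemma cmass_ge0 w c l : weight w -> 0 <= cmass w c l.
Proof. by move=> /weight_nnmeas nw; apply: fine_ge0; exact: mass_ge0. Qed.

Lemma cmass_gt0 w c l : weight w -> 0 < l -> 0 < cmass w c l.
Proof.
move=> ww l0; rewrite lt_def cmass_ge0// andbT; apply/eqP => m0.
have [mw w0 wp _] := ww.
have : mu (cube c l) = 0%E.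
  apply: (mass_null_set (weight_nnmeas ww) (measurable_cube c l) wp).
  by rewrite cmassE// m0.
by rewrite cube_volume ?ltW// => -[] /eqP; rewrite expf_eq0 (gt_eqF l0) andbF.
Qed.

Lemma averageE w c l : 0 < l ->
  average w (cube c l) = ((l ^+ d)^-1%:E * mass mu w (cube c l))%E.
Proof.
move=> l0; rewrite /average cube_volume; last exact: ltW.
by rewrite inver expf_eq0 (gt_eqF l0) andbF.
Qed.

(** Markov's inequality at [1 / theta] times the average of [w] over the cube. *)
Lemma chebyshev_average w : weight w -> forall c l theta, 0 < l -> 0 < theta ->
  (mu [set x | cube c l x /\ cmass w c l / (theta * l ^+ d) < w x]%R <=
    (theta * l ^+ d)%:E)%E.
Proof.
move=> ww c l theta l0 t0.
set B := [set x | _]; have nw := weight_nnmeas ww.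
have mB : measurable B.
  have -> : B = cube c l `&` w @^-1` `]cmass w c l / (theta * l ^+ d), +oo[.
    by apply/seteqP; split=> x /=; rewrite in_itv/= andbT.
  apply: measurableI; first exact: measurable_cube.
  by rewrite -[X in measurable X]setTI; apply: nw.1.
have m0 := cmass_gt0 c ww l0.
have ld0 : 0 < l ^+ d by exact: exprn_gt0.
have : ((cmass w c l / (theta * l ^+ d))%:E * mu B <= (cmass w c l)%:E)%E.
  rewrite -cmassE// -mass_cst//.
  apply: (@le_trans _ _ (mass mu w B)).
    apply: mass_le => //; first by apply: nnmeas_cst; rewrite divr_ge0 ?mulr_ge0// ltW.
    by move=> x [_ /ltW].
  by apply: mass_sub => //; [exact: measurable_cube|move=> x []].
have tl : 0 < theta * l ^+ d by exact: mulr_gt0.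
move=> h; rewrite -(@lee_pmul2l _ (cmass w c l / (theta * l ^+ d))%:E)//; last first.
  by rewrite lte_fin divr_gt0.
by rewrite (le_trans h)// -EFinM lee_fin divfK// gt_eqF.
Qed.

(** Markov's inequality for the dual weight [a^(-1/(q-1))], whose average over the
    cube the A_q condition bounds by a power of the average of [a]: on most of the
    cube [a] is not much smaller than its average. *)
Lemma Ap_large_level_set q a : 1 < q -> Ap q a -> exists2 C : R, 0 < C &
  forall c l theta, 0 < l -> 0 < theta ->
  (mu [set x | cube c l x /\ a x < theta `^ (q - 1) * cmass a c l / (C * l ^+ d)]%R <=
    (theta * l ^+ d)%:E)%E.
Proof.
move=> q1 [wa [C0 HC]]; pose C := Num.max C0 1.
have Cp : 0 < C by rewrite lt_max ltr01 orbT.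
exists C => // c l theta l0 t0.
set B := [set x | _]; have na := weight_nnmeas wa.
have mB : measurable B.
  have -> : B = cube c l `&` a @^-1` `]-oo, theta `^ (q - 1) * cmass a c l / (C * l ^+ d)[.
    by apply/seteqP; split=> x /=; rewrite in_itv/=.
  apply: measurableI; first exact: measurable_cube.
  by rewrite -[X in measurable X]setTI; apply: na.1.
have m0 := cmass_gt0 c wa l0.
have ld0 : 0 < l ^+ d by exact: exprn_gt0.
pose A := cmass a c l / l ^+ d.
have A0 : 0 < A by rewrite divr_gt0.
have q10 : 0 < q - 1 by rewrite subr_gt0.
pose sg := (fun x => a x `^ (- (q - 1)^-1)).
have nsg : nnmeas sg by apply: nnmeas_powR; exact: na.1.
pose s := (C / A) `^ (q - 1)^-1.
have s0 : 0 < s by rewrite powR_gt0// divr_gt0.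
have : (mass mu sg (cube c l) <= (s * l ^+ d)%:E)%E.
  have := HC c l l0; rewrite !averageE//.
  rewrite cmassE// -/sg -EFinM (mulrC _ (cmass _ _ _)) -/A.
  have := mass_ge0 mu (cube c l) nsg.
  case: (mass mu sg (cube c l)) => [t| |] //.
    rewrite lee_fin => t0'.
    have -> : ((l ^- d)%:E * t%:E = (l ^- d * t)%:E)%E by [].
    rewrite poweR_EFin -EFinM lee_fin => h.
    have t1 : 0 <= (l ^+ d)^-1 * t by rewrite mulr_ge0// invr_ge0 ltW.
    rewrite lee_fin -ler_pdivrMr// mulrC.
    have -> : (l ^+ d)^-1 * t = (((l ^+ d)^-1 * t) `^ (q - 1)) `^ (q - 1)^-1.
      by rewrite -powRrM divff ?powRr1// gt_eqF.
    apply: ge0_ler_powR.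
    - by rewrite invr_ge0 ltW.
    - by rewrite nnegrE powR_ge0.
    - by rewrite nnegrE divr_ge0// ltW.
    - rewrite ler_pdivlMr// mulrC (le_trans h)// /C le_max lexx//.
  move=> _; rewrite gt0_muley; last by rewrite lte_fin invr_gt0.
  by rewrite poweRyr ?gt_eqF// gt0_muley ?lte_fin.
move=> sle.
have : ((s / theta)%:E * mu B <= (s * l ^+ d)%:E)%E.
  apply: le_trans sle; rewrite -mass_cst//.
  apply: (@le_trans _ _ (mass mu sg B)); last first.
    by apply: mass_sub => //; [exact: measurable_cube|move=> x []].
  apply: mass_aele => //; first by apply: nnmeas_cst; rewrite divr_ge0// ltW.
  have [_ _ ap _] := wa.
  apply: filterS ap => x ax [_ xB]; rewrite /sg.
  have -> : s / theta = (theta `^ (q - 1) * cmass a c l / (C * l ^+ d)) `^ (- (q - 1)^-1).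
    have -> : theta `^ (q - 1) * cmass a c l / (C * l ^+ d) = theta `^ (q - 1) * (C / A)^-1.
      rewrite /A; field; rewrite ?gt_eqF//.
    rewrite powRM; [|exact: powR_ge0|by rewrite invr_ge0 divr_ge0// ltW].
    rewrite -powRrM mulrN divff ?gt_eqF// powR_inv1 ?ltW// mulrC; congr (_ * _).
    rewrite -(@powR_inv1 _ (C / A)); last by rewrite divr_ge0// ltW.
    by rewrite -powRrM mulrNN mul1r.
  rewrite !powRN lef_pV2 ?posrE ?powR_gt0//; last first.
    by rewrite divr_gt0// ?mulr_gt0// powR_gt0.
  apply: ge0_ler_powR.
  - by rewrite invr_ge0 ltW.
  - by rewrite nnegrE ltW.
  - by rewrite nnegrE divr_ge0// ?mulr_ge0// ltW// powR_gt0.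
  - exact: ltW.
move=> h; rewrite -(@lee_pmul2l _ (s / theta)%:E)//; last first.
  by rewrite lte_fin divr_gt0.
rewrite (le_trans h)// -EFinM lee_fin.
by rewrite mulrA divfK// gt_eqF.
Qed.

(** The level can be chosen so that [a] lies below it on at most the proportion
    [theta / 2] of the cube; on the remaining part of [E], of proportion at least
    [theta / 2], it is comparable with its average.  This quantitative form
    of A_infty is the source of the doubling property and of the infinite mass of
    [a]. *)
Lemma Ap_lower_mass q a theta : 1 < q -> Ap q a -> 0 < theta ->
  exists2 k : R, 0 < k & forall c l E, 0 < l -> measurable E ->
    E `<=` cube c l -> ((theta * l ^+ d)%:E <= mu E)%E ->
    ((k * cmass a c l)%:E <= mass mu a E)%E.
Proof.
move=> q1 Aa t0; have [C C0 HC] := Ap_large_level_set q1 Aa.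
have wa := Aa.1; have na := weight_nnmeas wa.
exists ((theta / 2) `^ (q - 1) / C * (theta / 2)).
  by rewrite mulr_gt0// ?divr_gt0// powR_gt0// divr_gt0.
move=> c l E l0 mE Ec tE.
have ld0 : 0 < l ^+ d by exact: exprn_gt0.
have {HC} := HC c l (theta / 2) l0 (divr_gt0 t0 (ltr0n _ 2)).
set t := _ * _ / _; set B := [set x | _] => muB.
have mB : measurable B.
  have -> : B = cube c l `&` a @^-1` `]-oo, t[.
    by apply/seteqP; split=> x /=; rewrite in_itv/=.
  apply: measurableI; first exact: measurable_cube.
  by rewrite -[X in measurable X]setTI; apply: na.1.
have muEB : ((theta / 2 * l ^+ d)%:E <= mu (E `\` B))%E.
  have : (mu E <= mu (E `\` B) + mu B)%E.
    rewrite -measureU//; last 2 first.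
    - exact: measurableD.
    - by rewrite setDE -setIA setICl setI0.
    by apply: le_measure; rewrite ?inE//; [apply: measurableU => //; exact: measurableD|
      rewrite setDE setUIl setUCl setIT; exact: subsetUl].
  have B0 : (0 <= mu B)%E by exact: measure_ge0.
  have EB0 : (0 <= mu (E `\` B))%E by exact: measure_ge0.
  move: muB tE B0 EB0.
  case: (mu B) => [b| |]//; case: (mu (E `\` B)) => [e| |]//; rewrite ?leey//.
  by rewrite !lee_fin => h1 /le_trans h2 _ _ /h2; rewrite lee_fin; lra.
have t0' : 0 <= t by rewrite divr_ge0// ?mulr_ge0// ?powR_ge0 ?cmass_ge0// ltW.
have mEB : measurable (E `\` B) by exact: measurableD.
apply: (@le_trans _ _ (mass mu a (E `\` B))); last first.
  by apply: mass_sub => //; exact: subDsetl.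
apply: (@le_trans _ _ (mass mu (fun=> t) (E `\` B))); last first.
  apply: mass_le => // x [/Ec cx nB]; rewrite leNgt; apply/negP => axt.
  by apply: nB.
rewrite mass_cst//; apply: (@le_trans _ _ (t%:E * (theta / 2 * l ^+ d)%:E)%E).
  by rewrite -EFinM lee_fin /t le_eqVlt; apply/orP; left; apply/eqP; field; rewrite ?gt_eqF.
by apply: lee_wpmul2l => //; rewrite lee_fin.
Qed.

(** The pointwise identity passes to averages over a cube because some point of the
    cube is good for all three weights: outside three sets, each of a quarter of
    its volume, [w] is at most a multiple of its average while [a] and [v] are at
    least a multiple of theirs. *)
Lemma weights_comparison p q w v a : 1 < p -> 1 < q -> weight w -> Ap p v -> Ap q a ->
  {ae mu, forall x, a x `^ (p - 1) * v x = w x `^ p} ->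
  exists2 C : R, 0 < C & forall c l, 0 < l ->
    cmass a c l `^ (p - 1) * cmass v c l <= C * cmass w c l `^ p.
Proof.
move=> p1 q1 ww Av Aa hpt.
have wv := Av.1; have wa := Aa.1.
have [Cv Cv0 Hv] := Ap_large_level_set p1 Av.
have [Ca Ca0 Ha] := Ap_large_level_set q1 Aa.
have Hw := chebyshev_average ww.
have p10 : 0 < p - 1 by rewrite subr_gt0.
(* Three exceptional sets of a quarter of the volume leave room for a point. *)
pose th : R := 4^-1; have th0 : 0 < th by rewrite invr_gt0.
pose ka := th `^ (q - 1) / Ca; pose kv := th `^ (p - 1) / Cv.
have ka0 : 0 < ka by rewrite divr_gt0// powR_gt0.
have kv0 : 0 < kv by rewrite divr_gt0// powR_gt0.
exists (th^-1 `^ p / (ka `^ (p - 1) * kv)).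
  by rewrite divr_gt0 ?mulr_gt0 ?powR_gt0// invr_gt0.
move=> c l l0; have ld0 : 0 < l ^+ d by exact: exprn_gt0.
have := Hv c l th l0 th0; have := Ha c l th l0 th0; have := Hw c l th l0 th0.
set Bw := [set x | _]; set Ba := [set x | _]; set Bv := [set x | _].
move=> muBw muBa muBv; have [N [mN N0 sN]] := hpt.
have [x [cx nBw nBa nBv nN]] : exists x, [/\ cube c l x, ~ Bw x, ~ Ba x, ~ Bv x & ~ N x].
  apply: contrapT => hno.
  have mBw : measurable Bw.
    have -> : Bw = cube c l `&` w @^-1` `]cmass w c l / (th * l ^+ d), +oo[.
      by apply/seteqP; split=> x /=; rewrite in_itv/= andbT.
    apply: measurableI; first exact: measurable_cube.
    by rewrite -[X in measurable X]setTI; apply: (weight_nnmeas ww).1.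
  have mBa : measurable Ba.
    have -> : Ba = cube c l `&` a @^-1` `]-oo, th `^ (q - 1) * cmass a c l / (Ca * l ^+ d)[.
      by apply/seteqP; split=> x /=; rewrite in_itv/=.
    apply: measurableI; first exact: measurable_cube.
    by rewrite -[X in measurable X]setTI; apply: (weight_nnmeas wa).1.
  have mBv : measurable Bv.
    have -> : Bv = cube c l `&` v @^-1` `]-oo, th `^ (p - 1) * cmass v c l / (Cv * l ^+ d)[.
      by apply/seteqP; split=> x /=; rewrite in_itv/=.
    apply: measurableI; first exact: measurable_cube.
    by rewrite -[X in measurable X]setTI; apply: (weight_nnmeas wv).1.
  have : (mu (cube c l) <= mu (Bw `|` Ba `|` Bv `|` N))%E.
    apply: le_measure; rewrite ?inE//; first exact: measurable_cube.
      by do 3 apply: measurableU => //.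
    move=> x cx; apply: contrapT => hx; apply: hno; exists x; split=> // h; apply: hx.
    - by do 3 left.
    - by do 2 left; right.
    - by left; right.
    - by right.
  apply/negP; rewrite -ltNge cube_volume ?ltW//.
  have /le_lt_trans : (mu (Bw `|` Ba `|` Bv `|` N) <= mu Bw + mu Ba + mu Bv + mu N)%E.
    have mwa : measurable (Bw `|` Ba) by exact: measurableU.
    have mwav : measurable (Bw `|` Ba `|` Bv) by exact: measurableU.
    apply: (le_trans (measureU2 mu mwav mN)); rewrite leeD2r//.
    by apply: (le_trans (measureU2 mu mwa mBv)); rewrite leeD2r// measureU2.
  apply; rewrite N0 adde0.
  apply: (@le_lt_trans _ _ ((th * l ^+ d)%:E + (th * l ^+ d)%:E + (th * l ^+ d)%:E)%E).
    by rewrite leeD// leeD.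
  by rewrite -!EFinD lte_fin /th; lra.
have hx : a x `^ (p - 1) * v x = w x `^ p.
  by apply: contrapT => h; apply: nN; apply: sN.
have [_ w0 _ _] := ww; have [_ a0 _ _] := wa; have [_ v0 _ _] := wv.
have wx : w x <= cmass w c l / (th * l ^+ d).
  by rewrite leNgt; apply/negP => h; exact: nBw.
have ax : ka * (cmass a c l / l ^+ d) <= a x.
  rewrite leNgt; apply/negP => h; apply: nBa; split => //.
  by rewrite (lt_le_trans h)// /ka le_eqVlt; apply/orP; left; apply/eqP; field; rewrite ?gt_eqF.
have vx : kv * (cmass v c l / l ^+ d) <= v x.
  rewrite leNgt; apply/negP => h; apply: nBv; split => //.
  by rewrite (lt_le_trans h)// /kv le_eqVlt; apply/orP; left; apply/eqP; field; rewrite ?gt_eqF.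
have ma := cmass_gt0 c wa l0; have mv := cmass_gt0 c wv l0; have mw := cmass_gt0 c ww l0.
have h1 : (ka * (cmass a c l / l ^+ d)) `^ (p - 1) * (kv * (cmass v c l / l ^+ d)) <=
   (cmass w c l / (th * l ^+ d)) `^ p.
  apply: (@le_trans _ _ (a x `^ (p - 1) * v x)).
    apply: ler_pM => //; first exact: powR_ge0.
      by apply: mulr_ge0; [exact: ltW|rewrite divr_ge0// ltW].
    apply: ge0_ler_powR => //; first exact: ltW.
      by rewrite nnegrE; apply: mulr_ge0; [exact: ltW|rewrite divr_ge0// ltW].
    by rewrite nnegrE.
  rewrite hx; apply: ge0_ler_powR; rewrite ?nnegrE//; first exact: (ltW (lt_trans ltr01 p1)).
  by rewrite divr_ge0 ?mulr_ge0// ltW.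
set K := l ^+ d in ld0 h1.
pose X := (K^-1) `^ (p - 1) * K^-1.
have X0 : 0 < X by rewrite mulr_gt0 ?powR_gt0 ?invr_gt0.
have XE : X = K^-1 `^ p.
  rewrite /X -[in X in _ * X = _](@powRr1 _ K^-1) ?invr_ge0 ?ltW//.
  by rewrite -powRD ?subrK// invr_eq0 (gt_eqF ld0) implybT.
have kap : 0 < ka `^ (p - 1) * kv by rewrite mulr_gt0// powR_gt0.
rewrite [leRHS]mulrAC ler_pdivlMr// -(ler_pM2r X0).
move: h1; congr (_ <= _); last first.
  have -> : cmass w c l / (th * K) = th^-1 * cmass w c l * K^-1.
    by rewrite invfM mulrA (mulrC (cmass w c l)).
  rewrite powRM ?invr_ge0 ?(ltW ld0)// ?XE ?mulr_ge0 ?(ltW mw)//.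
  by rewrite powRM ?(ltW mw)// invr_ge0 ltW.
  by rewrite invr_ge0 ltW.
rewrite [ka * _]mulrA powRM ?invr_ge0 ?(ltW ld0)//; last by rewrite mulr_ge0// ltW.
by rewrite powRM ?ltW// /X; ring.
Qed.
End cubes.

(** * Dyadic cubes *)

Section density.
Context {dT : measure_display} {T : measurableType dT} {R : realType}.
Variables (mu : {measure set T -> \bar R}) (f : T -> R) (nf : nnmeas f).

(** [mass mu f] as a measure, so that subadditivity and the Borel-Cantelli lemma
    apply to it.  The proof is an argument so that the measure structure can be
    inferred from the term. *)
Definition density_measure of nnmeas f := mass mu f.

Local Notation nu := (density_measure nf).

Let nu0 : nu set0 = 0%E.
Proof. exact: mass_set0. Qed.

Let nu_ge0 A : (0 <= nu A)%E.
Proof. exact: mass_ge0. Qed.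

Let nu_sigma_additive : semi_sigma_additive nu.
Proof.
apply: semi_sigma_additive_nng_induced; first exact: nnmeas_mEFin.
by move=> x; rewrite lee_fin; exact: nf.2.
Qed.

HB.instance Definition _ := isMeasure.Build _ _ _ nu nu0 nu_ge0 nu_sigma_additive.
End density.

Section dyadic.
Context {R : realType} {d : nat}.
Local Notation mu := (lebesgue_rV R d).
Local Notation Rd := 'rV[R]_d.
Implicit Types (f g a : Rd -> R) (x y c : Rd) (l lam : R) (E A : set Rd) (m n : int).

Lemma floor_divn_eq (s t : R) (N : nat) : (0 < N)%N ->
  Num.floor s = Num.floor t ->
  Num.floor (s / N%:R) = Num.floor (t / N%:R).
Proof.
move=> N0 st; apply: floor_def.
have N0' : 0 < N%:R :> R by rewrite ltr0n.
have h := floor_itv (t / N%:R); move: h; set M := Num.floor _ => /andP[h1 h2].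
apply/andP; split.
  move: h1; rewrite !ler_pdivlMr// -[N%:R]/((N : int)%:~R) -intrM.
  by rewrite -!floor_ge_int st.
move: h2; rewrite !ltr_pdivrMr// -[N%:R]/((N : int)%:~R) -intrM.
by rewrite -!floor_lt_int st.
Qed.

(** The index of the dyadic cube of side [2 ^ (- n)] containing [x].  Indices [n] are
    integers because arbitrarily large cubes are needed as well as small ones. *)
Definition grid n x : 'rV[int]_d := \row_i Num.floor (x ord0 i * 2 ^ n).

(** Half-open dyadic cubes, encoded as the fibres of [grid n]; that two of them are
    nested or disjoint is then a statement about integer parts. *)
Definition dyadic n x : set Rd := [set y | grid n y = grid n x].

Lemma dyadic_eq n x y : dyadic n x y -> dyadic n y = dyadic n x.
Proof. by rewrite /dyadic/= => ->. Qed.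

Lemma dyadic_sub m n x : m <= n -> dyadic n x `<=` dyadic m x.
Proof.
move=> mn y; rewrite /dyadic/= => /rowP h; apply/rowP => i.
have := h i; rewrite !mxE => {}h.
have [k nmk] : exists k : nat, n = m + k%:Z.
  by exists `|n - m|%N; rewrite gez0_abs ?subr_ge0// subrKC.
have E (t : R) : t * 2 ^ m = (t * 2 ^ n) / (2 ^ k)%N%:R.
  rewrite nmk expfzDr// mulrA natrX mulfK//.
by rewrite !E; apply: floor_divn_eq => //; rewrite expn_gt0.
Qed.

Lemma grid_mono m n x y : m <= n -> grid n x = grid n y -> grid m x = grid m y.
Proof. by move=> mn xy; apply: (dyadic_sub mn). Qed.

Lemma measurable_grid n (S : set 'rV[int]_d) : measurable (grid n @^-1` S).
Proof.
rewrite (_ : _ @^-1` _ = \bigcup_(k in S) [set x | grid n x = k]); last first.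
  apply/seteqP; split=> x /=; first by move=> Sx; exists (grid n x).
  by move=> [k Sk /= ->].
rewrite bigcup_mkcond; apply: countable_bigcupT_measurable => [|k].
  exact: countableP.
case: ifPn => // _.
rewrite (_ : mkset _ = \bigcap_(i in [set: 'I_d])
     ((fun x : 'rV[R]_d => x ord0 i) @^-1`
        `[(k ord0 i)%:~R / 2 ^ n, (k ord0 i + 1)%:~R / 2 ^ n[)); last first.
  have p0 : 0 < (2 : R) ^ n by rewrite exprz_gt0.
  apply/seteqP; split=> x /=.
    move=> /rowP h i _; have := h i; rewrite mxE => /eqP; rewrite floor_eq /=.
    by rewrite in_itv/= ler_pdivrMr// ltr_pdivlMr.
  move=> h; apply/rowP => i; have := h i I; rewrite mxE /= in_itv/=.
  by rewrite ler_pdivrMr// ltr_pdivlMr// => xi; exact: floor_def.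
apply: fin_bigcap_measurable => // i _.
by rewrite -[X in measurable X]setTI; apply: measurable_coord_rV.
Qed.

Lemma measurable_dyadic n x : measurable (dyadic n x).
Proof. exact: (measurable_grid n [set grid n x]). Qed.

Definition side n : R := 2 ^ (- n).

Definition center n x : Rd := \row_i (((grid n x ord0 i)%:~R + 2^-1) * side n).

Lemma side_gt0 n : 0 < side n.
Proof. by rewrite exprz_gt0. Qed.

Lemma sideB1 n : side (n - 1) = 2 * side n.
Proof. by rewrite /side opprB addrC expfzDr// mulrC. Qed.

Lemma sideE n (t : R) : t * 2 ^ n = t / side n.
Proof. by rewrite /side -invr_expz invrK. Qed.

Lemma dyadic_sub_cube n x : dyadic n x `<=` cube (center n x) (side n).
Proof.
move=> y; rewrite /dyadic/= /center => <- i; rewrite !mxE.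
have s0 := side_gt0 n.
have := floor_itv (y ord0 i * 2 ^ n); rewrite {2 3}sideE.
rewrite ler_pdivlMr// ltr_pdivrMr// => /andP[h1 h2].
rewrite ler_distl; move: h2; rewrite intrD => h2.
by apply/andP; split; lra.
Qed.

Lemma cube_sub_dyadic n x : cube (center n x) (side n / 2) `<=` dyadic n x.
Proof.
move=> y yc; apply/rowP => i; have := yc i; rewrite !mxE.
have s0 := side_gt0 n.
set k := Num.floor (x _ _ * _).
rewrite ler_distl => /andP[h1 h2]; apply: floor_def.
rewrite sideE ler_pdivlMr// ltr_pdivrMr// intrD.
by apply/andP; split; lra.
Qed.

(** Unions of dyadic cubes of generation [n]. *)
Definition saturated n A := forall x y, grid n x = grid n y -> A x -> A y.

Lemma measurable_saturated n A : saturated n A -> measurable A.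
Proof.
move=> sA; rewrite (_ : A = grid n @^-1` (grid n @` A)); first exact: measurable_grid.
apply/seteqP; split=> x /=; first by move=> Ax; exists x.
by move=> [y Ay /sA]; exact.
Qed.

Lemma saturated_mono m n A : m <= n -> saturated m A -> saturated n A.
Proof. by move=> mn sA x y /(grid_mono mn); exact: sA. Qed.

(** The index set of the cubes of one generation is countable, so the comparison
    may be summed over the cubes. *)
Lemma mass_saturated_le f g n A : nnmeas f -> nnmeas g -> saturated n A ->
  (forall x, A x -> (mass mu f (dyadic n x) <= mass mu g (dyadic n x))%E) ->
  (mass mu f A <= mass mu g A)%E.
Proof.
move=> nf ng sA fg.
pose B (k : nat) := [set x | A x /\ pickle (grid n x) = k].
have BE k x : B k x -> B k = dyadic n x.
  move=> [Ax xk]; apply/seteqP; split=> y /=.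
    move=> [Ay yk]; apply: (pcan_inj (@pickleK _)).
    by rewrite xk.
  move=> yx; split; first by apply: sA Ax.
  by rewrite yx.
have B0 k : B k = set0 \/ exists2 x, A x & B k = dyadic n x.
  have [->|/set0P[x Bx]] := eqVneq (B k) set0; first by left.
  by right; exists x; [case: Bx | exact: BE].
have mB k : measurable (B k).
  by have [->//|[x _ ->]] := B0 k; exact: measurable_dyadic.
have tB : trivIset setT B.
  apply/trivIsetP => i j _ _ /eqP ij; apply/seteqP; split=> // x [[_ xi] [_ xj]].
  by apply: ij; rewrite -xi.
have -> : A = \bigcup_k B k.
  apply/seteqP; split=> x /=; first by move=> Ax; exists (pickle (grid n x)).
  by move=> [k _ []].
rewrite !mass_bigcup//; apply: lee_nneseries => [k _ _|k _]; first exact: mass_ge0.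
by have [->|[x Ax ->]] := B0 k; [rewrite !mass_set0|exact: fg].
Qed.

Lemma ereal_cvg0_lt (u : nat -> \bar R) (e : R) : u @ \oo --> 0%E -> 0 < e ->
  exists N, forall k : nat, (N <= k)%N -> (u k < e%:E)%E.
Proof.
move=> u0 e0; have : \forall n \near \oo, (u n < e%:E)%E.
  by apply: (u0 [set y | (y < e%:E)%E]); exact: (@nbhs_open_ereal_lt R 0 (fun=> e)).
by move=> [N _ h]; exists N.
Qed.

(** * Comparing densities through dyadic cubes *)

Section approximation.
Variable nu : {measure set Rd -> \bar R}.
Hypothesis nu_fin : (nu setT < +oo)%E.

(** Approximability in [nu]-measure by unions of dyadic cubes of one generation.
    Such sets form a sigma-algebra, and half-spaces [r < x_i] are
    countable unions of such unions, so all Borel sets are approximable. *)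
Definition grid_approx E := measurable E /\ forall e : R, 0 < e ->
  exists n A, saturated n A /\ (nu (E `+` A) < e%:E)%E.

Let measurableY E A : measurable E -> measurable A -> measurable (E `+` A).
Proof. by move=> mE mA; apply: measurableU; exact: measurableD. Qed.

Lemma grid_approx_saturated n A : saturated n A -> grid_approx A.
Proof.
move=> sA; split; first exact: measurable_saturated sA.
by move=> e e0; exists n, A; split=> //; rewrite setYK measure0.
Qed.

Lemma grid_approxC E : grid_approx E -> grid_approx (~` E).
Proof.
move=> [mE aE]; split; first exact: measurableC.
move=> e /aE [n [A [sA EA]]]; exists n, (~` A); split.
  by move=> x y xy Ax Ay; apply: Ax; apply: sA Ay.
by rewrite (_ : ~` E `+` ~` A = E `+` A)// /setY !setDE !setCK setUC setIC (setIC A).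
Qed.

Lemma grid_approxU E F : grid_approx E -> grid_approx F -> grid_approx (E `|` F).
Proof.
move=> [mE aE] [mF aF]; split; first exact: measurableU.
move=> e e0; have e20 : 0 < e / 2 by rewrite divr_gt0.
have [n [A [sA EA]]] := aE _ e20; have [m [B [sB FB]]] := aF _ e20.
exists (Num.max n m), (A `|` B).
have mA := measurable_saturated sA; have mB := measurable_saturated sB.
have mEA := measurableY mE mA; have mFB := measurableY mF mB.
have nmax : n <= Num.max n m by rewrite le_max lexx.
have mmax : m <= Num.max n m by rewrite le_max lexx orbT.
split.
  move=> x y xy [Ax|Bx]; [left|right].
    exact: (saturated_mono nmax sA) xy Ax.
  exact: (saturated_mono mmax sB) xy Bx.
apply: (@le_lt_trans _ _ (nu ((E `+` A) `|` (F `+` B)))).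
  apply: le_measure; rewrite ?inE.
  - by apply: measurableY; exact: measurableU.
  - exact: measurableU.
  move=> x; rewrite /setY /=.
  by move: (EM (E x)) (EM (A x)) (EM (F x)) (EM (B x)); tauto.
apply: (le_lt_trans (measureU2 nu mEA mFB)).
by rewrite (splitr e) EFinD; exact: lteD.
Qed.

Lemma grid_approx_bigcup (E : nat -> set Rd) : (forall k, grid_approx (E k)) ->
  grid_approx (\bigcup_k E k).
Proof.
move=> aE; have mE k : measurable (E k) by case: (aE k).
have mbE : measurable (\bigcup_k E k) by exact: bigcupT_measurable.
split=> //; move=> e e0; have e20 : 0 < e / 2 by rewrite divr_gt0.
pose F N := \bigcup_(k < N) E k.
have mF N : measurable (F N) by exact: bigcup_measurable.
have aF N : grid_approx (F N).
  elim: N => [|N IH].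
    rewrite /F bigcup_mkord big_ord0; apply: (@grid_approx_saturated 0).
    by move=> x y _ [].
  by rewrite /F bigcup_mkord big_ord_recr/= -bigcup_mkord; exact: grid_approxU.
pose G N := \bigcup_k E k `\` F N.
have mG N : measurable (G N) by exact: measurableD.
have G0 : \bigcap_N G N = set0.
  apply/seteqP; split=> // x Gx.
  have [[k _ Ek] _] := Gx 0%N I.
  by have [_] := Gx k.+1 I; apply; exists k => /=.
have : nu \o G @ \oo --> nu (\bigcap_N G N).
  apply: nonincreasing_cvg_mu => //.
  - apply: le_lt_trans nu_fin; apply: le_measure; rewrite ?inE//.
  - by rewrite G0.
  - move=> m n mn; apply/subsetPset; apply: setDS => x [k /= km Ek].
    by exists k => //=; exact: leq_trans mn.
rewrite G0 measure0 => /ereal_cvg0_lt/(_ e20)[N /(_ N (leqnn N)) /= GN].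
have [_ /(_ _ e20)[n [A [sA FA]]]] := aF N.
exists n, A; split=> //.
have mA := measurable_saturated sA.
apply: (@le_lt_trans _ _ (nu (G N `|` (F N `+` A)))).
  apply: le_measure; rewrite ?inE.
  - exact: measurableY.
  - by apply: measurableU => //; exact: measurableY.
  have FE : F N `<=` \bigcup_k E k by move=> x [k _ Ek]; exists k.
  move=> x; rewrite /setY /G /= => -[[Ex nA]|[Ax nE]].
    by have [Fx|nF] := EM (F N x); [right; left|left].
  by right; right; split=> // /FE.
apply: (le_lt_trans (measureU2 nu (mG N) (measurableY (mF N) mA))).
by rewrite (splitr e) EFinD; exact: lteD.
Qed.

Lemma grid_approx_measurable E : measurable E -> grid_approx E.
Proof.
suff : measurable `<=` grid_approx by exact.
apply: smallest_sub.
  split=> /=.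
  - by apply: (@grid_approx_saturated 0) => x y _ [].
  - by move=> A aA; rewrite setTD; exact: grid_approxC.
  - exact: grid_approx_bigcup.
rewrite -bigcup_seq/=; apply: bigcup_sub => i _ B [Y mY <-]/=; rewrite setTI.
have {mY} : (RGenOInfty.G (R:=R)).-sigma.-measurable Y by rewrite -RGenOInfty.measurableE.
move: Y.
set P := [set Y : set R | grid_approx ((fun x : Rd => x ord0 i) @^-1` Y)].
suff : <<s RGenOInfty.G (R:=R) >> `<=` P by exact.
apply: smallest_sub.
  split; rewrite /P /=.
  - by rewrite preimage_set0; apply: (@grid_approx_saturated 0) => x y _ [].
  - by move=> A aA; rewrite setTD preimage_setC; exact: grid_approxC.
  - by move=> F aF; rewrite preimage_bigcup; exact: grid_approx_bigcup.
move=> _ [r ->]; rewrite /P /=.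
rewrite (_ : _ @^-1` _ = \bigcup_k [set x : Rd | r < (grid k%:Z x ord0 i)%:~R * side k%:Z]).
  apply: grid_approx_bigcup => k; apply: (@grid_approx_saturated k%:Z) => x y /= xy.
  by rewrite xy.
apply/seteqP; split=> x /=; rewrite in_itv/= andbT.
  move=> rx; have e0 : 0 < x ord0 i - r by rewrite subr_gt0.
  have [N _ /(_ N (leqnn N))] := near_infty_natSinv_expn_lt (PosNum e0).
  rewrite /= => h; exists N => //=; rewrite mxE.
  have s0 := side_gt0 N%:Z.
  have := floorD1_gt (x ord0 i * 2 ^ N%:Z).
  rewrite {1}sideE ltr_pdivrMr// intrD mulrDl mul1r.
  have : side N%:Z = 1 / 2 ^+ N by rewrite /side -invr_expz div1r.
  lra.
move=> [k _ /=]; rewrite mxE => /lt_le_trans; apply.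
have s0 := side_gt0 k%:Z.
by rewrite -ler_pdivlMr// -sideE floor_le.
Qed.

End approximation.

(** A substitute for the differentiation theorem.  The comparison extends from cubes
    to unions of cubes, hence by approximation to all measurable subsets of [G] in a
    bounded region, in particular to the set where [g < f]; on that set it forces
    [f - g] to have zero integral. *)
Lemma dyadic_ae_le f g (G : set Rd) : nnmeas f -> nnmeas g -> measurable G ->
  (mass mu f setT < +oo)%E ->
  (forall c l, mass mu g (cube c l) < +oo)%E ->
  (forall x n, G x -> (mass mu f (dyadic n x) <= mass mu g (dyadic n x))%E) ->
  {ae mu, forall x, G x -> f x <= g x}.
Proof.
move=> nf ng mG ff fg Gfg.
(* Boxes made of unit dyadic cubes, on which [g] has finite mass. *)
pose K (M : nat) : set Rd :=
  [set x | forall i, - M%:Z <= grid 0 x ord0 i < M%:Z].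
have sK M : saturated 0 (K M) by move=> x y xy Kx i; rewrite -xy; exact: Kx.
have mK M : measurable (K M) by exact: measurable_saturated (sK M).
have gK M : (mass mu g (K M) < +oo)%E.
  apply: le_lt_trans (fg 0 (2 * M%:R)); apply: mass_sub => //; first exact: measurable_cube.
  move=> x Kx i; have /andP[] := Kx i; rewrite !mxE expr0z mulr1 subr0.
  rewrite floor_ge_int floor_lt_int rmorphN/= => h1 h2.
  rewrite (_ : 2 * M%:R / 2 = M%:R); last by field.
  by rewrite ler_norml h1 ltW.
suff main M : {ae mu, forall x, (G `&` K M) x -> f x <= g x}.
  have : {ae mu, forall x, forall M, (G `&` K M) x -> f x <= g x} by exact/ae_foralln.
  apply: filterS => x h Gx.
  pose M := (\max_(i < d) `|grid 0 x ord0 i|).+1.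
  apply: (h M); split=> // i.
  have := @leq_bigmax _ (fun i => `|grid 0 x ord0 i|%N) i; rewrite -/M.
  rewrite -ltnS -/M -ltz_nat => hM.
  apply/andP; split; [rewrite lerNl; apply: ltW|]; apply: le_lt_trans hM.
    by rewrite abszE -normrN ler_norm.
  by rewrite abszE ler_norm.
pose h x := f x + \1_(K M) x * g x.
have nh : nnmeas h.
  apply: nnmeasD => //; apply: nnmeasM => //; exact: nnmeas_indic.
(* One finite measure controls the errors of both masses at once. *)
pose nu := density_measure mu nh.
have nuE E : measurable E -> nu E = (mass mu f E + mass mu g (E `&` K M))%E.
  move=> mE; rewrite /nu /density_measure massD// ?mass_patch//.
  by apply: nnmeasM => //; exact: nnmeas_indic.
have nufin : (nu setT < +oo)%E.
  by rewrite nuE// setTI; apply: lte_add_pinfty.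
have key E : measurable E -> E `<=` G `&` K M -> (mass mu f E <= mass mu g E)%E.
  move=> mE EGK; apply/lee_addgt0Pr => e e0.
  have e20 : 0 < e / 2 by rewrite divr_gt0.
  have [_ /(_ _ e20) [n [A [sA EA]]]] := grid_approx_measurable nufin mE.
  pose m := Num.max n 0.
  have nm : n <= m by rewrite le_max lexx.
  have m0 : 0 <= m by rewrite le_max lexx orbT.
  (* Only the cubes of [A] that meet [G] are kept, since the hypothesis compares
     no others. *)
  pose A' := [set x | [/\ A x, K M x & exists2 y, grid m y = grid m x & G y]].
  have sA' : saturated m A'.
    move=> x y xy [Ax Kx [z zx Gz]]; split.
    - exact: (saturated_mono nm sA) xy Ax.
    - exact: (saturated_mono m0 (sK M)) xy Kx.
    - by exists z => //; rewrite zx.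
  have mA := measurable_saturated sA; have mA' := measurable_saturated sA'.
  have h1 : (mass mu f A' <= mass mu g A')%E.
    apply: (mass_saturated_le nf ng sA') => x [_ _ [y yx Gy]].
    by rewrite -(dyadic_eq (y := y) (x := x))//; exact: Gfg.
  have sub1 : E `\` A' `<=` E `+` A.
    move=> x [Ex nA']; left; split=> // Ax; apply: nA'.
    by have [Gx Kx] := EGK _ Ex; split=> //; exists x.
  have sub2 : A' `\` E `<=` E `+` A by move=> x [[Ax _ _] nE]; right.
  have mY : measurable (E `+` A) by apply: measurableU; exact: measurableD.
  have hE : (mass mu f (E `\` A') <= (e / 2)%:E)%E.
    apply: le_trans (ltW EA); apply: (@le_trans _ _ (nu (E `\` A'))).
      rewrite nuE; last exact: measurableD.
      by rewrite leeDl// mass_ge0.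
    by apply: le_measure; rewrite ?inE//; exact: measurableD.
  have hA : (mass mu g (A' `\` E) <= (e / 2)%:E)%E.
    apply: le_trans (ltW EA); apply: (@le_trans _ _ (nu (A' `\` E))).
      rewrite nuE; last exact: measurableD.
      rewrite (_ : (A' `\` E) `&` K M = A' `\` E).
        by rewrite leeDr// mass_ge0.
      by apply/setIidl => x [[]].
    by apply: le_measure; rewrite ?inE//; exact: measurableD.
  rewrite (mass_split mu nf mE mA') (splitr e) EFinD (addeA (mass mu g E)).
  apply: leeD => //; apply: (@le_trans _ _ (mass mu f A')).
    by apply: mass_sub => //; exact: measurableI.
  apply: (le_trans h1); rewrite (mass_split mu ng mA' mE).
  by apply: leeD => //; apply: mass_sub => //; exact: measurableI.
pose E := G `&` K M `&` [set x | g x < f x].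
have mE : measurable E.
  apply: measurableI; first exact: measurableI.
  rewrite -[X in measurable X]setTI.
  have := measurable_fun_ltr ng.1 nf.1 measurableT; move/(_ [set true]); apply.
  by [].
have EK : E `<=` K M by move=> x [[]].
have gE : (mass mu g E < +oo)%E by apply: le_lt_trans (gK M); apply: mass_sub.
pose r x := Num.max (f x - g x) 0.
have nr : nnmeas r.
  split; last by move=> x; rewrite le_max lexx orbT.
  by apply: measurable_maxr => //; apply: measurable_funB; [exact: nf.1|exact: ng.1].
have rE : mass mu r E = 0%E.
  have : (mass mu g E + mass mu r E <= mass mu g E)%E.
    rewrite -massD//; apply: le_trans (key E mE _); last by move=> x [].
    rewrite le_eqVlt; apply/orP; left; apply/eqP; apply: eq_mass => x [_ /= gf].
    by rewrite /r (max_idPl _) ?subrKC// subr_ge0 ltW.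
  rewrite -[leRHS]adde0 leeD2lE; last by rewrite ge0_fin_numE// mass_ge0.
  by move=> h0; apply/eqP; rewrite eq_le h0 mass_ge0.
have : {ae mu, forall x, E x -> (r x)%:E = 0%E}.
  have : mass mu r E = 0%E by [].
  rewrite /mass; under eq_integral do rewrite -[r _]ger0_norm ?nr.2// -abse_EFin.
  by move/ae_eq_integral_abs => /(_ mE (nnmeas_mEFin nr)).
apply: filterS => x hx [Gx Kx]; rewrite leNgt; apply/negP => gf.
have : E x by [].
by move/hx => -[] /eqP; rewrite /r (max_idPl _) ?subr_eq0 ?gt_eqF// subr_ge0 ltW.
Qed.

(** * Calderon-Zygmund decomposition relative to a weight *)

Section growth.
Variables (q : R) (a : Rd -> R).
Hypotheses (d0 : (0 < d)%N) (q1 : 1 < q) (Aa : Ap q a).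

Let wa : weight a := Aa.1.
Let na : nnmeas a := weight_nnmeas wa.

(** The factor 16 covers both uses: from the half-size cube inside a dyadic cube to
    a cube around its parent (ratio 4) and to its dilation by 5 (ratio 10). *)
Lemma cmass_doubling : exists2 C : R, 0 < C & forall c l c' l',
  0 < l -> 0 < l' -> l' <= 16 * l -> cube c l `<=` cube c' l' ->
  cmass a c' l' <= C * cmass a c l.
Proof.
have t0 : 0 < (16 ^+ d)^-1 :> R by rewrite invr_gt0 exprn_gt0.
have [k k0 H] := Ap_lower_mass q1 Aa t0.
exists k^-1; first by rewrite invr_gt0.
move=> c l c' l' l0 l'0 ll' cc'.
rewrite ler_pdivlMl//.
have := H c' l' (cube c l) l'0 (measurable_cube c l) cc'.
rewrite (cube_volume _ (ltW l0)) cmassE// !lee_fin; apply.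
rewrite ler_pdivrMl ?exprn_gt0// -exprMn lerXn2r// nnegrE; first exact: ltW.
by rewrite mulr_ge0// ltW.
Qed.

Lemma dyadic_mass_fin m x : (mass mu a (dyadic m x) < +oo)%E.
Proof.
apply: (@le_lt_trans _ _ (mass mu a (cube (center m x) (side m)))).
  apply: mass_sub => //; [exact: measurable_dyadic|exact: measurable_cube|].
  exact: dyadic_sub_cube.
by rewrite cmassE// ltry.
Qed.

(** A cube occupies at most a fixed part of the second ancestor, whose remainder
    thus carries a fixed proportion of its mass.  Two generations are climbed
    because the volume of a dyadic cube is only bounded, from inside by the cube
    of half its side and from outside by the closed cube of its side. *)
Lemma dyadic_mass_growth_step : exists2 k : R, 0 < k & forall m x,
  (mass mu a (dyadic m x) + k%:E * mass mu a (dyadic (m - 2) x) <=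
   mass mu a (dyadic (m - 2) x))%E.
Proof.
have t0 : 0 < (2 ^+ d.+1)^-1 :> R by rewrite invr_gt0 exprn_gt0.
have [k k0 H] := Ap_lower_mass q1 Aa t0.
exists k => // m x.
set D := dyadic m x; set D' := dyadic (m - 2) x.
have DD' : D `<=` D' by apply: dyadic_sub; rewrite lerBlDr lerDl.
have mD : measurable D by exact: measurable_dyadic.
have mD' : measurable D' by exact: measurable_dyadic.
have mDD : measurable (D' `\` D) by exact: measurableD.
pose L := side (m - 2); pose c := center (m - 2) x.
have L0 : 0 < L by exact: side_gt0.
have Lm : side m = L / 4.
  rewrite /L (_ : m - 2 = m - 1 - 1) ?sideB1; last by rewrite -addrA.
  by field.
have D'c : D' `<=` cube c L by exact: dyadic_sub_cube.
have cD' : cube c (L / 2) `<=` D' by exact: cube_sub_dyadic.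
have vol : ((2 ^- d.+1 * L ^+ d)%:E <= mu (D' `\` D))%E.
  have h1 : ((L ^+ d / 2 ^+ d)%:E <= mu D')%E.
    apply: (@le_trans _ _ (mu (cube c (L / 2)))).
      by rewrite cube_volume ?expr_div_n// divr_ge0// ltW.
    by apply: le_measure; rewrite ?inE//; exact: measurable_cube.
  have h2 : (mu D <= (L ^+ d / 4 ^+ d)%:E)%E.
    apply: (@le_trans _ _ (mu (cube (center m x) (side m)))).
      by apply: le_measure; rewrite ?inE//; [exact: measurable_cube|exact: dyadic_sub_cube].
    by rewrite cube_volume ?Lm ?expr_div_n// divr_ge0// ltW.
  have h3 : (mu D' <= mu (D' `\` D) + mu D)%E.
    apply: le_trans (measureU2 mu mDD mD); apply: le_measure; rewrite ?inE//.
      exact: measurableU.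
    by move=> y D'y; have [|] := EM (D y); [right|left].
  have h4 : 2 ^- d.+1 * L ^+ d + L ^+ d / 4 ^+ d <= L ^+ d / 2 ^+ d.
    have -> : (4 : R) ^+ d = 2 ^+ d * 2 ^+ d by rewrite -exprMn; congr (_ ^+ _); ring.
    have p1 : (2 : R) <= 2 ^+ d by rewrite -[leLHS]expr1 ler_weXn2l// ler1n.
    have p0 : 0 < (2 : R) ^+ d by exact: exprn_gt0.
    have Ld0 : 0 < L ^+ d by exact: exprn_gt0.
    rewrite exprS -subr_ge0.
    have -> : L ^+ d / 2 ^+ d - ((2 * 2 ^+ d)^-1 * L ^+ d + L ^+ d / (2 ^+ d * 2 ^+ d)) =
      L ^+ d / 2 ^+ d / 2 / 2 ^+ d * (2 ^+ d - 2).
      by field; rewrite gt_eqF.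
    by rewrite mulr_ge0 ?subr_ge0// !divr_ge0// ltW.
  have D0 : (0 <= mu D)%E by exact: measure_ge0.
  have DD0 : (0 <= mu (D' `\` D))%E by exact: measure_ge0.
  have := le_trans h1 h3; move: h2 D0 DD0.
  case: (mu D) => [u| |]//; case: (mu (D' `\` D)) => [u'| |]//; rewrite ?leey//.
  by rewrite !lee_fin; lra.
have := H c L (D' `\` D) L0 mDD (fun y h => D'c y h.1) vol.
move=> h; rewrite [leRHS](mass_split mu na mD' mD).
apply: leeD; first by rewrite (setIidr DD').
apply: le_trans h; rewrite EFinM; apply: lee_wpmul2l; first by rewrite lee_fin ltW.
by rewrite -cmassE//; apply: mass_sub => //; exact: measurable_cube.
Qed.

Lemma dyadic_mass_gt0 m x : (0 < mass mu a (dyadic m x))%E.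
Proof.
apply: (@lt_le_trans _ _ (mass mu a (cube (center m x) (side m / 2)))).
  by rewrite cmassE// lte_fin cmass_gt0// divr_gt0// side_gt0.
apply: mass_sub => //; [exact: measurable_cube|exact: measurable_dyadic|].
exact: cube_sub_dyadic.
Qed.

Lemma dyadic_mass_le m n x : m <= n ->
  (mass mu a (dyadic n x) <= mass mu a (dyadic m x))%E.
Proof.
move=> mn; apply: mass_sub => //; try exact: measurable_dyadic.
exact: dyadic_sub.
Qed.

(** The masses of the ancestors of a point are unbounded, so that none of its large
    ancestors is selected and a maximal selected cube exists. *)
Lemma dyadic_mass_growth x (M : R) : exists m0 : int, forall m, m <= m0 ->
  (M%:E <= mass mu a (dyadic m x))%E.
Proof.
have [k k0 H] := dyadic_mass_growth_step.
pose al m := fine (mass mu a (dyadic m x)).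
have alE m : mass mu a (dyadic m x) = (al m)%:E.
  rewrite fineK// ge0_fin_numE ?dyadic_mass_fin//; exact/ltW/dyadic_mass_gt0.
have al0 : 0 < al 0 by rewrite -lte_fin -alE dyadic_mass_gt0.
have grow (j : nat) : (1 + j%:R * k) * al 0 <= al (- (2 * j)%N%:Z).
  elim: j => [|j IH]; first by rewrite mul0r addr0 mul1r muln0 oppr0.
  have -> : - (2 * j.+1)%N%:Z = - (2 * j)%N%:Z - 2.
    by rewrite mulnS addnC PoszD opprD.
  have := H (- (2 * j)%N%:Z) x; rewrite !alE -EFinM -EFinD lee_fin => h.
  apply: le_trans h; rewrite -natr1.
  have : al 0 <= al (- (2 * j)%N%:Z - 2).
    rewrite -lee_fin -!alE; apply: dyadic_mass_le.
    by rewrite -opprD oppr_le0.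
  move=> h; have : k * al 0 <= k * al (- (2 * j)%N%:Z - 2) by rewrite ler_wpM2l// ltW.
  rewrite mulrDl mul1r in IH *.
  move: IH; set u := al (- _); set u' := al (_ - 2); set z := al 0.
  by move=> IH h'; rewrite mulrDl mulrDl mul1r; lra.
have [j hj] : exists j : nat, M <= (1 + j%:R * k) * al 0.
  exists (Num.bound (`|M| / (k * al 0))).
  have ka0 : 0 < k * al 0 by rewrite mulr_gt0.
  have : `|M| / (k * al 0) < (Num.bound (`|M| / (k * al 0)))%:R.
    by apply: archi_boundP; rewrite divr_ge0// ltW.
  rewrite ltr_pdivrMr// mulrDl mul1r -mulrA => h.
  by have := ler_norm M; lra.
exists (- (2 * j)%N%:Z) => m mj; apply: le_trans (dyadic_mass_le x mj).
by rewrite alE lee_fin (le_trans hj).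
Qed.

Definition cz_selected (phi : Rd -> R) lam n x :=
  (lam%:E * mass mu a (dyadic n x) < mass mu phi (dyadic n x))%E.

(** The sets [D j] are the maximal selected dyadic cubes, indexed by a countable
    encoding with empty fillers.  The parent of such a cube is not selected, which
    with doubling gives the upper bound for the mass of [phi]; that the cube is
    selected gives the bound for the mass of its dilation. *)
Lemma cz_decomposition : exists2 C : R, 0 < C &
  forall (phi : Rd -> R) lam, nnmeas phi -> (mass mu phi setT < +oo)%E -> 0 < lam ->
  exists (D : nat -> set Rd) (c : nat -> Rd) (l : nat -> R),
  [/\ (forall j, measurable (D j)), trivIset setT D,
     (forall j, 0 < l j),
     (forall j, D j = set0 \/
       [/\ cube (c j) (l j / 2) `<=` D j, D j `<=` cube (c j) (l j),
           (mass mu phi (D j) <= (C * lam * cmass a (c j) (l j))%:E)%E &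
           ((lam * cmass a (c j) (5 * l j))%:E <= C%:E * mass mu phi (D j))%E]) &
     {ae mu, forall x, (~` \bigcup_j D j) x -> phi x <= lam * a x}].
Proof.
have [C C0 dbl] := cmass_doubling.
exists C => // phi lam nphi phifin lam0.
pose sel := cz_selected phi lam.
have selE n x y : grid n x = grid n y -> sel n x -> sel n y.
  by rewrite /sel /cz_selected /dyadic => ->.
(* The generation of the largest selected cube containing [x]. *)
pose first n x := sel n x /\ forall m, m < n -> ~ sel m x.
have firstE n x y : grid n x = grid n y -> first n x -> first n y.
  move=> xy [sx fx]; split; first exact: selE sx.
  move=> m mn sy; apply: (fx m mn); apply: selE sy.
  by apply/esym; apply: grid_mono xy; exact: ltW.
have first_uniq n m x : first n x -> first m x -> n = m.
  move=> [sn fn] [sm fm]; apply/eqP; rewrite eq_le !leNgt; apply/andP; split.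
    by apply/negP => /fn.
  by apply/negP => /fm.
have first_ex n x : sel n x -> exists m, first m x.
  move=> sn.
  have [m0 hm0] := dyadic_mass_growth x (fine (mass mu phi setT) / lam).
  have nsel m : m <= m0 -> ~ sel m x.
    move=> /hm0 h; apply/negP; rewrite /cz_selected -leNgt.
    apply: (@le_trans _ _ (mass mu phi setT)).
      by apply: mass_sub => //; exact: measurable_dyadic.
    have := lee_wpmul2l (ltW lam0 : (0 <= lam%:E)%E) h.
    rewrite -EFinM mulrC divfK ?gt_eqF// fineK// ge0_fin_numE//; exact: mass_ge0.
  have ex : exists k : nat, `[< sel (m0 + k%:Z) x >].
    exists `|n - m0|%N; apply/asboolP.
    have [h|h] := leP n m0; first by have := nsel n h.
    by rewrite gez0_abs ?subrKC// subr_ge0 ltW.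
  exists (m0 + (ex_minn ex)%:Z).
  case: ex_minnP => k /asboolP sk kmin; split=> // m mk sm.
  have [h|h] := leP m m0; first by have := nsel m h.
  have := kmin `|m - m0|%N.
  rewrite gez0_abs ?subr_ge0 ?(ltW h)// subrKC => /(_ (asboolT sm)).
  rewrite -lez_nat gez0_abs ?subr_ge0 ?(ltW h)// lerBrDl leNgt.
  by rewrite mk.
pose D (j : nat) := [set x | exists2 n, first n x & pickle (n, grid n x) = j].
have DE j x n : first n x -> pickle (n, grid n x) = j -> D j = dyadic n x.
  move=> fx xj; apply/seteqP; split=> y.
    move=> [m fy]; rewrite -xj => /(pcan_inj (@pickleK _)) [mn yx].
    by rewrite -mn /dyadic/= yx mn.
  move=> yx; exists n; first by apply: firstE fx; rewrite yx.
  by rewrite -xj yx.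
have D0 j : D j = set0 \/ exists n x, first n x /\ D j = dyadic n x.
  have [->|/set0P[x [n fx xj]]] := eqVneq (D j) set0; first by left.
  by right; exists n, x; split=> //; exact: DE xj.
have mD j : measurable (D j).
  by have [->//|[n [x [_ ->]]]] := D0 j; exact: measurable_dyadic.
have tD : trivIset setT D.
  apply/trivIsetP => i j _ _ /eqP ij; apply/seteqP; split=> // x [[n fn xi] [m fm xj]].
  by apply: ij; rewrite -xi -xj (first_uniq n m x).
have /choice[cl hcl] : forall j, exists cl : Rd * R, 0 < cl.2 /\ (D j = set0 \/
       [/\ cube cl.1 (cl.2 / 2) `<=` D j, D j `<=` cube cl.1 cl.2,
           (mass mu phi (D j) <= (C * lam * cmass a cl.1 cl.2)%:E)%E &
           ((lam * cmass a cl.1 (5 * cl.2))%:E <= C%:E * mass mu phi (D j))%E]).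
  move=> j; have [->|[n [x [[sx fx] DjE]]]] := D0 j.
    by exists (0, 1); split=> //; left.
  exists (center n x, side n); have s0 : 0 < side n :> R := side_gt0 n.
  split=> //=; right; rewrite DjE.
  have s20 : 0 < side n / 2 :> R by rewrite divr_gt0.
  have cD : cube (center n x) (side n / 2) `<=` dyadic n x by exact: cube_sub_dyadic.
  split=> //; first exact: dyadic_sub_cube.
    have := fx (n - 1); rewrite ltrBlDr ltrDl => /(_ isT) /negP; rewrite -leNgt.
    have DP : dyadic n x `<=` dyadic (n - 1) x by apply: dyadic_sub; rewrite lerBlDr lerDl.
    move=> h; apply: (@le_trans _ _ (mass mu phi (dyadic (n - 1) x))).
      by apply: mass_sub => //; exact: measurable_dyadic.
    apply: (le_trans h); rewrite (mulrC C) -mulrA EFinM.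
    apply: lee_wpmul2l; first by rewrite lee_fin ltW.
    apply: (@le_trans _ _ (mass mu a (cube (center (n - 1) x) (side (n - 1))))).
      apply: mass_sub => //; [exact: measurable_dyadic|exact: measurable_cube|].
      exact: dyadic_sub_cube.
    rewrite cmassE// lee_fin.
    apply: (@le_trans _ _ (C * cmass a (center n x) (side n / 2))).
      apply: dbl => //; first exact: side_gt0.
        by rewrite sideB1; lra.
      by move=> y /cD /DP /dyadic_sub_cube.
    rewrite ler_pM2l// -lee_fin -!cmassE//; apply: mass_sub => //; try exact: measurable_cube.
    by apply: cube_sub => i; rewrite subrr normr0; lra.
  apply: (@le_trans _ _ ((lam * (C * cmass a (center n x) (side n / 2)))%:E)).
    rewrite lee_fin ler_pM2l//; apply: dbl => //; [by rewrite mulr_gt0|by lra|].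
    by apply: cube_sub => i; rewrite subrr normr0; lra.
  rewrite mulrCA EFinM; apply: lee_wpmul2l; first by rewrite lee_fin ltW.
  rewrite EFinM -cmassE//; apply: le_trans (ltW sx); apply: lee_wpmul2l.
    by rewrite lee_fin ltW.
  by apply: mass_sub => //; [exact: measurable_cube|exact: measurable_dyadic].
exists D, (fun j => (cl j).1), (fun j => (cl j).2); split=> //.
- by move=> j; case: (hcl j).
- by move=> j; case: (hcl j).
apply: dyadic_ae_le => //.
- by apply: nnmeasZ => //; exact: ltW.
- by apply: measurableC; exact: bigcupT_measurable.
- move=> c l; rewrite massZ ?(ltW lam0)//; last exact: measurable_cube.
  by rewrite cmassE// ltry.
move=> x n nD; rewrite leNgt; apply/negP.
rewrite massZ ?(ltW lam0)//; last exact: measurable_dyadic.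
move=> /first_ex[m fm]; apply: nD; exists (pickle (m, grid m x)) => //.
by exists m.
Qed.

End growth.

End dyadic.

(** * Extended real sequences tending to zero *)

Section tends0.
Context {R : realType}.
Implicit Types u v : nat -> \bar R.

(** Convergence to zero of nonnegative sequences in a form stable under majoration,
    without reference to filters. *)
Definition tends0 u := forall e : R, 0 < e ->
  exists N, forall n, (N <= n)%N -> (u n <= e%:E)%E.

Lemma tends0P u : (forall n, 0 <= u n)%E -> u @ \oo --> 0%E <-> tends0 u.
Proof.
move=> u0; split.
  move=> h e e0; have [N hN] := ereal_cvg0_lt h e0.
  by exists N => n /hN/ltW.
move=> h; apply/fine_cvgP; split.
  have [N hN] := h 1 ltr01; exists N => // n /= /hN un.
  by rewrite ge0_fin_numE// (le_lt_trans un)// ltry.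
apply/cvgrPdist_le => e e0; have [N hN] := h e e0; exists N => // n /= /hN un.
rewrite sub0r normrN ger0_norm ?fine_ge0//.
by rewrite -lee_fin fineK// ge0_fin_numE// (le_lt_trans un)// ltry.
Qed.

Lemma tends0_le u v : (forall n, u n <= v n)%E -> tends0 v -> tends0 u.
Proof.
move=> uv h e e0; have [N hN] := h e e0; exists N => n /hN; exact: le_trans.
Qed.

Lemma tends0D u v : tends0 u -> tends0 v -> tends0 (fun n => u n + v n)%E.
Proof.
move=> hu hv e e0; have e20 : 0 < e / 2 by rewrite divr_gt0.
have [N hN] := hu _ e20; have [M hM] := hv _ e20; exists (maxn N M) => n.
rewrite geq_max => /andP[/hN h1 /hM h2].
by rewrite (splitr e) EFinD leeD.
Qed.

Lemma tends0Z (k : R) u : 0 <= k -> tends0 u -> tends0 (fun n => k%:E * u n)%E.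
Proof.
move=> k0 hu e e0; have k1 : 0 < k + 1 by rewrite ltr_wpDl.
have [N hN] := hu (e / (k + 1)) (divr_gt0 e0 k1); exists N => n /hN h.
apply: (@le_trans _ _ (k%:E * (e / (k + 1))%:E)%E).
  by apply: lee_wpmul2l => //; rewrite lee_fin.
rewrite -EFinM lee_fin mulrCA ger_pMr// ler_pdivrMr// mul1r.
by rewrite lerDl.
Qed.

Lemma tends0_sub u (k : nat -> nat) : (forall n, (n <= k n)%N) -> tends0 u ->
  tends0 (u \o k).
Proof.
move=> kn hu e e0; have [N hN] := hu e e0; exists N => n Nn.
by apply: hN; exact: leq_trans (kn n).
Qed.

Lemma expr2V_lt (e : R) : 0 < e -> exists N : nat, forall n, (N <= n)%N -> 2 ^- n <= e.
Proof.
move=> e0; have [N _ h] := near_infty_natSinv_expn_lt (PosNum e0).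
exists N => n Nn; have := h N (leqnn N); rewrite /= div1r => /ltW.
by apply: le_trans; rewrite lef_pV2 ?posrE ?exprn_gt0// ler_weXn2l// ler1n.
Qed.

End tends0.

(** * Moduli of complex numbers *)

Section normc.
Context {R : realType}.
Local Notation normc := (@Normc.normc R).
Local Notation Re := (@complex.Re R).
Local Notation Im := (@complex.Im R).
Implicit Types x y z : R[i].

Lemma normc_ge0 x : 0 <= normc x.
Proof. by case: x => a b; rewrite /= sqrtr_ge0. Qed.

Lemma normcDle x y : normc (x + y) <= normc x + normc y.
Proof. exact: (@le_normcD R x y). Qed.

Lemma cnormN x : normc (- x) = normc x.
Proof. exact: (@normcN R x). Qed.

Lemma normcBC x y : normc (x - y) = normc (y - x).
Proof. by rewrite -cnormN opprB. Qed.

Lemma normcBle x y : normc (x - y) <= normc x + normc y.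
Proof. by rewrite -(cnormN y) normcDle. Qed.

Lemma normc_tri x y z : normc (x - z) <= normc (x - y) + normc (y - z).
Proof. by rewrite (le_trans _ (normcDle _ _))// addrA subrK. Qed.

Lemma normc_rev x y : normc x - normc (y - x) <= normc y.
Proof.
rewrite lerBlDr normcBC addrC.
by rewrite -[X in normc X <= _](subrK y) normcDle.
Qed.

Lemma cnormE x : normc x = Num.sqrt (Re x ^+ 2 + Im x ^+ 2).
Proof. by case: x. Qed.

Lemma cReD x y : Re (x + y) = Re x + Re y. Proof. by case: x; case: y. Qed.
Lemma cImD x y : Im (x + y) = Im x + Im y. Proof. by case: x; case: y. Qed.
Lemma cReN x : Re (- x) = - Re x. Proof. by case: x. Qed.
Lemma cImN x : Im (- x) = - Im x. Proof. by case: x. Qed.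
Lemma cReM x y : Re (x * y) = Re x * Re y - Im x * Im y.
Proof. by case: x; case: y. Qed.
Lemma cImM x y : Im (x * y) = Re x * Im y + Im x * Re y.
Proof. by case: x; case: y. Qed.

Lemma Re_le_normc x : `|Re x| <= normc x.
Proof. by rewrite cnormE -sqrtr_sqr ler_wsqrtr// lerDl sqr_ge0. Qed.

Lemma Im_le_normc x : `|Im x| <= normc x.
Proof. by rewrite cnormE -sqrtr_sqr ler_wsqrtr// lerDr sqr_ge0. Qed.

Lemma normc_le_ReIm x : normc x <= `|Re x| + `|Im x|.
Proof.
rewrite cnormE -[leRHS]ger0_norm ?addr_ge0// -sqrtr_sqr ler_wsqrtr//.
rewrite sqrrD !real_normK ?num_real// -addrA lerD2l lerDr.
by rewrite mulrn_wge0// mulr_ge0.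
Qed.

(** The constant [2 ^ p] comes from bounding a sum by twice the maximum. *)
Lemma powR_normcD_le (p : R) x y : 0 <= p ->
  normc (x + y) `^ p <= 2 `^ p * (normc x `^ p + normc y `^ p).
Proof.
move=> p0; pose m := Num.max (normc x) (normc y).
have m0 : 0 <= m by rewrite le_max normc_ge0.
apply: (@le_trans _ _ ((2 * m) `^ p)).
  apply: ge0_ler_powR; rewrite ?nnegrE ?normc_ge0 ?mulr_ge0//.
  apply: (le_trans (normcDle _ _)); rewrite mulr_natl mulr2n.
  by rewrite lerD// le_max lexx// orbT.
rewrite powRM// ler_wpM2l ?powR_ge0// /m.
rewrite /Num.max; case: ifP => _; [rewrite lerDr|rewrite lerDl]; exact: powR_ge0.
Qed.

End normc.

(** * Weighted norms of complex functions *)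

Section Cmeasurable.
Context {R : realType} {d : nat}.
Local Notation mu := (lebesgue_rV R d).
Local Notation Rd := 'rV[R]_d.
Local Notation normc := (@Normc.normc R).
Implicit Types (w v : Rd -> R) (f g h : Rd -> R[i]) (E D : set Rd).

Lemma Cmeasurable_cst (z : R[i]) : Cmeasurable (fun _ : Rd => z).
Proof. by split. Qed.

Lemma CmeasurableD f g : Cmeasurable f -> Cmeasurable g ->
  Cmeasurable (fun x => f x + g x).
Proof.
move=> [rf jf] [rg ig]; split.
- by under eq_fun do rewrite cReD; exact: measurable_funD.
- by under eq_fun do rewrite cImD; exact: measurable_funD.
Qed.

Lemma CmeasurableN f : Cmeasurable f -> Cmeasurable (fun x => - f x).
Proof.
move=> [rf jf]; split.
- by under eq_fun do rewrite cReN; exact: measurable_funN.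
- by under eq_fun do rewrite cImN; exact: measurable_funN.
Qed.

Lemma CmeasurableB f g : Cmeasurable f -> Cmeasurable g ->
  Cmeasurable (fun x => f x - g x).
Proof. by move=> mf mg; apply: CmeasurableD => //; exact: CmeasurableN. Qed.

Lemma measurable_normc f : Cmeasurable f ->
  measurable_fun [set: Rd] (fun x => normc (f x)).
Proof.
move=> [rf jf]; under eq_fun do rewrite cnormE -powR12_sqrt ?addr_ge0 ?sqr_ge0//.
apply: (measurableT_comp (measurable_powR _)).
by apply: measurable_funD; exact: measurable_funX.
Qed.

Lemma nnmeas_normc f : Cmeasurable f -> nnmeas (fun x => normc (f x)).
Proof. by move=> mf; split; [exact: measurable_normc|move=> x; exact: normc_ge0]. Qed.

Definition cutoff E f : Rd -> R[i] := fun x => if x \in E then f x else 0.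

Lemma cutoffE E f x : E x -> cutoff E f x = f x.
Proof. by move=> Ex; rewrite /cutoff mem_set. Qed.

Lemma cutoff_out E f x : ~ E x -> cutoff E f x = 0.
Proof. by move=> Ex; rewrite /cutoff memNset. Qed.

Lemma normc_cutoff E f x : normc (cutoff E f x) = \1_E x * normc (f x).
Proof.
by rewrite /cutoff indicE; case: (x \in E); rewrite ?mul1r// mul0r Normc.normc0.
Qed.

Lemma Cmeasurable_cutoff E f : measurable E -> Cmeasurable f -> Cmeasurable (cutoff E f).
Proof.
move=> mE [rf jf]; split.
- rewrite (_ : (fun x => _) = (fun x => \1_E x * complex.Re (f x))).
    by apply: measurable_funM.
  by apply/funext => x; rewrite /cutoff indicE; case: (x \in E); rewrite ?mul1r ?mul0r.
- rewrite (_ : (fun x => _) = (fun x => \1_E x * complex.Im (f x))).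
    by apply: measurable_funM.
  by apply/funext => x; rewrite /cutoff indicE; case: (x \in E); rewrite ?mul1r ?mul0r.
Qed.

(** The p-th power of the norm of the restriction of [f] to [E] in L^p(w); powers
    are additive in [E] where norms are not. *)
Definition pmass (p : R) w f E : \bar R :=
  mass mu (fun x => normc (f x) `^ p * w x) E.

Definition nmass w f E : \bar R := mass mu (fun x => normc (f x) * w x) E.

Lemma nnmeas_pmass p w f : nnmeas w -> Cmeasurable f ->
  nnmeas (fun x => normc (f x) `^ p * w x).
Proof.
by move=> nw mf; apply: nnmeasM => //; apply: nnmeas_powR; exact: measurable_normc.
Qed.

Lemma nnmeas_nmass w f : nnmeas w -> Cmeasurable f ->
  nnmeas (fun x => normc (f x) * w x).
Proof. by move=> nw mf; apply: nnmeasM => //; exact: nnmeas_normc. Qed.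

Lemma wLnorm1E w f : nnmeas w -> Cmeasurable f -> wLnorm 1 w f = nmass w f setT.
Proof.
move=> nw mf; rewrite /wLnorm invr1 poweRe1.
  by apply: eq_mass => x _; rewrite powRr1// normc_ge0.
exact: (mass_ge0 mu setT (nnmeas_pmass 1 nw mf)).
Qed.

Lemma wLnorm_leP p w f (s : R) : 0 < p -> 0 <= s -> nnmeas w -> Cmeasurable f ->
  (wLnorm p w f <= s%:E)%E <-> (pmass p w f setT <= (s `^ p)%:E)%E.
Proof.
move=> p0 s0 nw mf; rewrite /wLnorm -/(mass mu (fun x => normc (f x) `^ p * w x) setT).
rewrite -/(pmass p w f setT).
have := mass_ge0 mu setT (nnmeas_pmass p nw mf); rewrite -/(pmass p w f setT).
case: (pmass p w f setT) => [t| |]//.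
  rewrite lee_fin => t0; rewrite poweR_EFin !lee_fin; split=> h.
    rewrite -[leLHS]powRr1// -[in leLHS](mulVf (x := p)) ?gt_eqF// powRrM.
    by apply: ge0_ler_powR => //; [exact: ltW|rewrite nnegrE powR_ge0].
  rewrite -[leRHS]powRr1// -[in leRHS](divff (x := p)) ?gt_eqF// powRrM.
  by apply: ge0_ler_powR => //; rewrite ?nnegrE ?powR_ge0// invr_ge0 ltW.
by rewrite poweRyr ?invr_eq0 ?gt_eqF.
Qed.

Lemma nmassD w f g E : nnmeas w -> Cmeasurable f -> Cmeasurable g -> measurable E ->
  (nmass w (fun x => f x + g x)%R E <= nmass w f E + nmass w g E)%E.
Proof.
move=> nw mf mg mE; rewrite /nmass -massD//; try exact: nnmeas_nmass.
apply: mass_le => //.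
- by apply: nnmeas_nmass => //; exact: CmeasurableD.
- by apply: nnmeasD; exact: nnmeas_nmass.
- by move=> x _; rewrite -mulrDl ler_wpM2r ?nw.2// normcDle.
Qed.

Lemma nmassN w f E : nmass w (fun x => - f x) E = nmass w f E.
Proof. by apply: eq_mass => x _; rewrite cnormN. Qed.

Lemma nmassBC w f g E : nmass w (fun x => f x - g x) E = nmass w (fun x => g x - f x) E.
Proof. by apply: eq_mass => x _; rewrite normcBC. Qed.

Lemma nmassB w f g E : nnmeas w -> Cmeasurable f -> Cmeasurable g -> measurable E ->
  (nmass w (fun x => f x - g x)%R E <= nmass w f E + nmass w g E)%E.
Proof.
by move=> nw mf mg mE; rewrite -(nmassN w g); apply: nmassD => //; exact: CmeasurableN.
Qed.

Lemma nmass_ge0 w f E : nnmeas w -> Cmeasurable f -> (0 <= nmass w f E)%E.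
Proof. by move=> nw mf; apply: mass_ge0; exact: nnmeas_nmass. Qed.

Lemma nmass_cutoff w f E : measurable E -> nmass w (cutoff E f) setT = nmass w f E.
Proof.
move=> mE; rewrite /nmass -[in RHS](setTI E) -mass_patch//.
by apply: eq_mass => x _; rewrite normc_cutoff mulrA.
Qed.

Lemma pmassD p w f g E : 0 <= p -> nnmeas w -> Cmeasurable f -> Cmeasurable g ->
  measurable E ->
  (pmass p w (fun x => f x + g x)%R E <= (2 `^ p)%:E * (pmass p w f E + pmass p w g E))%E.
Proof.
move=> p0 nw mf mg mE; have nf := nnmeas_pmass p nw mf; have ng := nnmeas_pmass p nw mg.
rewrite /pmass -massD// -massZ ?powR_ge0//; last exact: nnmeasD.
apply: mass_le => //.
- by apply: nnmeas_pmass => //; exact: CmeasurableD.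
- by apply: nnmeasZ; [exact: powR_ge0|exact: nnmeasD].
- by move=> x _; rewrite -mulrDl mulrA ler_wpM2r ?nw.2// powR_normcD_le.
Qed.

Lemma pmassN p w f E : pmass p w (fun x => - f x) E = pmass p w f E.
Proof. by apply: eq_mass => x _; rewrite cnormN. Qed.

(** The lower limit is spelled out pointwise, in real numbers, which is the form in
    which the convergence statements below deliver it. *)
Lemma mass_fatou (phi_ : nat -> Rd -> R) (phi : Rd -> R) E (M : \bar R) :
  (forall n, nnmeas (phi_ n)) -> nnmeas phi -> measurable E ->
  {ae mu, forall x, E x -> forall r, r < phi x ->
    exists N, forall n, (N <= n)%N -> r <= phi_ n x} ->
  (forall n, mass mu (phi_ n) E <= M)%E -> (mass mu phi E <= M)%E.
Proof.
move=> nphi_ nphi mE h hM.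
pose F n x := (phi_ n x)%:E.
have mF n : measurable_fun E (F n) by exact: nnmeas_mEFin.
have F0 n x : E x -> (0 <= F n x)%E by move=> _; rewrite lee_fin; exact: (nphi_ n).2.
have liminf_ge0 x : E x -> (0 <= limn_einf (F ^~ x))%E.
  move=> Ex; rewrite limn_einf_lim; apply: lime_ge; first exact: is_cvg_einfs.
  by apply: nearW => n; apply: le_ereal_inf_tmp => _ [m /= _ <-]; exact: F0.
apply: (@le_trans _ _ (\int[mu]_(x in E) limn_einf (F ^~ x))%E).
  apply: ae_ge0_le_integral => //.
  - by move=> x _; rewrite lee_fin; exact: nphi.2.
  - exact: nnmeas_mEFin.
  - rewrite (_ : (fun x => _) = (fun x => - limn_esup (\- (F ^~ x)))%E)//.
    apply: measurableT_comp => //; apply: measurable_fun_limn_esup => n.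
    by apply: measurableT_comp.
  apply: filterS h => x hx Ex; apply/lee_subgt0Pr => e e0.
  have [|N hN] := hx Ex (phi x - e); first by rewrite ltrBlDr ltrDl.
  rewrite limn_einf_lim; apply: lime_ge; first exact: is_cvg_einfs.
  exists N => // n /= Nn; apply: le_ereal_inf_tmp => _ [m /= nm <-].
  by rewrite -EFinB lee_fin; apply: hN; exact: leq_trans nm.
apply: le_trans (fatou mu mE mF F0) _.
rewrite limn_einf_lim; apply: lime_le; first exact: is_cvg_einfs.
apply: nearW => n; apply: le_trans (hM n); apply: ereal_inf_lbound.
by exists n => //=.
Qed.

Definition ccvg (z_ : nat -> R[i]) (z : R[i]) := forall e : R, 0 < e ->
  exists N, forall n, (N <= n)%N -> normc (z_ n - z) <= e.

Lemma pmass_fatou p w (h_ : nat -> Rd -> R[i]) h E (M : \bar R) : 0 < p -> nnmeas w ->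
  (forall n, Cmeasurable (h_ n)) -> Cmeasurable h -> measurable E ->
  {ae mu, forall x, E x -> ccvg (fun n => h_ n x) (h x)} ->
  (forall n, pmass p w (h_ n) E <= M)%E -> (pmass p w h E <= M)%E.
Proof.
move=> p0 nw mh_ mh mE hcvg hM.
apply: mass_fatou hM => //; first by move=> n; exact: nnmeas_pmass.
  exact: nnmeas_pmass.
apply: filterS hcvg => x hx Ex r.
have [r0|r0] := leP r 0.
  move=> _; exists 0%N => n _; apply: (le_trans r0).
  by rewrite mulr_ge0 ?powR_ge0 ?nw.2.
move=> rl; have w0 : 0 < w x.
  rewrite lt_def nw.2 andbT; apply/eqP => w0; move: rl.
  by rewrite w0 mulr0 ltNge (ltW r0).
pose t := (r / w x) `^ p^-1.
have tp : t `^ p = r / w x.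
  by rewrite -powRrM mulVf ?gt_eqF// powRr1// divr_ge0// ltW.
have tlt : t < normc (h x).
  rewrite ltNge; apply/negP => le; move: rl; rewrite -ltr_pdivrMr// -tp ltNge.
  move=> /negP; apply; apply: ge0_ler_powR; rewrite ?nnegrE ?powR_ge0 ?normc_ge0 ?(ltW p0)//.
have e0 : 0 < normc (h x) - t by rewrite subr_gt0.
have [N hN] := hx Ex _ e0; exists N => n /hN hn.
rewrite -ler_pdivrMr// -tp; apply: ge0_ler_powR; rewrite ?nnegrE ?powR_ge0 ?normc_ge0 ?(ltW p0)//.
apply: le_trans (normc_rev (h x) _).
by rewrite lerBrDr -lerBrDl.
Qed.

Lemma nmass_pmass w f E : nmass w f E = pmass 1 w f E.
Proof. by apply: eq_mass => x _; rewrite powRr1 ?normc_ge0. Qed.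

End Cmeasurable.

(** * Weak L^1 *)

Lemma cvg_small_steps (R : realType) (a : nat -> R) N :
  (forall n, (N <= n)%N -> `|a n.+1 - a n| <= 2 ^- n) -> cvgn a.
Proof.
move=> h; pose b n := a (n + N)%N.
suff : cvgn b.
  by move=> /cvg_ex[l bl]; apply/cvg_ex; exists l; move: bl; rewrite /b cvg_shiftn.
rewrite (_ : b = (fun n => b 0%N + series (telescope b) n)); last first.
  by apply/funext => n; exact: eq_sum_telescope.
apply: is_cvgD; first exact: is_cvg_cst.
apply: (@normed_cvg R R^o); apply: series_le_cvg (is_cvg_geometric_series (a := 1) (z := 2^-1) _) => //.
- by move=> n; rewrite /=.
- by move=> n; rewrite /geometric/= mul1r exprn_ge0// invr_ge0.
- move=> n; rewrite /geometric/= mul1r /telescope /b exprVn.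
  apply: le_trans (h _ _) _; first exact: leq_addl.
  by rewrite lef_pV2 ?posrE ?exprn_gt0// ler_weXn2l ?ler1n// leq_addr.
- by rewrite ger0_norm ?invr_ge0// invf_lt1// ltr1n.
Qed.

Lemma ccvg_ReIm (R : realType) (z_ : nat -> R[i]) (a b : R) :
  (fun n => complex.Re (z_ n)) @ \oo --> a -> (fun n => complex.Im (z_ n)) @ \oo --> b ->
  ccvg z_ (Complex a b).
Proof.
move=> za zb e e0; have e20 : 0 < e / 2 by rewrite divr_gt0.
move/cvgrPdist_le/(_ _ e20) : za => [N _ hN].
move/cvgrPdist_le/(_ _ e20) : zb => [M _ hM].
exists (maxn N M) => n; rewrite geq_max => /andP[/hN/= h1 /hM/= h2].
apply: (le_trans (normc_le_ReIm _)).
by rewrite cReD cImD cReN cImN/= (splitr e) distrC (distrC _ b) lerD.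
Qed.

Lemma nneseries_exp2V (R : realType) : (\sum_(0 <= n <oo) (2 ^- n : R)%:E = 2%:E)%E.
Proof.
have := @cvg_geometric_eseries_half R 2 0; rewrite expr0 divr1 => /cvg_lim <-//.
congr (limn _); apply/funext => n; apply: eq_bigr => k _; congr EFin.
by rewrite addn1 natrX exprS; field; rewrite expf_neq0.
Qed.

Section weak.
Context {R : realType} {d : nat}.
Local Notation mu := (lebesgue_rV R d).
Local Notation Rd := 'rV[R]_d.
Local Notation normc := (@Normc.normc R).
Implicit Types (w v : Rd -> R) (f g h : Rd -> R[i]) (E D : set Rd).

Definition superlevel f (l : R) : set Rd := [set x | l < normc (f x)].

Lemma measurable_superlevel f l : Cmeasurable f -> measurable (superlevel f l).
Proof.
move=> mf; rewrite (_ : superlevel f l = (fun x => normc (f x)) @^-1` `]l, +oo[).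
  by rewrite -[X in measurable X]setTI; exact: measurable_normc.
by apply/seteqP; split=> x /=; rewrite in_itv/= andbT.
Qed.

Lemma weak_leP w f (M : \bar R) : (weakL1norm w f <= M)%E <->
  forall l, 0 < l -> (l%:E * mass mu w (superlevel f l) <= M)%E.
Proof.
split=> [h l l0|h].
  by apply: le_trans h; apply: ereal_sup_ubound; exists l.
by apply: ge_ereal_sup => _ [l /= l0 <-]; exact: h.
Qed.

Lemma weak_ge0 w f : nnmeas w -> (0 <= weakL1norm w f)%E.
Proof.
move=> nw; apply: (@le_trans _ _ (1%:E * mass mu w (superlevel f 1))%E).
  by rewrite mul1e mass_ge0.
by move/weak_leP : (lexx (weakL1norm w f)); apply.
Qed.

Lemma mass_aesub (phi : Rd -> R) E D : nnmeas phi -> measurable E -> measurable D ->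
  {ae mu, forall x, E x -> D x} -> (mass mu phi E <= mass mu phi D)%E.
Proof.
move=> nphi mE mD ED; rewrite -(setTI E) -(setTI D) -!mass_patch//.
apply: mass_aele => //; try by apply: nnmeasM => //; exact: nnmeas_indic.
apply: filterS ED => x hx _; rewrite ler_wpM2r ?nphi.2// !indicE.
have [Ex|] := boolP (x \in E); last by rewrite ler0n.
by rewrite mem_set//; apply: hx; exact: set_mem.
Qed.

Lemma weak_ae_le w f g : nnmeas w -> Cmeasurable f -> Cmeasurable g ->
  {ae mu, forall x, normc (f x) <= normc (g x)} -> (weakL1norm w f <= weakL1norm w g)%E.
Proof.
move=> nw mf mg fg; apply/weak_leP => l l0.
apply: (@le_trans _ _ (l%:E * mass mu w (superlevel g l))%E).
  apply: lee_wpmul2l; first by rewrite lee_fin ltW.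
  apply: mass_aesub => //; [exact: measurable_superlevel|exact: measurable_superlevel|].
  by apply: filterS fg => x hx /lt_le_trans; exact.
by move/weak_leP : (lexx (weakL1norm w g)); apply.
Qed.

(** Weak L^1 is only quasi-normed: a sum exceeds [l] only if one of the terms exceeds
    [l / 2], whence the factor 2. *)
Lemma weak_ae_leD w f g h : nnmeas w -> Cmeasurable f -> Cmeasurable g ->
  Cmeasurable h -> {ae mu, forall x, normc (f x) <= normc (g x) + normc (h x)} ->
  (weakL1norm w f <= 2%:E * (weakL1norm w g + weakL1norm w h))%E.
Proof.
move=> nw mf mg mh fgh; apply/weak_leP => l l0.
have l20 : 0 < l / 2 by rewrite divr_gt0.
have mG := measurable_superlevel (l / 2) mg.
have mH := measurable_superlevel (l / 2) mh.
apply: (@le_trans _ _ (l%:E * (mass mu w (superlevel g (l / 2)) +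
                              mass mu w (superlevel h (l / 2))))%E).
  apply: lee_wpmul2l; first by rewrite lee_fin ltW.
  apply: (@le_trans _ _ (mass mu w (superlevel g (l / 2) `|` superlevel h (l / 2)))).
    apply: mass_aesub => //; [exact: measurable_superlevel|exact: measurableU|].
    apply: filterS fgh => x hx; rewrite /superlevel /= => lf.
    have [gl|gl] := ltP (l / 2) (normc (g x)); [by left|right].
    by have := lt_le_trans lf hx; lra.
  exact: (measureU2 (density_measure mu nw)).
rewrite (_ : l%:E = 2%:E * (l / 2)%:E)%E; last by rewrite -EFinM; congr EFin; field.
rewrite -muleA ge0_muleDr ?mass_ge0//; apply: lee_wpmul2l => //.
apply: leeD.
  by move/weak_leP : (lexx (weakL1norm w g)); apply.
by move/weak_leP : (lexx (weakL1norm w h)); apply.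
Qed.

Lemma weak_le_nmass w f : nnmeas w -> Cmeasurable f ->
  (weakL1norm w f <= nmass w f setT)%E.
Proof.
move=> nw mf; apply/weak_leP => l l0; have mF := measurable_superlevel l mf.
rewrite -massZ ?(ltW l0)//; apply: (@le_trans _ _ (nmass w f (superlevel f l))).
  apply: mass_le => //; first by apply: nnmeasZ => //; exact: ltW.
    exact: nnmeas_nmass.
  by move=> x /ltW h; rewrite ler_wpM2r ?nw.2.
by apply: mass_sub => //; exact: nnmeas_nmass.
Qed.

(** Borel-Cantelli for the measure [w dx], brought back to Lebesgue measure by the
    positivity of [w]. *)
Lemma lim_sup_superlevel w (g_ : nat -> Rd -> R[i]) : weight w ->
  (forall n, Cmeasurable (g_ n)) ->
  (forall n, (mass mu w (superlevel (g_ n) (2 ^- n)) <= (2 ^- n)%:E)%E) ->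
  mu (lim_sup_set (fun n => superlevel (g_ n) (2 ^- n))) = 0%E.
Proof.
move=> ww mg hg; have nw := weight_nnmeas ww.
have mF n : measurable (superlevel (g_ n) (2 ^- n)) by exact: measurable_superlevel.
have [_ _ wp _] := ww.
apply: (mass_null_set nw _ wp).
  by apply: bigcap_measurable => // k _; exact: bigcup_measurable.
apply: (@lim_sup_set_cvg0 _ _ _ (density_measure mu nw)) => //.
apply: (@le_lt_trans _ _ (\sum_(0 <= n <oo) (2 ^- n : R)%:E)%E).
  by apply: lee_nneseries => [n _ _|n _]; [exact: mass_ge0|exact: hg].
by rewrite nneseries_exp2V ltry.
Qed.

Lemma not_lim_sup_superlevel (g_ : nat -> Rd -> R[i]) x :
  ~ lim_sup_set (fun n => superlevel (g_ n) (2 ^- n)) x ->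
  exists N, forall n, (N <= n)%N -> normc (g_ n x) <= 2 ^- n.
Proof.
move=> h; apply: contrapT => hno; apply: h => N _.
apply: contrapT => h; apply: hno; exists N => n Nn; rewrite leNgt; apply/negP => hn.
by apply: h; exists n.
Qed.

(** The rate [4 ^- n] splits evenly between the level and the mass, both summable. *)
Lemma weak_pow4 w f n : (weakL1norm w f <= (4 ^- n)%:E)%E ->
  (mass mu w (superlevel f (2 ^- n)) <= (2 ^- n)%:E)%E.
Proof.
move/weak_leP => /(_ (2 ^- n)); rewrite invr_gt0 exprn_gt0// => /(_ isT).
have -> : 4 ^- n = 2 ^- n * 2 ^- n :> R.
  by rewrite -!exprVn -exprMn; congr (_ ^+ _); field.
by rewrite EFinM lee_pmul2l// lte_fin invr_gt0 exprn_gt0.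
Qed.

Lemma pow4_tends0 : tends0 (fun n => (4 ^- n : R)%:E).
Proof.
move=> e e0; have [N hN] := expr2V_lt e0; exists N => n /hN h.
rewrite lee_fin (le_trans _ h)// lef_pV2 ?posrE ?exprn_gt0//.
by rewrite lerXn2r ?nnegrE// ler_nat.
Qed.

(** The index [k n] works for all later terms as well, which yields Cauchy estimates
    along the subsequence. *)
Lemma tends0_fast (u : nat -> \bar R) : tends0 u ->
  exists k : nat -> nat, (forall n, (n <= k n)%N) /\
    forall n m, (k n <= m)%N -> (u m <= (4 ^- n)%:E)%E.
Proof.
move=> hu; have /choice[k hk] : forall n, exists k : nat, (n <= k)%N /\
    forall m, (k <= m)%N -> (u m <= (4 ^- n)%:E)%E.
  move=> n; have [|N hN] := hu (4 ^- n); first by rewrite invr_gt0 exprn_gt0.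
  exists (maxn n N); rewrite leq_maxl; split=> // m; rewrite geq_max => /andP[_].
  exact: hN.
by exists k; split=> n; [case: (hk n)|move=> m; case: (hk n) => _; apply].
Qed.

Lemma weak_ae_subseq w (h_ : nat -> Rd -> R[i]) h : weight w ->
  (forall n, Cmeasurable (h_ n)) -> Cmeasurable h ->
  tends0 (fun n => weakL1norm w (fun x => h_ n x - h x)) ->
  exists k : nat -> nat, (forall n, (n <= k n)%N) /\
    {ae mu, forall x, ccvg (fun n => h_ (k n) x) (h x)}.
Proof.
move=> ww mh_ mh /tends0_fast[k [kn hk]]; exists k; split=> //.
pose g_ n x := h_ (k n) x - h x.
have mg n : Cmeasurable (g_ n) by exact: CmeasurableB.
have null : mu (lim_sup_set (fun n => superlevel (g_ n) (2 ^- n))) = 0%E.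
  apply: (lim_sup_superlevel ww mg) => n; apply: weak_pow4; exact: hk.
exists (lim_sup_set (fun n => superlevel (g_ n) (2 ^- n))); split=> //.
  by apply: bigcap_measurable => // m _; apply: bigcup_measurable => n _;
    exact: measurable_superlevel.
move=> x; apply: contra_notP => /not_lim_sup_superlevel[N hN] e e0.
have [M hM] := expr2V_lt e0; exists (maxn N M) => n; rewrite geq_max => /andP[/hN h1 /hM].
exact: le_trans.
Qed.

(** Off the null set [L] where infinitely many increments are large the sequence
    converges geometrically.  The rate passes to the limit by Fatou, applied to
    indicators of superlevel sets.  The terms are cut to zero on [L] so that the
    limit is measurable everywhere. *)
Lemma weak_complete w (h_ : nat -> Rd -> R[i]) : weight w ->
  (forall n, Cmeasurable (h_ n)) ->
  (forall n m, (n <= m)%N ->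
    (weakL1norm w (fun x => h_ m x - h_ n x)%R <= (4 ^- n)%:E)%E) ->
  exists2 h, Cmeasurable h &
    forall n, (weakL1norm w (fun x => h_ n x - h x)%R <= (4 ^- n)%:E)%E.
Proof.
move=> ww mh_ hh; have nw := weight_nnmeas ww.
pose g_ n x := h_ n.+1 x - h_ n x.
have mg n : Cmeasurable (g_ n) by exact: CmeasurableB.
pose L := lim_sup_set (fun n => superlevel (g_ n) (2 ^- n)).
have L0 : mu L = 0%E.
  by apply: (lim_sup_superlevel ww mg) => n; apply: weak_pow4; exact: hh.
have mL : measurable L.
  by apply: bigcap_measurable => // m _; apply: bigcup_measurable => n _;
    exact: measurable_superlevel.
pose z_ n := cutoff (~` L) (h_ n).
have mz n : Cmeasurable (z_ n) by apply: Cmeasurable_cutoff => //; exact: measurableC.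
have zcvg x : cvgn (fun n => complex.Re (z_ n x)) /\ cvgn (fun n => complex.Im (z_ n x)).
  have [Lx|nLx] := EM (L x).
    have z0 n : z_ n x = 0 by rewrite /z_ cutoff_out// => /(_ Lx).
    split; under eq_fun do rewrite z0; exact: is_cvg_cst.
  have zE n : z_ n x = h_ n x by rewrite /z_ cutoffE.
  have [N hN] := not_lim_sup_superlevel nLx.
  split; apply: (@cvg_small_steps R _ N) => n /hN; apply: le_trans; rewrite !zE.
    by rewrite -cReN -cReD Re_le_normc.
  by rewrite -cImN -cImD Im_le_normc.
pose h x := Complex (limn (fun n => complex.Re (z_ n x)))
                    (limn (fun n => complex.Im (z_ n x))).
have mh : Cmeasurable h.
  split=> /=.
  - apply: (@measurable_fun_cvg _ _ _ _ (fun n x => complex.Re (z_ n x))).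
      by move=> n; exact: (mz n).1.
    by move=> x _; exact: (zcvg x).1.
  - apply: (@measurable_fun_cvg _ _ _ _ (fun n x => complex.Im (z_ n x))).
      by move=> n; exact: (mz n).2.
    by move=> x _; exact: (zcvg x).2.
exists h => // n; apply/weak_leP => l l0.
have msl m : measurable (superlevel (fun x => h_ (n + m)%N x - h_ n x) l).
  by apply: measurable_superlevel; exact: CmeasurableB.
have ms : measurable (superlevel (fun x => h_ n x - h x) l).
  by apply: measurable_superlevel; exact: CmeasurableB.
suff : (mass mu w (superlevel (fun x => h_ n x - h x)%R l) <= (4 ^- n / l)%:E)%E.
  move=> hle; apply: (@le_trans _ _ (l%:E * (4 ^- n / l)%:E)%E).
    by apply: lee_wpmul2l => //; rewrite lee_fin ltW.
  by rewrite -EFinM lee_fin mulrC divfK// gt_eqF.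
rewrite -[X in mass mu w X]setTI -mass_patch//.
apply: (@mass_fatou _ _ (fun m x => \1_(superlevel (fun x => h_ (n + m)%N x - h_ n x) l) x * w x)).
- by move=> m; apply: nnmeasM => //; exact: nnmeas_indic.
- by apply: nnmeasM => //; exact: nnmeas_indic.
- by [].
- exists L; split=> // x; apply: contra_notP => nLx _ r.
  have [lx|nlx] := EM (superlevel (fun x => h_ n x - h x) l x); last first.
    rewrite indicE memNset// mul0r => r0; exists 0%N => m _.
    by rewrite (ltW (lt_le_trans r0 _))// mulr_ge0 ?nw.2// indicE.
  move=> hr; have e0 : 0 < normc (h_ n x - h x) - l by rewrite subr_gt0.
  have : ccvg (fun m => z_ m x) (h x) by apply: ccvg_ReIm; [exact: (zcvg x).1|exact: (zcvg x).2].
  have e20 : 0 < (normc (h_ n x - h x) - l) / 2 by rewrite divr_gt0.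
  move=> /(_ _ e20)[N hN]; exists N => m Nm.
  have := hN (n + m)%N (leq_trans Nm (leq_addl _ _)); rewrite {1}/z_ cutoffE// => hm.
  apply: (le_trans (ltW hr)); rewrite ler_wpM2r ?nw.2// !indicE mem_set//.
  rewrite mem_set//; rewrite /superlevel/=.
  have := normc_tri (h_ n x) (h_ (n + m)%N x) (h x).
  rewrite (normcBC (h_ n x) (h_ (n + m)%N x)); lra.
- move=> m; rewrite mass_patch// setTI.
  have /weak_leP/(_ l l0) := hh n (n + m)%N (leq_addr _ _).
  rewrite -[X in _ -> (X <= _)%E]mul1e -(mulVf (x := l)) ?gt_eqF// EFinM -muleA => hm.
  rewrite mulrC EFinM; apply: lee_wpmul2l => //.
  by rewrite lee_fin invr_ge0 ltW.
Qed.

End weak.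

(** * Bounded functions of compact support *)

Section bcs.
Context {R : realType} {d : nat}.
Local Notation mu := (lebesgue_rV R d).
Local Notation Rd := 'rV[R]_d.
Local Notation normc := (@Normc.normc R).
Implicit Types (w v : Rd -> R) (f g h u : Rd -> R[i]) (E D : set Rd).

Lemma support_sub_closed f E : closed E -> (forall x, ~ E x -> f x = 0) ->
  support f `<=` E.
Proof.
move=> cE fE; rewrite [X in _ `<=` X](closure_id E).1//; apply: closure_subset => x /= fx.
by apply: contrapT => /fE /eqP; apply/negP.
Qed.

Lemma bcs_cube f c l : Cmeasurable f -> (exists M, forall x, normc (f x) <= M) ->
  (forall x, ~ cube c l x -> f x = 0) -> bounded_compact_support f.
Proof.
move=> mf bf fc; split=> //.
apply: (subclosed_compact _ (@compact_cube R d c l)); first exact: closed_closure.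
by apply: support_sub_closed => //; exact: closed_cube.
Qed.

(** Compactness of the closed support amounts to vanishing off a centred cube,
    which is easier to combine. *)
Lemma bcs_cubeP f : bounded_compact_support f <->
  [/\ Cmeasurable f, (exists M, forall x, normc (f x) <= M) &
      exists2 l, 0 <= l & forall x, ~ cube 0 l x -> f x = 0].
Proof.
split; last by move=> [mf bf [l _ fl]]; exact: bcs_cube fl.
move=> [mf bf /compact_bounded[M [_ hM]]]; split=> //.
pose M' := Num.max M 0 + 1.
have M'0 : 0 <= M' by rewrite addr_ge0// le_max lexx orbT.
exists (2 * M'); first by rewrite mulr_ge0.
move=> x; apply: contra_notP => /eqP fx i; rewrite mxE subr0.
rewrite (_ : 2 * M' / 2 = M'); last by field.
have : `|x| <= M'.
  apply: hM; first by rewrite ltr_pwDr// le_max lexx.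
  exact: subset_closure.
apply: le_trans; rewrite [leRHS]/Num.Def.normr /= mx_normrE.
by apply/bigmax_geP; right; exists (ord0, i).
Qed.

Lemma cube0_mono (l l' : R) (x : Rd) : l <= l' -> cube 0 l x -> cube 0 l' x.
Proof. by move=> ll' h i; apply: le_trans (h i) _; rewrite ler_wpM2r// invr_ge0. Qed.

Lemma bcsD f g : bounded_compact_support f -> bounded_compact_support g ->
  bounded_compact_support (fun x => f x + g x).
Proof.
move=> /bcs_cubeP[mf [M hM] [l l0 hl]] /bcs_cubeP[mg [N hN] [k k0 hk]].
apply/bcs_cubeP; split; first exact: CmeasurableD.
  by exists (M + N) => x; apply: (le_trans (normcDle _ _)); exact: lerD.
exists (Num.max l k); first by rewrite le_max l0.
move=> x nx; rewrite hl ?hk ?addr0// => h; apply: nx; apply: cube0_mono h.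
  by rewrite le_max lexx orbT.
by rewrite le_max lexx.
Qed.

Lemma bcs0 : bounded_compact_support (fun _ : Rd => 0 : R[i]).
Proof.
apply: (bcs_cube (c := 0) (l := 0)); [exact: Cmeasurable_cst| |by []].
by exists 0 => _; rewrite Normc.normc0.
Qed.

Lemma bcsN f : bounded_compact_support f -> bounded_compact_support (fun x => - f x).
Proof.
move=> /bcs_cubeP[mf [M hM] [l l0 hl]]; apply/bcs_cubeP; split.
- exact: CmeasurableN.
- by exists M => x; rewrite cnormN.
- by exists l => // x /hl ->; rewrite oppr0.
Qed.

Lemma bcsB f g : bounded_compact_support f -> bounded_compact_support g ->
  bounded_compact_support (fun x => f x - g x).
Proof. by move=> bf bg; apply: bcsD => //; exact: bcsN. Qed.

Lemma bcs_sum (F : nat -> Rd -> R[i]) N : (forall j, bounded_compact_support (F j)) ->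
  bounded_compact_support (fun x => \sum_(j < N) F j x).
Proof.
move=> hF; elim: N => [|N IH].
  by under eq_fun do rewrite big_ord0; exact: bcs0.
by under eq_fun do rewrite big_ord_recr/=; exact: bcsD.
Qed.

Lemma nnmeas1 : nnmeas (fun _ : Rd => 1 : R).
Proof. exact: nnmeas_cst. Qed.

Lemma bcs_inL2 f : bounded_compact_support f -> inLp 2 (fun=> 1) f.
Proof.
move=> /bcs_cubeP[mf [M hM] [l l0 hl]]; split=> //; apply: poweR_lty.
have mQ := @measurable_cube R d 0 l.
apply: (@le_lt_trans _ _ (mass mu (fun x => \1_(cube 0 l) x * (M `^ 2)) setT)).
  apply: (@mass_le _ _ _ mu (fun x => normc (f x) `^ 2 * 1)) => //.
  - by apply: nnmeas_pmass => //; exact: nnmeas1.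
  - apply: nnmeasM; first exact: nnmeas_indic.
    by apply: nnmeas_cst; exact: powR_ge0.
  - move=> x _; rewrite mulr1; have [cx|ncx] := EM (cube 0 l x).
      rewrite indicE mem_set// mul1r; apply: ge0_ler_powR; rewrite ?nnegrE ?normc_ge0//.
      by apply: le_trans (hM x); exact: normc_ge0.
    by rewrite hl// Normc.normc0 powR0// mulr_ge0// powR_ge0.
rewrite mass_patch// setTI mass_cst//.
by have h := @cube_volume R d 0 l l0; rewrite [X in (_ * X < _)%E]h -EFinM ltry.
Qed.

Lemma Cmeasurable_bcs f : bounded_compact_support f -> Cmeasurable f.
Proof. by case. Qed.

Lemma cutoff_cvg w f (F : nat -> set Rd) E : nnmeas w -> Cmeasurable f ->
  (forall n, measurable (F n)) -> measurable E ->
  (forall x, E x -> exists N, forall n, (N <= n)%N -> F n x) ->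
  (nmass w f E < +oo)%E ->
  tends0 (fun n => nmass w (fun x => f x - cutoff (F n) f x) E).
Proof.
move=> nw mf mF mE hF fE.
have mc n : Cmeasurable (fun x => f x - cutoff (F n) f x).
  by apply: CmeasurableB => //; exact: Cmeasurable_cutoff.
apply/tends0P; first by move=> n; exact: nmass_ge0.
have := @dominated_convergence _ _ _ mu E mE
  (fun n x => (normc (f x - cutoff (F n) f x) * w x)%:E) (fun=> 0%E)
  (fun x => (normc (f x) * w x)%:E).
case.
- by move=> n; apply: nnmeas_mEFin; exact: nnmeas_nmass.
- exact: measurable_cst.
- apply: nearW => x Ex; have [N hN] := hF x Ex.
  apply: cvg_near_cst; exists N => // n /= Nn.
  by rewrite cutoffE ?subrr ?Normc.normc0 ?mul0r//; exact: hN.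
- apply/integrableP; split; first by apply: nnmeas_mEFin; exact: nnmeas_nmass.
  under eq_integral do rewrite abse_EFin ger0_norm ?mulr_ge0 ?normc_ge0 ?nw.2//.
  exact: fE.
- apply: nearW => x n Ex.
  rewrite abse_EFin ger0_norm ?mulr_ge0 ?normc_ge0 ?nw.2// lee_fin ler_wpM2r ?nw.2//.
  rewrite /cutoff; case: (x \in F n); rewrite ?subr0// subrr Normc.normc0.
  exact: normc_ge0.
- move=> _ _; rewrite integral0; exact.
Qed.

Definition trunc_set u (n : nat) : set Rd :=
  cube 0 n%:R `&` [set x | normc (u x) <= n%:R].

Lemma measurable_trunc_set u n : Cmeasurable u -> measurable (trunc_set u n).
Proof.
move=> mu'; apply: measurableI; first exact: measurable_cube.
rewrite (_ : mkset _ = (fun x => normc (u x)) @^-1` `]-oo, n%:R]).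
  by rewrite -[X in measurable X]setTI; exact: measurable_normc.
by apply/seteqP; split=> x /=; rewrite in_itv.
Qed.

Lemma trunc_set_ex u x : exists N, forall n, (N <= n)%N -> trunc_set u n x.
Proof.
pose M := normc (u x) + \sum_i 2 * `|x ord0 i|.
exists (Num.bound M) => n Mn.
have M0 : 0 <= M by rewrite addr_ge0 ?normc_ge0// sumr_ge0// => i _; rewrite mulr_ge0.
have le : M <= n%:R.
  apply: (@le_trans _ _ (Num.bound M)%:R); last by rewrite ler_nat.
  by rewrite ltW// archi_boundP.
split.
  move=> i; rewrite mxE subr0 ler_pdivlMr// mulrC; apply: le_trans le.
  rewrite /M (bigD1 i)//= [leRHS]addrCA lerDl addr_ge0 ?normc_ge0//.
  by rewrite sumr_ge0// => j _; rewrite mulr_ge0.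
by rewrite /=; apply: le_trans le; rewrite lerDl sumr_ge0// => i _; rewrite mulr_ge0.
Qed.

Lemma bcs_trunc u n : Cmeasurable u -> bounded_compact_support (cutoff (trunc_set u n) u).
Proof.
move=> mu'; apply: (bcs_cube (c := 0) (l := n%:R)).
- by apply: Cmeasurable_cutoff => //; exact: measurable_trunc_set.
- exists n%:R => x; have [h|h] := EM (trunc_set u n x).
    by rewrite cutoffE//; exact: h.2.
  by rewrite cutoff_out// Normc.normc0.
- by move=> x h; rewrite cutoff_out// => -[].
Qed.

Lemma pmass_cutoff_le p w f E D : 0 < p -> nnmeas w -> Cmeasurable f -> measurable E ->
  measurable D -> (pmass p w (cutoff E f) D <= pmass p w f D)%E.
Proof.
move=> p0 nw mf mE mD; apply: mass_le => //.
- by apply: nnmeas_pmass => //; exact: Cmeasurable_cutoff.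
- exact: nnmeas_pmass.
- move=> x _; rewrite ler_wpM2r ?nw.2// normc_cutoff indicE.
  case: (x \in E); first by rewrite mul1r.
  by rewrite mul0r powR0 ?gt_eqF// powR_ge0.
Qed.

End bcs.

(** * Extending the operator to L^1(w) *)

Section operator.
Context {R : realType} {d : nat}.
Local Notation mu := (lebesgue_rV R d).
Local Notation Rd := 'rV[R]_d.
Local Notation normc := (@Normc.normc R).
Implicit Types (w v : Rd -> R) (f g h u : Rd -> R[i]) (E D : set Rd).
Variable T : (Rd -> R[i]) -> Rd -> R[i].
Hypothesis hT : CZ_operator T.
Local Notation bcs := bounded_compact_support.

Lemma T_measurable f : bcs f -> Cmeasurable (T f).
Proof. by move=> bf; apply: (CZ_measurable hT); exact: bcs_inL2. Qed.
Hint Resolve T_measurable : core.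

Lemma T_D f g : bcs f -> bcs g ->
  {ae mu, forall x, T (fun y => f y + g y) x = T f x + T g x}.
Proof.
move=> bf bg; have := CZ_linear hT 1 (bcs_inL2 bf) (bcs_inL2 bg).
rewrite (_ : (fun y => 1 * f y + g y) = (fun y => f y + g y)); last first.
  by apply/funext => y; rewrite mul1r.
by apply: filterS => x ->; rewrite mul1r.
Qed.

Lemma T_B f g : bcs f -> bcs g ->
  {ae mu, forall x, T (fun y => f y - g y) x = T f x - T g x}.
Proof.
move=> bf bg; have := CZ_linear hT (-1) (bcs_inL2 bg) (bcs_inL2 bf).
rewrite (_ : (fun y => -1 * g y + f y) = (fun y => f y - g y)); last first.
  by apply/funext => y; rewrite mulN1r addrC.
by apply: filterS => x ->; rewrite mulN1r addrC.
Qed.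

Lemma T_sum (F : nat -> Rd -> R[i]) N : (forall j, bcs (F j)) ->
  {ae mu, forall x, T (fun y => \sum_(j < N) F j y) x = \sum_(j < N) T (F j) x}.
Proof.
move=> hF; elim: N => [|N IH].
  have := T_B (bcs0 (R := R) (d := d)) bcs0; apply: filterS => x.
  move=> h; have e : T (fun=> 0 - 0) x = 0 by rewrite h; exact: subrr.
  rewrite big_ord0; apply: etrans e; congr (T _ x).
  by apply/funext => y; rewrite big_ord0 subr0.
have := T_D (bcs_sum N hF) (hF N); apply: filterS2 IH => x IH h.
rewrite big_ord_recr/= -IH -h; congr (T _ x).
by apply/funext => y; rewrite big_ord_recr.
Qed.

Lemma T_weak w : A1 w -> exists2 C : R, 0 < C & forall f, bcs f ->
  (weakL1norm w (T f) <= C%:E * nmass w f setT)%E.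
Proof.
move=> Aw; have [C hC] := CZ_weak_type hT Aw.
have nw := weight_nnmeas Aw.1.
exists (Num.max C 1); first by rewrite lt_max ltr01 orbT.
move=> f bf; apply: (le_trans (hC f bf)).
have mf := Cmeasurable_bcs bf.
rewrite wLnorm1E//; apply: lee_wpmul2r; first exact: nmass_ge0.
by rewrite lee_fin le_max lexx.
Qed.

(** The constant is enlarged to be positive, and the bound is read on p-th powers. *)
Lemma T_strong p v : 1 < p -> Ap p v -> exists2 C : R, 0 < C & forall f, bcs f ->
  (pmass p v (T f) setT <= C%:E * pmass p v f setT)%E.
Proof.
move=> p1 Av; have [C hC] := CZ_strong_type hT p1 Av.
have nv := weight_nnmeas Av.1; have p0 := lt_trans ltr01 p1.
pose C' := Num.max C 1; have C'0 : 0 < C' by rewrite lt_max ltr01 orbT.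
exists (C' `^ p); first by rewrite powR_gt0.
move=> f bf; have mf := Cmeasurable_bcs bf.
have := mass_ge0 mu setT (nnmeas_pmass p nv mf); rewrite -/(pmass p v f setT).
case fE : (pmass p v f setT) => [t| |]//; last first.
  by move=> _; rewrite gt0_muley ?leey// lte_fin powR_gt0.
rewrite lee_fin => t0.
have := hC f bf; rewrite {2}/wLnorm -/(mass mu (fun x => normc (f x) `^ p * v x) setT).
rewrite -/(pmass p v f setT) fE poweR_EFin => h.
have : (wLnorm p v (T f) <= (C' * t `^ p^-1)%:E)%E.
  apply: (le_trans h); rewrite -EFinM lee_fin ler_wpM2r ?powR_ge0//.
  by rewrite le_max lexx.
move/(wLnorm_leP p0 (mulr_ge0 (ltW C'0) (powR_ge0 _ _)) nv (T_measurable bf)).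
by rewrite powRM ?powR_ge0 ?(ltW C'0)// -powRrM mulVf ?gt_eqF// powRr1// EFinM.
Qed.

Variable w : Rd -> R.
Hypothesis Aw : A1 w.
Let nw : nnmeas w := weight_nnmeas Aw.1.

(** By the weak type bound the images of an L^1(w)-convergent sequence are Cauchy
    in weak L^1(w).  A fast subsequence meets the rate required by completeness. *)
Lemma T_limit_exists (u_ : nat -> Rd -> R[i]) u : (forall n, bcs (u_ n)) ->
  Cmeasurable u -> tends0 (fun n => nmass w (fun x => u_ n x - u x) setT) ->
  exists (k : nat -> nat) Tu, [/\ forall n, (n <= k n)%N, Cmeasurable Tu &
    tends0 (fun n => weakL1norm w (fun x => T (u_ (k n)) x - Tu x))].
Proof.
move=> bu mu' hu; have [C C0 hC] := T_weak Aw.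
have C20 : 0 <= 2 * C by rewrite mulr_ge0// ltW.
have [k [kn hk]] := tends0_fast (tends0Z C20 hu).
have mu_ n : Cmeasurable (u_ n) by exact: Cmeasurable_bcs.
have [Tu mTu hTu] : exists2 h, Cmeasurable h & forall n,
    (weakL1norm w (fun x => T (u_ (k n)) x - h x)%R <= (4 ^- n)%:E)%E.
  apply: (weak_complete Aw.1) => [n|n m nm]; first exact: T_measurable.
  have bB := bcsB (bu (k m)) (bu (k n)).
  apply: (@le_trans _ _ (weakL1norm w (T (fun x => u_ (k m) x - u_ (k n) x)%R))).
    apply: weak_ae_le => //; [by apply: CmeasurableB; exact: T_measurable|exact: T_measurable|].
    by apply: filterS (T_B (bu (k m)) (bu (k n))) => x ->.
  apply: (le_trans (hC _ bB)).
  have hn := hk n (k n) (leqnn _); have hm := hk m (k m) (leqnn _).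
  have hm' : ((2 * C)%:E * nmass w (fun x => u_ (k m) x - u x)%R setT <= (4 ^- n)%:E)%E.
    apply: (le_trans hm); rewrite lee_fin lef_pV2 ?posrE ?exprn_gt0//.
    by rewrite ler_weXn2l// ler1n.
  have h2 : (nmass w (fun x => u_ (k m) x - u_ (k n) x)%R setT <=
    nmass w (fun x => u_ (k m) x - u x)%R setT + nmass w (fun x => u_ (k n) x - u x)%R setT)%E.
    rewrite (nmassBC _ (u_ (k n))).
    apply: (@le_trans _ _ (nmass w (fun x => (u_ (k m) x - u x) + (u x - u_ (k n) x))%R setT)).
      rewrite le_eqVlt; apply/orP; left; apply/eqP; apply: eq_mass => x _.
      by rewrite addrA subrK.
    by apply: nmassD => //; exact: CmeasurableB.
  have C0' : (0 <= C%:E)%E by rewrite lee_fin ltW.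
  apply: (le_trans (lee_wpmul2l C0' h2)).
  rewrite -(@lee_pmul2l _ 2%:E)// muleA -EFinM.
  rewrite ge0_muleDr; [|exact/nmass_ge0/CmeasurableB|exact/nmass_ge0/CmeasurableB].
  rewrite (_ : 2%:E * (4 ^- n)%:E = (4 ^- n)%:E + (4 ^- n)%:E)%E; first exact: leeD.
  by rewrite -EFinM -EFinD; congr EFin; ring.
exists k, Tu; split=> //.
by apply: (tends0_le hTu); exact: pow4_tends0.
Qed.

(** The sequences [b_] and [f_ - u_] have the same limit [f - u] in L^1(w), so by the
    weak type bound the images of [b_] converge to [Tf - Tu], whatever sequence was
    used to define each of [Tf] and [Tu]. *)
Lemma CZ_ext_transfer f Tf (u_ b_ : nat -> Rd -> R[i]) u Tu :
  CZ_ext T w f Tf -> Cmeasurable f -> Cmeasurable u -> Cmeasurable Tu ->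
  (forall n, bcs (u_ n)) -> (forall n, bcs (b_ n)) ->
  tends0 (fun n => nmass w (fun x => u_ n x - u x) setT) ->
  tends0 (fun n => weakL1norm w (fun x => T (u_ n) x - Tu x)) ->
  tends0 (fun n => nmass w (fun x => b_ n x - (f x - u x)) setT) ->
  tends0 (fun n => weakL1norm w (fun x => T (b_ n) x - (Tf x - Tu x))).
Proof.
move=> [mTf [f_ [bf hf hTf]]] mf mu' mTu bu bb hu hTu hb.
have [C C0 hC] := T_weak Aw.
have mf_ n : Cmeasurable (f_ n) by exact: Cmeasurable_bcs.
have mu_ n : Cmeasurable (u_ n) by exact: Cmeasurable_bcs.
have mb_ n : Cmeasurable (b_ n) by exact: Cmeasurable_bcs.
have {}hf : tends0 (fun n => nmass w (fun x => f_ n x - f x) setT).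
  have wE n : wLnorm 1 w (fun x => f_ n x - f x) = nmass w (fun x => f_ n x - f x) setT.
    by rewrite wLnorm1E//; exact: CmeasurableB.
  have p n : (0 <= wLnorm 1 w (fun x => f_ n x - f x)%R)%E.
    by rewrite wE; apply: nmass_ge0 => //; exact: CmeasurableB.
  by apply: tends0_le ((tends0P p).1 hf) => n; rewrite wE.
have {}hTf : tends0 (fun n => weakL1norm w (fun x => T (f_ n) x - Tf x)).
  by apply/tends0P => // n; exact: weak_ge0.
(* This difference tends to zero in L^1(w), so its image does in weak L^1(w). *)
pose e_ n x := (b_ n x + u_ n x) - f_ n x.
have be n : bcs (e_ n) by apply: bcsB => //; exact: bcsD.
have he : tends0 (fun n => nmass w (e_ n) setT).
  apply: (@tends0_le _ _ (fun n => (nmass w (fun x => b_ n x - (f x - u x))%R setT +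
    nmass w (fun x => u_ n x - u x)%R setT) + nmass w (fun x => f_ n x - f x)%R setT)%E); last first.
    by apply: tends0D => //; exact: tends0D.
  move=> n.
  apply: (@le_trans _ _ (nmass w (fun x =>
      ((b_ n x - (f x - u x)) + (u_ n x - u x)) - (f_ n x - f x))%R setT)).
    rewrite le_eqVlt; apply/orP; left; apply/eqP; apply: eq_mass => x _.
    by congr (normc _ * _); rewrite /e_; ring.
  have m1 : Cmeasurable (fun x => b_ n x - (f x - u x)) by do 2 apply: CmeasurableB => //.
  have m2 : Cmeasurable (fun x => u_ n x - u x) by exact: CmeasurableB.
  have m3 : Cmeasurable (fun x => f_ n x - f x) by exact: CmeasurableB.
  apply: (le_trans (nmassB nw (CmeasurableD m1 m2) m3 measurableT)).
  by apply: leeD => //; exact: nmassD.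
apply: (@tends0_le _ _ (fun n => 2%:E * (C%:E * nmass w (e_ n) setT +
   2%:E * (weakL1norm w (fun x => T (f_ n) x - Tf x)%R +
     weakL1norm w (fun x => T (u_ n) x - Tu x)%R)))%E); last first.
  apply: tends0Z => //; apply: tends0D; first by apply: tends0Z => //; exact: ltW.
  by apply: tends0Z => //; exact: tends0D.
move=> n.
have mTe : Cmeasurable (T (e_ n)) by exact: T_measurable.
have mTfn : Cmeasurable (fun x => T (f_ n) x - Tf x) by apply: CmeasurableB => //; exact: T_measurable.
have mTun : Cmeasurable (fun x => T (u_ n) x - Tu x) by apply: CmeasurableB => //; exact: T_measurable.
have mTbn : Cmeasurable (fun x => T (b_ n) x - (Tf x - Tu x)).
  by apply: CmeasurableB; [exact: T_measurable|exact: CmeasurableB].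
pose r x := (T (f_ n) x - Tf x) - (T (u_ n) x - Tu x).
have mr : Cmeasurable r by exact: CmeasurableB.
apply: (@le_trans _ _ (2%:E * (weakL1norm w (T (e_ n)) + weakL1norm w r))%E).
  apply: weak_ae_leD => //.
  have h1 := T_B (bcsD (bb n) (bu n)) (bf n).
  have h2 := T_D (bb n) (bu n).
  apply: filterS2 h1 h2 => x h1 h2.
  have -> : T (b_ n) x - (Tf x - Tu x) = T (e_ n) x + r x.
    by rewrite /e_ h1 h2 /r; ring.
  exact: normcDle.
apply: lee_wpmul2l => //; apply: leeD; first exact: hC.
apply: weak_ae_leD => //; apply: nearW => x; exact: normcBle.
Qed.

End operator.

(** * Complex integrals and A_1 averages *)

Section complex_integral.
Context {R : realType} {d : nat}.
Local Notation mu := (lebesgue_rV R d).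
Local Notation Rd := 'rV[R]_d.
Local Notation normc := (@Normc.normc R).
Local Notation bcs := bounded_compact_support.
Implicit Types (w v : Rd -> R) (f g h B : Rd -> R[i]) (E D : set Rd).

Lemma mass_support (phi : Rd -> R) E : measurable E -> (forall x, ~ E x -> phi x = 0) ->
  mass mu phi E = mass mu phi setT.
Proof.
move=> mE phi0; rewrite -[in LHS](setTI E) -mass_patch//.
apply: eq_mass => x _; have [Ex|nEx] := EM (E x).
  by rewrite indicE mem_set// mul1r.
by rewrite phi0// mulr0.
Qed.

Definition L1mass f : \bar R := mass mu (fun x => normc (f x)) setT.

Lemma Cintegrable_L1 f : Cmeasurable f -> (L1mass f < +oo)%E -> Cintegrable f.
Proof.
move=> mf ff; have nf := nnmeas_normc mf.
split; apply/integrableP; split.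
- by apply/measurable_EFinP; exact: mf.1.
- apply: le_lt_trans ff; apply: ge0_le_integral => //.
  + by apply: measurableT_comp => //; apply/measurable_EFinP; exact: mf.1.
  + exact: nnmeas_mEFin.
  + by move=> x _; rewrite /= lee_fin Re_le_normc.
- by apply/measurable_EFinP; exact: mf.2.
- apply: le_lt_trans ff; apply: ge0_le_integral => //.
  + by apply: measurableT_comp => //; apply/measurable_EFinP; exact: mf.2.
  + exact: nnmeas_mEFin.
  + by move=> x _; rewrite /= lee_fin Im_le_normc.
Qed.

Lemma CintegrableZ (k : R[i]) f : Cintegrable f -> Cintegrable (fun x => k * f x).
Proof.
move=> [rf jf]; split.
- rewrite (_ : _ \o _ = (fun x => (complex.Re k)%:E * (complex.Re (f x))%:E -
     (complex.Im k)%:E * (complex.Im (f x))%:E)%E); last first.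
    by apply/funext => x /=; rewrite cReM EFinB !EFinM.
  by apply: integrableB => //; exact: integrableZl.
- rewrite (_ : _ \o _ = (fun x => (complex.Re k)%:E * (complex.Im (f x))%:E +
     (complex.Im k)%:E * (complex.Re (f x))%:E)%E); last first.
    by apply/funext => x /=; rewrite cImM EFinD !EFinM.
  by apply: integrableD => //; exact: integrableZl.
Qed.

Lemma CintegrableB f g : Cintegrable f -> Cintegrable g ->
  Cintegrable (fun x => f x - g x).
Proof.
move=> [rf jf] [rg ig]; split.
- rewrite (_ : _ \o _ = (fun x => (complex.Re (f x))%:E - (complex.Re (g x))%:E)%E).
    exact: integrableB.
  by apply/funext => x /=; rewrite cReD cReN EFinB.
- rewrite (_ : _ \o _ = (fun x => (complex.Im (f x))%:E - (complex.Im (g x))%:E)%E).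
    exact: integrableB.
  by apply/funext => x /=; rewrite cImD cImN EFinB.
Qed.

Lemma CintegralB f g : Cintegrable f -> Cintegrable g ->
  Cintegral (fun x => f x - g x) = Cintegral f - Cintegral g.
Proof.
move=> [rf jf] [rg ig].
apply/eqP; rewrite eq_complex cReD cReN cImD cImN /=; apply/andP; split; apply/eqP.
- by under [in LHS]eq_Rintegral do rewrite cReD cReN; rewrite RintegralB.
- by under [in LHS]eq_Rintegral do rewrite cImD cImN; rewrite RintegralB.
Qed.

Lemma CintegralZ (k : R[i]) f : Cintegrable f ->
  Cintegral (fun x => k * f x) = k * Cintegral f.
Proof.
move=> [rf jf].
have rZ (r : R) (F : Rd -> R) : mu.-integrable setT (EFin \o F) ->
    mu.-integrable setT (EFin \o (fun x => r * F x)).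
  move=> iF; rewrite (_ : _ \o _ = (fun x => r%:E * (F x)%:E)%E)//.
  exact: integrableZl.
apply/eqP; rewrite eq_complex cReM cImM /=; apply/andP; split; apply/eqP.
- under [in LHS]eq_Rintegral do rewrite cReM.
  by rewrite RintegralB ?RintegralZl//; exact: rZ.
- under [in LHS]eq_Rintegral do rewrite cImM.
  by rewrite RintegralD ?RintegralZl//; exact: rZ.
Qed.

(** The factor 2, from treating the real and imaginary parts apart, is harmless. *)
Lemma normc_Cintegral_le f (h : Rd -> R) : Cintegrable f -> nnmeas h ->
  (mass mu h setT < +oo)%E -> (forall x, normc (f x) <= h x) ->
  normc (Cintegral f) <= 2 * fine (mass mu h setT).
Proof.
move=> [rf jf] nh hf fh.
have ih : mu.-integrable setT (EFin \o h).
  apply/integrableP; split; first exact: nnmeas_mEFin.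
  by under eq_integral do rewrite /= ger0_norm ?nh.2//.
have mh : fine (mass mu h setT) = Rintegral mu setT h by [].
apply: (le_trans (normc_le_ReIm _)); rewrite mulr_natl mulr2n mh; apply: lerD => /=.
- apply: (le_trans (le_normr_Rintegral _ _)) => //.
  apply: le_Rintegral => //.
    rewrite (_ : _ \o _ = abse \o (EFin \o (fun x => complex.Re (f x))))//.
    exact: integrable_abse.
  by move=> x _; apply: le_trans (fh x); exact: Re_le_normc.
- apply: (le_trans (le_normr_Rintegral _ _)) => //.
  apply: le_Rintegral => //.
    rewrite (_ : _ \o _ = abse \o (EFin \o (fun x => complex.Im (f x))))//.
    exact: integrable_abse.
  by move=> x _; apply: le_trans (fh x); exact: Im_le_normc.
Qed.

(** The A_1 condition replaces [w] by its average over the cube under an integral. *)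
Lemma A1_average w : A1 w -> exists2 C : R, 0 < C & forall c l E (h : Rd -> R),
  0 < l -> measurable E -> E `<=` cube c l -> nnmeas h ->
  ((cmass w c l)%:E * mass mu h E <= (C * l ^+ d)%:E * mass mu (fun x => h x * w x)%R E)%E.
Proof.
move=> [ww [C0 hC]]; have nw := weight_nnmeas ww.
pose C := Num.max C0 1; have Cp : 0 < C by rewrite lt_max ltr01 orbT.
exists C => // c l E h l0 mE Ec nh; have ld0 : 0 < l ^+ d by exact: exprn_gt0.
have nhw := nnmeasM nh nw.
rewrite -massZ ?cmass_ge0// -massZ//; last by rewrite mulr_ge0 ?ltW.
apply: mass_aele => //.
- by apply: nnmeasZ => //; exact: cmass_ge0.
- by apply: nnmeasZ => //; rewrite mulr_ge0 ?ltW.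
apply: filterS (hC c l l0) => x hx Ex; have := hx (Ec _ Ex).
rewrite averageE// cmassE// -EFinM lee_fin ler_pdivrMl// => hm.
rewrite [leRHS](_ : _ = l ^+ d * (C * w x) * h x); last by ring.
rewrite ler_wpM2r ?nh.2// (le_trans hm)// ler_wpM2l ?(ltW ld0)// ler_wpM2r ?nw.2//.
by rewrite le_max lexx.
Qed.

Lemma bcs_nmass_fin w f : weight w -> bcs f -> (nmass w f setT < +oo)%E.
Proof.
move=> ww /bcs_cubeP[mf [M hM] [l l0 hl]]; have nw := weight_nnmeas ww.
have M0 : 0 <= M by apply: le_trans (hM 0); exact: normc_ge0.
have mQ := @measurable_cube R d 0 l.
apply: (@le_lt_trans _ _ (mass mu (fun x => \1_(cube 0 l) x * (M * w x)) setT)).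
  apply: mass_le => //; first exact: nnmeas_nmass.
    by apply: nnmeasM; [exact: nnmeas_indic|exact: nnmeasZ].
  move=> x _; have [cx|ncx] := EM (cube 0 l x).
    by rewrite indicE mem_set// mul1r ler_wpM2r ?nw.2.
  by rewrite hl// Normc.normc0 mul0r indicE memNset// mul0r.
by rewrite mass_patch// setTI massZ// cmassE// -EFinM ltry.
Qed.

Lemma bcs_L1_fin f : bcs f -> (L1mass f < +oo)%E.
Proof.
move=> /bcs_cubeP[mf [M hM] [l l0 hl]].
have M0 : 0 <= M by apply: le_trans (hM 0); exact: normc_ge0.
have mQ := @measurable_cube R d 0 l.
apply: (@le_lt_trans _ _ (mass mu (fun x => \1_(cube 0 l) x * M) setT)).
  apply: mass_le => //; first exact: nnmeas_normc.
    by apply: nnmeasM; [exact: nnmeas_indic|exact: nnmeas_cst].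
  move=> x _; have [cx|ncx] := EM (cube 0 l x).
    by rewrite indicE mem_set// mul1r.
  by rewrite hl// Normc.normc0 indicE memNset// mul0r.
rewrite mass_patch// setTI mass_cst//.
by have h := @cube_volume R d 0 l l0; rewrite [X in (_ * X < _)%E]h -EFinM ltry.
Qed.

Lemma nneseries_geometric (a r : R) : 0 <= r < 1 ->
  (\sum_(0 <= k <oo) (a * r ^+ k)%:E = (a / (1 - r))%:E)%E.
Proof.
move=> /andP[r0 r1]; apply: cvg_lim => //.
have -> : (fun n => \sum_(0 <= k < n) (a * r ^+ k)%:E)%E = EFin \o series (geometric a r).
  by apply/funext => n; rewrite /= /series/= sumEFin.
apply: cvg_EFin; first exact: nearW.
apply: cvg_geometric_series; by rewrite ger0_norm.
Qed.

End complex_integral.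

(** * Decay of the operator on functions of mean zero *)

Section kernel.
Context {R : realType} {d : nat}.
Local Notation mu := (lebesgue_rV R d).
Local Notation Rd := 'rV[R]_d.
Local Notation normc := (@Normc.normc R).
Local Notation bcs := bounded_compact_support.
Implicit Types (w v : Rd -> R) (f g h B : Rd -> R[i]) (E D : set Rd).
Hypothesis d0 : (0 < d)%N.

Lemma eucl_norm_le (z : Rd) (r : R) : (forall i, `|z ord0 i| <= r) ->
  eucl_norm z <= d%:R * r.
Proof.
move=> hz; have r0 : 0 <= r.
  by apply: le_trans (hz (Ordinal d0)).
rewrite -[leRHS]ger0_norm ?mulr_ge0// -sqrtr_sqr ler_wsqrtr//.
apply: (@le_trans _ _ (\sum_(i < d) r ^+ 2)).
  by apply: ler_sum => i _; rewrite -real_normK ?num_real// lerXn2r ?nnegrE.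
rewrite sumr_const card_ord exprMn -[leLHS]mulr_natl ler_wpM2r ?sqr_ge0//.
by rewrite -natrX ler_nat -[leqLHS]expn1 leq_pexp2l.
Qed.

Lemma eucl_norm_ge (z : Rd) i : `|z ord0 i| <= eucl_norm z.
Proof.
rewrite /eucl_norm -sqrtr_sqr ler_wsqrtr// (bigD1 i)//= lerDl sumr_ge0// => j _.
exact: sqr_ge0.
Qed.

(** The smoothness of the kernel in the second variable, compared with the centre of
    the cube and expressed by the generation [k] of the annulus containing [x]: the
    ratio [2^(-alpha)] is the gain, and the other factors are the inverse of the volume
    of the annulus, up to a constant. *)
Lemma kernel_difference (K : Rd -> Rd -> R[i]) : CZ_kernel K ->
  exists C alpha : R, [/\ 0 < C, 0 < alpha & forall c l x y (k : nat), 0 < l ->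
    cube c l y -> ~ cube c (5 * 2 ^+ k * l) x ->
    normc (K x y - K x c) <= C * ((2 `^ (- alpha)) ^+ k / (2 ^+ k) ^+ d / l ^+ d)].
Proof.
move=> [C [al [C0 al0 hK]]].
have dR : 0 < d%:R :> R by rewrite ltr0n.
exists (C * d%:R `^ al), al; split=> //; first by rewrite mulr_gt0// powR_gt0.
move=> c l x y k l0 cy ncx.
have k1 : (1 : R) <= 2 ^+ k by rewrite exprn_ege1// ler1n.
have k0 : (0 : R) < 2 ^+ k by rewrite exprn_gt0.
have cc : cube c l c by move=> i; rewrite subrr normr0 divr_ge0// ltW.
have ncx5 : ~ cube c (5 * l) x.
  move=> cx; apply: ncx => i; apply: le_trans (cx i) _; rewrite ler_pM2r// ler_pM2r//.
  by rewrite ler_peMr.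
have h1 : eucl_norm (c - y) <= d%:R * l.
  apply: eucl_norm_le => i; rewrite !mxE distrC; apply: le_trans (cy i) _; lra.
have [i hi] : exists i, 5 * 2 ^+ k * l / 2 < `|x ord0 i - c ord0 i|.
  by move/existsNP: ncx => [i /negP]; rewrite -ltNge; exists i.
have h2 : 2 ^+ k * l <= eucl_norm (x - c).
  apply: le_trans (eucl_norm_ge _ i); rewrite !mxE; apply: le_trans (ltW hi).
  have : 0 <= 2 ^+ k * l by rewrite mulr_ge0// ltW.
  lra.
have kl0 : 0 < 2 ^+ k * l by rewrite mulr_gt0.
rewrite normcBC; apply: (le_trans (hK c l x c y l0 cc cy ncx5)).
rewrite -mulrA ler_pM2l//.
apply: (@le_trans _ _ ((d%:R * l) `^ al / (2 ^+ k * l) `^ (d%:R + al))).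
  apply: ler_pM; rewrite ?powR_ge0 ?invr_ge0 ?powR_ge0//.
    by apply: ge0_ler_powR; rewrite ?nnegrE ?(ltW al0) ?sqrtr_ge0// mulr_ge0// ltW.
  rewrite lef_pV2 ?posrE ?powR_gt0//; last exact: lt_le_trans h2.
  apply: ge0_ler_powR; rewrite ?nnegrE ?sqrtr_ge0 ?(ltW kl0)//.
  by rewrite addr_ge0// ltW.
rewrite powRM ?(ltW l0) ?(ltW dR)// -mulrA ler_pM2l ?powR_gt0//.
rewrite powRD; last by rewrite (gt_eqF kl0) implybT.
rewrite powR_mulrn ?(ltW kl0)// exprMn (powRM (x := 2 ^+ k)) ?(ltW l0) ?(ltW k0)//.
have -> : (2 ^+ k) `^ al = ((2 `^ (- al)) ^+ k)^-1 :> R.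
  rewrite -!powR_mulrn ?powR_ge0// -powRrM -powRN -powRrM; congr (_ `^ _).
  by ring.
rewrite le_eqVlt; apply/orP; left; apply/eqP.
have p1 : l `^ al != 0 by rewrite gt_eqF// powR_gt0.
have p2 : l != 0 by rewrite gt_eqF.
have p3 : 2 `^ (- al) != 0 :> R by rewrite gt_eqF// powR_gt0.
by field; rewrite ?expf_neq0// ?p1 ?p2 ?p3.
Qed.

Variable T : (Rd -> R[i]) -> Rd -> R[i].
Hypothesis hT : CZ_operator T.

(** Since [B] has mean zero, the kernel may be replaced by its difference with its
    value at the centre.  The quantifier over [k] is inside the almost everywhere
    statement, as the exceptional set depends on [B] only. *)
Lemma T_far : exists C alpha : R, [/\ 0 < C, 0 < alpha & forall c l B, 0 < l -> bcs B ->
  (forall x, ~ cube c l x -> B x = 0) -> Cintegral B = 0 ->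
  {ae mu, forall x (k : nat), ~ cube c (5 * 2 ^+ k * l) x ->
    normc (T B x) <= C * ((2 `^ (- alpha)) ^+ k / (2 ^+ k) ^+ d / l ^+ d) *
      fine (L1mass B)}].
Proof.
have [K KK hK] := CZ_representation hT.
have [C [al [C0 al0 hC]]] := kernel_difference KK.
exists (2 * C), al; split=> //; first by rewrite mulr_gt0.
move=> c l B l0 bB Bc B0.
have mB := Cmeasurable_bcs bB; have Bfin := bcs_L1_fin bB.
have iB := Cintegrable_L1 mB Bfin.
have [_ _ cB] := bB.
have := hK B (bcs_inL2 bB) cB; apply: filterS => x hx k ncx.
have nsx : ~ support B x.
  move=> /(support_sub_closed (closed_cube (c := c) (l := l)) Bc) cx; apply: ncx => i.
  apply: le_trans (cx i) _; rewrite ler_pM2r// ler_peMl ?(ltW l0)//.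
  have : (1 : R) <= 2 ^+ k by rewrite exprn_ege1// ler1n.
  lra.
have [iK ->] := hx nsx.
have iKc := CintegrableZ (K x c) iB.
(* The mean of [B] vanishes, so [K x c] may be subtracted from the kernel. *)
have -> : Cintegral (fun y => K x y * B y) = Cintegral (fun y => K x y * B y - K x c * B y).
  by rewrite CintegralB// CintegralZ// B0 mulr0 subr0.
set r := _ / _ / _.
have r0 : 0 <= r by rewrite !divr_ge0 ?exprn_ge0 ?powR_ge0// ltW.
have nB := nnmeas_normc mB.
have Cr0 : 0 <= C * r by rewrite mulr_ge0// ltW.
have EB : mass mu (fun y => C * r * normc (B y)) setT = ((C * r)%:E * L1mass B)%E.
  by rewrite massZ.
apply: (le_trans (@normc_Cintegral_le _ _ _ (fun y => C * r * normc (B y)) _ _ _ _)).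
- exact: CintegrableB.
- exact: nnmeasZ.
- rewrite EB -(fineK (x := L1mass B)) -?EFinM ?ltry// ge0_fin_numE//.
  exact: mass_ge0.
- move=> y; rewrite -mulrBl Normc.normcM.
  have [cy|ncy] := EM (cube c l y); last by rewrite Bc// Normc.normc0 !mulr0.
  by rewrite ler_wpM2r ?normc_ge0//; exact: hC.
rewrite EB fineM//; last by rewrite ge0_fin_numE//; exact: mass_ge0.
by rewrite /= !mulrA.
Qed.

(** On the [k]-th annulus [T B] is bounded by [T_far], the [w]-mass of the annulus is
    compared with the integral of [|B| w] by A_1, and the powers of the side cancel,
    leaving a geometric series of ratio [2^(-alpha)]. *)
Lemma T_tail w : A1 w -> exists2 C : R, 0 < C & forall c l B, 0 < l -> bcs B ->
  (forall x, ~ cube c l x -> B x = 0) -> Cintegral B = 0 ->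
  (nmass w (T B) (~` cube c (5 * l)) <= C%:E * nmass w B setT)%E.
Proof.
move=> Aw; have [C [al [C0 al0 hfar]]] := T_far.
have [Ca Ca0 hA] := A1_average Aw.
have ww := Aw.1; have nw := weight_nnmeas ww.
pose r : R := 2 `^ (- al).
have r0 : 0 <= r by exact: powR_ge0.
have r1 : r < 1.
  rewrite /r powRN invf_lt1 ?powR_gt0//.
  have e : 1 `^ al = 1 :> R by rewrite powR1.
  by rewrite -[ltLHS]e; apply: gt0_ltr_powR; rewrite ?nnegrE// ltr1n.
exists (C * Ca * 10 ^+ d / (1 - r)).
  by rewrite divr_gt0 ?subr_gt0// !mulr_gt0// exprn_gt0.
move=> c l B l0 bB Bc B0.
have mB := Cmeasurable_bcs bB; have mTB := T_measurable hT bB.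
have nTB := nnmeas_nmass nw mTB.
have tE : nmass w B setT = (fine (nmass w B setT))%:E.
  by rewrite fineK// ge0_fin_numE ?bcs_nmass_fin// nmass_ge0.
set t := fine _ in tE.
have t0 : 0 <= t by rewrite fine_ge0// nmass_ge0.
have IE : L1mass B = (fine (L1mass B))%:E.
  by rewrite fineK// ge0_fin_numE ?bcs_L1_fin//; apply: mass_ge0; exact: nnmeas_normc.
set I := fine _ in IE.
have I0 : 0 <= I by rewrite fine_ge0//; apply: mass_ge0; exact: nnmeas_normc.
pose L (k : nat) := 5 * 2 ^+ k * l.
have L0 k : 0 < L k by rewrite !mulr_gt0// exprn_gt0.
have Lmono (j k : nat) : (j <= k)%N -> cube c (L j) `<=` cube c (L k).
  move=> jk x cx i; apply: le_trans (cx i) _.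
  by rewrite ler_pM2r// ler_pM2r// ler_pM2l// ler_weXn2l// ler1n.
pose A (k : nat) := cube c (L k.+1) `\` cube c (L k).
have mQ k : measurable (cube c (L k)) by exact: measurable_cube.
have mA k : measurable (A k) by exact: measurableD.
have tA : trivIset setT A.
  apply: ltn_trivIset => j k jk; apply/seteqP; split=> // x [[cx _] [_ nx]].
  by apply: nx; exact: (Lmono _ _ jk).
have AE : ~` cube c (5 * l) = \bigcup_k A k.
  apply/seteqP; split=> x; last first.
    move=> [k _ [_ nx]] cx; apply: nx; apply: (Lmono 0%N) => //.
    by rewrite /L expr0 mulr1.
  move=> nx.
  (* The dilated cubes exhaust the space; the least one containing [x] gives the
     annulus. *)
  have ex : exists k : nat, `[< cube c (L k) x >].
    pose M := \sum_i `|x ord0 i - c ord0 i|.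
    have M0 : 0 <= M by exact: sumr_ge0.
    exists (Num.bound (M / l)); apply/asboolP => i.
    have : M / l < (Num.bound (M / l))%:R by apply: archi_boundP; rewrite divr_ge0// ltW.
    set n := Num.bound _; rewrite ltr_pdivrMr// => hn.
    have n2 : n%:R <= 2 ^+ n :> R by rewrite -natrX ler_nat ltnW// ltn_expl.
    apply: (@le_trans _ _ M); first by rewrite /M (bigD1 i)//= lerDl sumr_ge0.
    apply: (le_trans (ltW hn)); apply: (@le_trans _ _ (2 ^+ n * l)); first by rewrite ler_pM2r.
    rewrite /L (_ : 5 * 2 ^+ n * l / 2 = 2 ^+ n * l * (5 / 2)); last by ring.
    by rewrite ler_peMr ?mulr_ge0 ?exprn_ge0 ?(ltW l0)//; lra.
  case: (ex_minnP ex) => -[|k] /asboolP cx kmin.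
    by exfalso; apply: nx; rewrite /L expr0 mulr1 in cx.
  exists k => //; split=> // ck.
  by have := kmin k (asboolT ck); rewrite ltnn.
have far := hfar c l B l0 bB Bc B0.
rewrite AE /nmass mass_bigcup//.
rewrite -/(nmass w B setT) tE -EFinM.
rewrite (_ : (_ * t)%:E = ((C * Ca * 10 ^+ d * t) / (1 - r))%:E); last by congr EFin; ring.
rewrite -nneseries_geometric ?r0//.
apply: lee_nneseries => [k _ _|k _]; first exact: mass_ge0.
pose b := C * (r ^+ k / (2 ^+ k) ^+ d / l ^+ d) * I.
have b0 : 0 <= b.
  by rewrite !mulr_ge0 ?invr_ge0 ?exprn_ge0 ?(ltW C0) ?(ltW l0).
apply: (@le_trans _ _ (mass mu (fun x => b * w x) (A k))).
  apply: mass_aele => //; first exact: nnmeasZ.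
  by apply: filterS far => x hx [_ nx]; rewrite ler_wpM2r ?nw.2//; exact: hx.
rewrite massZ//.
apply: (@le_trans _ _ (b%:E * (cmass w c (L k.+1))%:E)%E).
  apply: lee_wpmul2l; first by rewrite lee_fin.
  by rewrite -cmassE//; apply: mass_sub => // x [].
rewrite -EFinM lee_fin.
have mc : measurable (cube c l) by exact: measurable_cube.
have := hA c (L k.+1) (cube c l) (fun x => normc (B x)) (L0 _) mc _ (nnmeas_normc mB).
have lL : l <= L k.+1.
  rewrite /L ler_peMl ?(ltW l0)//.
  have : (1 : R) <= 2 ^+ k.+1 by rewrite exprn_ege1// ler1n.
  lra.
have -> : mass mu (fun x => normc (B x)) (cube c l) = I%:E.
  by rewrite -IE; apply: mass_support => // x /Bc ->; rewrite Normc.normc0.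
have -> : mass mu (fun x => normc (B x) * w x) (cube c l) = t%:E.
  by rewrite -tE; apply: mass_support => // x /Bc ->; rewrite Normc.normc0 mul0r.
rewrite -!EFinM lee_fin => /(_ _) hh.
have {}hh : cmass w c (L k.+1) * I <= Ca * L k.+1 ^+ d * t.
  apply: hh => x cx i; apply: le_trans (cx i) _; by rewrite ler_pM2r.
rewrite /b (_ : _ * cmass w c (L k.+1) =
  C * (r ^+ k / (2 ^+ k) ^+ d / l ^+ d) * (cmass w c (L k.+1) * I)); last by ring.
apply: (@le_trans _ _ (C * (r ^+ k / (2 ^+ k) ^+ d / l ^+ d) * (Ca * L k.+1 ^+ d * t))).
  by rewrite ler_wpM2l// !mulr_ge0 ?invr_ge0 ?exprn_ge0 ?(ltW C0) ?(ltW l0).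
rewrite le_eqVlt; apply/orP; left; apply/eqP.
have -> : L k.+1 ^+ d = 10 ^+ d * (2 ^+ k) ^+ d * l ^+ d.
  by rewrite /L exprS -!exprMn; congr (_ ^+ _); ring.
field; rewrite ?expf_neq0// ?gt_eqF//.
Qed.

End kernel.

(** * The bad part of a decomposition *)

Section bad.
Context {R : realType} {d : nat}.
Local Notation mu := (lebesgue_rV R d).
Local Notation Rd := 'rV[R]_d.
Local Notation normc := (@Normc.normc R).
Local Notation bcs := bounded_compact_support.
Implicit Types (f g h B : Rd -> R[i]).

Variables (w : Rd -> R) (Aw : A1 w).
Let ww : weight w := Aw.1.
Let nw : nnmeas w := weight_nnmeas ww.

Variables (Ca : R) (Ca0 : 0 < Ca).
Hypothesis hA : forall c l E (h : Rd -> R),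
  0 < l -> measurable E -> E `<=` cube c l -> nnmeas h ->
  ((cmass w c l)%:E * mass mu h E <= (Ca * l ^+ d)%:E * mass mu (fun x => h x * w x)%R E)%E.

(** A set comparable with a cube, or empty: all that the estimates of the bad part
    retain of a dyadic cube. *)
Definition cube_like (E : set Rd) (z : Rd) (s : R) :=
  [/\ measurable E, 0 < s & E = set0 \/ (cube z (s / 2) `<=` E /\ E `<=` cube z s)].

Variables (D : nat -> set Rd) (c : nat -> Rd) (l : nat -> R).
Hypotheses (tD : trivIset setT D) (cD : forall j, cube_like (D j) (c j) (l j)).

Let mD j : measurable (D j). Proof. by case: (cD j). Qed.
Let l0 j : 0 < l j. Proof. by case: (cD j). Qed.
Let Dc j : D j `<=` cube (c j) (l j).
Proof. by case: (cD j) => _ _ [->|[]]. Qed.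

Let vol j : R := fine (mu (D j)).

Let volE j : mu (D j) = (vol j)%:E.
Proof.
rewrite fineK// ge0_fin_numE//; apply: (@le_lt_trans _ _ (mu (cube (c j) (l j)))).
  by apply: le_measure; rewrite ?inE//; exact: measurable_cube.
by rewrite cube_volume ?ltry// ltW.
Qed.

Let vol_ge j : D j !=set0 -> (l j / 2) ^+ d <= vol j.
Proof.
move=> /set0P/negP D0; case: (cD j) => _ _ [/eqP//|[cDj _]].
rewrite -lee_fin -volE -(cube_volume (c j)); last by rewrite divr_ge0// ltW.
by apply: le_measure; rewrite ?inE//; exact: measurable_cube.
Qed.

Definition avg j g : R[i] := Complex (vol j)^-1 0 * Cintegral (cutoff (D j) g).

Definition bad_part j g : Rd -> R[i] := cutoff (D j) (fun x => g x - avg j g).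

Lemma bad_part_empty j g : D j = set0 -> bad_part j g = (fun=> 0).
Proof. by move=> D0; apply/funext => x; rewrite /bad_part D0 cutoff_out. Qed.

Lemma Cmeasurable_bad_part j g : Cmeasurable g -> Cmeasurable (bad_part j g).
Proof.
by move=> mg; apply: Cmeasurable_cutoff => //; apply: CmeasurableB.
Qed.

Lemma L1mass_cutoff E g : measurable E ->
  L1mass (cutoff E g) = mass mu (fun x => normc (g x)) E.
Proof.
move=> mE; rewrite /L1mass -[in RHS](setTI E) -mass_patch//.
by apply: eq_mass => x _; rewrite normc_cutoff.
Qed.

Lemma nmass_real E g : measurable E -> Cmeasurable g -> (nmass w g E < +oo)%E ->
  exists2 t, 0 <= t & nmass w g E = t%:E.
Proof.
move=> mE mg gfin; exists (fine (nmass w g E)); first by rewrite fine_ge0// nmass_ge0.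
by rewrite fineK// ge0_fin_numE// nmass_ge0.
Qed.

Lemma L1_piece_fin j g : Cmeasurable g -> (nmass w g (D j) < +oo)%E ->
  (L1mass (cutoff (D j) g) < +oo)%E.
Proof.
move=> mg gfin.
have := hA (l0 j) (mD j) (@Dc j) (nnmeas_normc mg).
rewrite L1mass_cutoff// -/(nmass w g (D j)).
have cw := cmass_gt0 (c j) ww (l0 j).
have := mass_ge0 mu (D j) (nnmeas_normc mg).
have [t _ ->] := nmass_real (mD j) mg gfin.
case: (mass mu _ (D j)) => [I| |]// _; first by rewrite ltry.
by rewrite gt0_muley ?lte_fin.
Qed.

Lemma Cintegrable_piece j g : Cmeasurable g -> (nmass w g (D j) < +oo)%E ->
  Cintegrable (cutoff (D j) g).
Proof.
by move=> mg gfin; apply: Cintegrable_L1; [exact: Cmeasurable_cutoff|exact: L1_piece_fin].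
Qed.

Lemma normc_real (r : R) : normc (Complex r 0) = `|r|.
Proof. by rewrite /= expr0n addr0 sqrtr_sqr. Qed.

Definition Cavg : R := 2 * 2 ^+ d * Ca.

Let Cavg0 : 0 < Cavg. Proof. by rewrite !mulr_gt0// exprn_gt0. Qed.

(** By A_1 the plain mean of [g], weighted by [w], is controlled by the integral of
    [|g| w]. *)
Lemma avg_le j g : D j !=set0 -> Cmeasurable g -> (nmass w g (D j) < +oo)%E ->
  ((cmass w (c j) (l j) * normc (avg j g))%:E <= Cavg%:E * nmass w g (D j))%E.
Proof.
move=> Dj mg gfin.
have L1fin := L1_piece_fin mg gfin.
have iD := Cintegrable_piece mg gfin.
have mc := Cmeasurable_cutoff (mD j) mg.
have := hA (l0 j) (mD j) (@Dc j) (nnmeas_normc mg).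
rewrite -L1mass_cutoff// -/(nmass w g (D j)).
have [t t0 ->] := nmass_real (mD j) mg gfin.
have IE : L1mass (cutoff (D j) g) = (fine (L1mass (cutoff (D j) g)))%:E.
  by rewrite fineK// ge0_fin_numE//; apply: mass_ge0; exact: nnmeas_normc.
pose I := fine (L1mass (cutoff (D j) g)); rewrite -/I in IE.
have hI : normc (Cintegral (cutoff (D j) g)) <= 2 * I.
  exact: (normc_Cintegral_le iD (nnmeas_normc mc) L1fin (fun x => lexx _)).
rewrite IE -!EFinM !lee_fin => hcI.
have v0 : 0 < (l j / 2) ^+ d by rewrite exprn_gt0// divr_gt0.
have vv : 0 < vol j by apply: lt_le_trans (vol_ge Dj).
have cw := cmass_ge0 (c j) (l j) ww.
rewrite /avg Normc.normcM normc_real ger0_norm; last by rewrite invr_ge0 ltW.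
apply: (@le_trans _ _ (((l j / 2) ^+ d)^-1 * (2 * (Ca * l j ^+ d * t)))).
  rewrite mulrCA; apply: ler_pM.
  - by rewrite invr_ge0 ltW.
  - by rewrite mulr_ge0 ?normc_ge0.
  - by rewrite lef_pV2 ?posrE// vol_ge.
  - apply: le_trans (ler_wpM2l cw hI) _; rewrite mulrCA ler_pM2l//.
rewrite le_eqVlt; apply/orP; left; apply/eqP; rewrite /Cavg expr_div_n.
by field; rewrite !expf_neq0// gt_eqF.
Qed.

Lemma nmass_bad_part_le j g : Cmeasurable g -> (nmass w g (D j) < +oo)%E ->
  (nmass w (bad_part j g) setT <= (1 + Cavg)%:E * nmass w g (D j))%E.
Proof.
move=> mg gfin; have C1 : 0 <= 1 + Cavg by rewrite addr_ge0// ltW.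
have [D0|/set0P Dj] := eqVneq (D j) set0.
  rewrite bad_part_empty// {1}/nmass; under eq_mass do rewrite Normc.normc0 mul0r.
  rewrite [X in (X <= _)%E]integral0.
  by rewrite mule_ge0 ?lee_fin// nmass_ge0.
rewrite nmass_cutoff//.
have mk : Cmeasurable (fun _ : Rd => avg j g) by exact: Cmeasurable_cst.
apply: (le_trans (nmassB nw mg mk (mD j))).
have [t t0 tE] := nmass_real (mD j) mg gfin.
have := avg_le Dj mg gfin; rewrite tE -!EFinM lee_fin => h.
apply: (@le_trans _ _ (t%:E + (normc (avg j g))%:E * (cmass w (c j) (l j))%:E)%E).
  apply: leeD => //; rewrite /nmass massZ ?normc_ge0//.
  apply: lee_wpmul2l; first by rewrite lee_fin normc_ge0.
  by rewrite -cmassE//; apply: mass_sub => //; exact: measurable_cube.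
by rewrite -EFinM -EFinD lee_fin mulrDl mul1r lerD2l mulrC.
Qed.

Lemma Cintegral0 : Cintegral (fun _ : Rd => 0 : R[i]) = 0.
Proof. by apply/eqP; rewrite eq_complex /= /Rintegral integral0 !eqxx. Qed.

Lemma Cintegral_bad_part j g : Cmeasurable g -> (nmass w g (D j) < +oo)%E ->
  Cintegral (bad_part j g) = 0.
Proof.
move=> mg gfin; have [D0|/set0P Dj] := eqVneq (D j) set0.
  by rewrite bad_part_empty// Cintegral0.
pose one := cutoff (D j) (fun=> 1 : R[i]).
have m1 : Cmeasurable one by apply: Cmeasurable_cutoff => //; exact: Cmeasurable_cst.
have E1 : L1mass one = (vol j)%:E.
  rewrite L1mass_cutoff//; under eq_mass do rewrite Normc.normc1.
  by rewrite mass_cst// mul1e; exact: volE.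
have i1 : Cintegrable one by apply: Cintegrable_L1 => //; rewrite E1 ltry.
have I1 : Cintegral one = Complex (vol j) 0.
  have ReE : (fun x => complex.Re (one x)) = \1_(D j).
    by apply/funext => x; rewrite /one /cutoff indicE; case: (x \in D j).
  have ImE : (fun x => complex.Im (one x)) = cst 0.
    by apply/funext => x; rewrite /one /cutoff; case: (x \in D j).
  rewrite /Cintegral ReE ImE /Rintegral integral_indic// setIT integral0.
  by [].
have -> : bad_part j g = (fun x => cutoff (D j) g x - avg j g * one x).
  apply/funext => x; rewrite /bad_part /one /cutoff; case: (x \in D j).
    by rewrite mulr1.
  by rewrite mulr0 subr0.
rewrite CintegralB ?CintegralZ//; [|exact: Cintegrable_piece|exact: CintegrableZ].
have vv : vol j != 0.
  by rewrite gt_eqF//; apply: lt_le_trans (vol_ge Dj); rewrite exprn_gt0// divr_gt0.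
rewrite I1 /avg mulrAC (_ : Complex (vol j)^-1 0 * Complex (vol j) 0 = 1) ?mul1r ?subrr//.
by apply/eqP; rewrite eq_complex cReM cImM /= !mulr0 mul0r !subr0 addr0 mulVf// !eqxx.
Qed.

Lemma avgB j g h : Cmeasurable g -> Cmeasurable h -> (nmass w g (D j) < +oo)%E ->
  (nmass w h (D j) < +oo)%E -> avg j (fun x => g x - h x) = avg j g - avg j h.
Proof.
move=> mg mh gfin hfin; rewrite /avg -mulrBr -CintegralB; try exact: Cintegrable_piece.
congr (_ * Cintegral _); apply/funext => x; rewrite /cutoff.
by case: (x \in D j); rewrite ?subr0.
Qed.

Definition Omega : set Rd := \bigcup_j D j.

Lemma measurable_Omega : measurable Omega.
Proof. exact: bigcupT_measurable. Qed.

Definition idx (x : Rd) : nat := xget 0%N [set j | D j x].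

Lemma idxE j x : D j x -> idx x = j.
Proof.
move=> Djx; rewrite /idx; case: xgetP => [i _ /= Dix|/(_ j)//].
by apply: tD => //; exists x.
Qed.

(** The pieces have disjoint supports, so their infinite sum is defined pointwise by
    the only index that may contribute; [idx] has default value 0 off [Omega], where
    the piece of index 0 vanishes anyway. *)
Definition bad g : Rd -> R[i] := fun x => bad_part (idx x) g x.

Lemma badE j g x : D j x -> bad g x = g x - avg j g.
Proof. by move=> Djx; rewrite /bad (idxE Djx) /bad_part cutoffE. Qed.

Lemma bad_partE j g x : D j x -> bad_part j g x = bad g x.
Proof. by move=> Djx; rewrite /bad (idxE Djx). Qed.

Lemma bad_out g x : ~ Omega x -> bad g x = 0.
Proof. by move=> nO; rewrite /bad /bad_part cutoff_out// => h; apply: nO; exists (idx x). Qed.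

Lemma bad_part_sum g x N : (forall j, (N <= j)%N -> bad_part j g x = 0) ->
  \sum_(j < N) bad_part j g x = bad g x.
Proof.
move=> hN; have other j : j != idx x -> bad_part j g x = 0.
  move=> ji; rewrite /bad_part cutoff_out// => /idxE e.
  by rewrite e eqxx in ji.
have [iN|Ni] := ltnP (idx x) N; last first.
  by rewrite /bad hN// big1// => j _; apply: other; rewrite neq_ltn (leq_trans (ltn_ord j)).
rewrite (bigD1 (Ordinal iN))//= big1 ?addr0// => j ji.
by apply: other; move: ji; apply: contraNN => /eqP e; apply/eqP/val_inj.
Qed.

Lemma Cmeasurable_sum (F : nat -> Rd -> R[i]) N : (forall j, Cmeasurable (F j)) ->
  Cmeasurable (fun x => \sum_(j < N) F j x).
Proof.
move=> hF; elim: N => [|N IH].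
  by under eq_fun do rewrite big_ord0; exact: Cmeasurable_cst.
by under eq_fun do rewrite big_ord_recr/=; exact: CmeasurableD.
Qed.

Lemma Cmeasurable_bad g : Cmeasurable g -> Cmeasurable (bad g).
Proof.
move=> mg; have ms N : Cmeasurable (fun x => \sum_(j < N) bad_part j g x).
  by apply: (Cmeasurable_sum (F := fun j => bad_part j g)) => j; exact: Cmeasurable_bad_part.
have ev x : exists N, forall n, (N <= n)%N -> \sum_(j < n) bad_part j g x = bad g x.
  exists (idx x).+1 => n Nn; apply: bad_part_sum => j nj.
  rewrite /bad_part cutoff_out// => /idxE e.
  by move: (leq_trans Nn nj); rewrite e ltnn.
split.
- apply: (@measurable_fun_cvg _ _ _ _ (fun n x => complex.Re (\sum_(j < n) bad_part j g x))).
    by move=> n; exact: (ms n).1.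
  move=> x _; have [N hN] := ev x.
  by apply: cvg_near_cst; exists N => // n /= /hN ->.
- apply: (@measurable_fun_cvg _ _ _ _ (fun n x => complex.Im (\sum_(j < n) bad_part j g x))).
    by move=> n; exact: (ms n).2.
  move=> x _; have [N hN] := ev x.
  by apply: cvg_near_cst; exists N => // n /= /hN ->.
Qed.

Let piece_fin j g : Cmeasurable g -> (nmass w g Omega < +oo)%E ->
  (nmass w g (D j) < +oo)%E.
Proof.
move=> mg; apply: le_lt_trans; apply: mass_sub => //; first exact: nnmeas_nmass.
  exact: measurable_Omega.
by move=> x Dx; exists j.
Qed.

Lemma nmass_bad_le g : Cmeasurable g -> (nmass w g Omega < +oo)%E ->
  (nmass w (bad g) setT <= (1 + Cavg)%:E * nmass w g Omega)%E.
Proof.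
move=> mg gfin; have C1 : 0 <= 1 + Cavg by rewrite addr_ge0// ltW.
have mb := Cmeasurable_bad mg.
rewrite /nmass -(mass_support (E := Omega)); last 2 first.
- exact: measurable_Omega.
- by move=> x nO; rewrite bad_out// Normc.normc0 mul0r.
rewrite /Omega !mass_bigcup//; try exact: nnmeas_nmass.
rewrite -nneseriesZl; last by move=> j _; exact: nmass_ge0.
apply: lee_nneseries => [j _ _|j _]; first exact: nmass_ge0.
apply: (@le_trans _ _ (nmass w (bad_part j g) setT)); last first.
  rewrite -/(nmass w g (D j)).
  by apply: nmass_bad_part_le => //; exact: piece_fin.
rewrite le_eqVlt; apply/orP; left; apply/eqP.
rewrite -/(nmass w (bad g) (D j)) -(nmass_cutoff _ _ (mD j)).
apply: eq_mass => x _; have [Dx|nDx] := EM (D j x).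
  by rewrite cutoffE// (bad_partE _ Dx).
by rewrite cutoff_out// /bad_part cutoff_out.
Qed.

(** The means are linear only on functions integrable over the pieces, whence the two
    finiteness hypotheses. *)
Lemma badB g h : Cmeasurable g -> Cmeasurable h -> (nmass w g Omega < +oo)%E ->
  (nmass w h Omega < +oo)%E -> bad (fun x => g x - h x) = (fun x => bad g x - bad h x).
Proof.
move=> mg mh gfin hfin; apply/funext => x; have [[j _ Dx]|nO] := EM (Omega x).
  by rewrite !(badE _ Dx) avgB//; [ring|exact: piece_fin|exact: piece_fin].
by rewrite !bad_out// subr0.
Qed.

(** A truncation meeting finitely many pieces: its bad part is a finite sum of
    bounded functions supported in cubes, to which [T] applies term by term. *)
Definition piece_trunc g (N : nat) : Rd -> R[i] :=
  cutoff ([set x | normc (g x) <= N%:R] `&` \bigcup_(j < N) D j) g.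

Lemma measurable_piece_trunc g N : Cmeasurable g ->
  measurable ([set x | normc (g x) <= N%:R] `&` \bigcup_(j < N) D j).
Proof.
move=> mg; apply: measurableI; last exact: bigcup_measurable.
rewrite (_ : mkset _ = (fun x => normc (g x)) @^-1` `]-oo, N%:R]).
  by rewrite -[X in measurable X]setTI; exact: measurable_normc.
by apply/seteqP; split=> x /=; rewrite in_itv.
Qed.

Lemma Cmeasurable_piece_trunc g N : Cmeasurable g -> Cmeasurable (piece_trunc g N).
Proof.
by move=> mg; apply: Cmeasurable_cutoff => //; exact: measurable_piece_trunc.
Qed.

Lemma normc_piece_trunc g N x : normc (piece_trunc g N x) <= Num.min N%:R (normc (g x)).
Proof.
rewrite /piece_trunc; set E := _ `&` _.
have [Ex|nEx] := EM (E x).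
  by rewrite cutoffE// le_min lexx andbT; exact: Ex.1.
by rewrite cutoff_out// Normc.normc0 le_min normc_ge0 andbT.
Qed.

Lemma nmass_piece_trunc_le g N E : measurable E -> Cmeasurable g ->
  (nmass w (piece_trunc g N) E <= nmass w g E)%E.
Proof.
move=> mE mg; apply: mass_le => //.
- by apply: nnmeas_nmass => //; exact: Cmeasurable_piece_trunc.
- exact: nnmeas_nmass.
move=> x _; rewrite ler_wpM2r ?nw.2//.
by have := normc_piece_trunc g N x; rewrite le_min => /andP[].
Qed.

Lemma bcs_bad_part j g : Cmeasurable g -> (exists M, forall x, normc (g x) <= M) ->
  bcs (bad_part j g).
Proof.
move=> mg [M hM]; apply: (bcs_cube (c := c j) (l := l j)).
- exact: Cmeasurable_bad_part.
- exists (M + normc (avg j g)) => x; have [Dx|nDx] := EM (D j x).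
    rewrite /bad_part cutoffE//; apply: (le_trans (normcBle _ _)).
    by rewrite lerD2r.
  rewrite /bad_part cutoff_out// Normc.normc0 addr_ge0 ?normc_ge0//.
  exact: le_trans (normc_ge0 _) (hM x).
- by move=> x nc; rewrite /bad_part cutoff_out// => /Dc.
Qed.

Let piece_trunc_bounded g N : exists M, forall x, normc (piece_trunc g N x) <= M.
Proof.
exists N%:R => x; have := normc_piece_trunc g N x.
by rewrite le_min => /andP[].
Qed.

Lemma bad_piece_trunc_sum g N :
  bad (piece_trunc g N) = (fun x => \sum_(j < N) bad_part j (piece_trunc g N) x).
Proof.
apply/funext => x; apply/esym; apply: bad_part_sum => j Nj.
have tr0 y : D j y -> piece_trunc g N y = 0.
  move=> Dy; rewrite /piece_trunc cutoff_out// => -[_ [i /= iN Diy]].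
  by move: iN; rewrite -(idxE Diy) (idxE Dy) ltnNge Nj.
have [Dx|nDx] := EM (D j x); last by rewrite /bad_part cutoff_out.
rewrite /bad_part cutoffE// tr0// sub0r /avg.
rewrite (_ : cutoff _ _ = (fun=> 0)) ?Cintegral0 ?mulr0 ?oppr0//.
apply/funext => y; have [Dy|nDy] := EM (D j y); last by rewrite cutoff_out.
by rewrite cutoffE// tr0.
Qed.

Lemma bcs_bad_piece_trunc g N : Cmeasurable g -> bcs (bad (piece_trunc g N)).
Proof.
move=> mg; rewrite bad_piece_trunc_sum.
apply: (bcs_sum (F := fun j => bad_part j (piece_trunc g N))) => j.
apply: bcs_bad_part; [exact: Cmeasurable_piece_trunc|exact: piece_trunc_bounded].
Qed.

(** The bad part is linear and bounded on L^1(w), so it inherits the convergence of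
    the truncations. *)
Lemma bad_piece_trunc_cvg g : Cmeasurable g -> (nmass w g Omega < +oo)%E ->
  tends0 (fun N => nmass w (fun x => bad (piece_trunc g N) x - bad g x) setT).
Proof.
move=> mg gfin; have C1 : 0 <= 1 + Cavg by rewrite addr_ge0// ltW.
have mO := measurable_Omega.
have tfin N : (nmass w (piece_trunc g N) Omega < +oo)%E.
  by apply: le_lt_trans gfin; exact: nmass_piece_trunc_le.
have := cutoff_cvg nw mg (fun N => measurable_piece_trunc N mg) mO _ gfin.
move=> /(_ _)/(tends0Z C1) h.
have {h} : tends0 (fun N => (1 + Cavg)%:E * nmass w (fun x => g x - piece_trunc g N x)%R Omega)%E.
  apply: h => x [j _ Dx]; exists (maxn j.+1 (Num.bound (normc (g x)))) => n.
  rewrite geq_max => /andP[jn bn]; split; last by exists j.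
  apply: (@le_trans _ _ (Num.bound (normc (g x)))%:R); last by rewrite ler_nat.
  by rewrite ltW// archi_boundP// normc_ge0.
apply: tends0_le => N; rewrite nmassBC.
have mt := Cmeasurable_piece_trunc N mg.
rewrite -(badB mg mt gfin (tfin N)).
apply: nmass_bad_le; first exact: CmeasurableB.
apply: le_lt_trans (nmassB nw mg mt mO) _.
by rewrite lte_add_pinfty.
Qed.

Definition Omega_star : set Rd :=
  \bigcup_j [set x | D j !=set0 /\ cube (c j) (5 * l j) x].

Lemma measurable_Omega_star : measurable Omega_star.
Proof.
apply: bigcupT_measurable => j; have [Dj|nDj] := EM (D j !=set0).
  rewrite (_ : mkset _ = cube (c j) (5 * l j)); first exact: measurable_cube.
  by apply/seteqP; split=> x /= => [[]|].
rewrite (_ : mkset _ = set0)//.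
by apply/seteqP; split=> x /= => [[]|].
Qed.

Variables (T : (Rd -> R[i]) -> Rd -> R[i]) (hT : CZ_operator T).
Variables (Ct : R) (Ct0 : 0 < Ct).
Hypothesis hTail : forall c l B, 0 < l -> bcs B ->
  (forall x, ~ cube c l x -> B x = 0) -> Cintegral B = 0 ->
  (nmass w (T B) (~` cube c (5 * l)) <= Ct%:E * nmass w B setT)%E.

(** An empty piece has no cube to speak of, but its image vanishes almost
    everywhere by linearity. *)
Lemma nmass_T_bad_part_le j g : Cmeasurable g -> (nmass w g (D j) < +oo)%E ->
  (exists M, forall x, normc (g x) <= M) ->
  (nmass w (T (bad_part j g)) (~` Omega_star) <= (Ct * (1 + Cavg))%:E * nmass w g (D j))%E.
Proof.
move=> mg gfin gb; have bb := bcs_bad_part j mg gb.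
have mO : measurable (~` Omega_star) by apply: measurableC; exact: measurable_Omega_star.
have C1 : 0 <= 1 + Cavg by rewrite addr_ge0// ltW.
have mTb := T_measurable hT bb.
apply: (@le_trans _ _ (Ct%:E * nmass w (bad_part j g) setT)%E); last first.
  rewrite EFinM -muleA; apply: lee_wpmul2l; first by rewrite lee_fin ltW.
  exact: nmass_bad_part_le.
have [D0|/set0P Dj] := eqVneq (D j) set0.
  have T0 := T_sum hT (F := fun _ _ => 0) 0 (fun=> bcs0).
  rewrite (_ : nmass w (T _) _ = 0%E).
    by rewrite mule_ge0 ?lee_fin ?(ltW Ct0)// nmass_ge0//; exact: Cmeasurable_bad_part.
  rewrite /nmass (mass_aeeq (g := fun=> 0) (nnmeas_nmass nw mTb) (nnmeas_cst (lexx 0)) mO).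
    exact: integral0.
  apply: filterS T0 => x; rewrite !big_ord0 => hx _.
  by rewrite bad_part_empty// hx Normc.normc0 mul0r.
apply: le_trans (hTail (c := c j) (l0 j) bb _ _).
- apply: mass_sub => //; first exact: nnmeas_nmass.
    by apply: measurableC; exact: measurable_cube.
  by move=> x nO cx; apply: nO; exists j.
- by move=> x nc; rewrite /bad_part cutoff_out// => /Dc.
- exact: Cintegral_bad_part.
Qed.

Lemma nmass_sum_le (F : nat -> Rd -> R[i]) N E : measurable E ->
  (forall j, Cmeasurable (F j)) ->
  (nmass w (fun x => \sum_(j < N) F j x)%R E <= \sum_(j < N) nmass w (F j) E)%E.
Proof.
move=> mE hF; elim: N => [|N IH].
  rewrite big_ord0 /nmass; under eq_mass do rewrite big_ord0 Normc.normc0 mul0r.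
  by rewrite /mass integral0.
rewrite big_ord_recr/=; apply: (@le_trans _ _
  (nmass w (fun x => \sum_(j < N) F j x)%R E + nmass w (F N) E)%E).
  apply: le_trans (nmassD nw (Cmeasurable_sum N hF) (hF N) mE).
  rewrite le_eqVlt; apply/orP; left; apply/eqP; apply: eq_mass => x _.
  by rewrite big_ord_recr.
exact: leeD.
Qed.

Lemma nmass_T_bad_trunc_le g N : Cmeasurable g -> (nmass w g Omega < +oo)%E ->
  (nmass w (T (bad (piece_trunc g N))) (~` Omega_star) <=
    (Ct * (1 + Cavg))%:E * nmass w g Omega)%E.
Proof.
move=> mg gfin; set gN := piece_trunc g N.
have mgN : Cmeasurable gN by exact: Cmeasurable_piece_trunc.
have gNb : exists M, forall x, normc (gN x) <= M by exact: piece_trunc_bounded.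
have mO : measurable (~` Omega_star) by apply: measurableC; exact: measurable_Omega_star.
have C2 : 0 <= Ct * (1 + Cavg) by rewrite mulr_ge0 ?addr_ge0// ltW.
have bb j : bcs (bad_part j gN) by exact: bcs_bad_part.
have gNfin j : (nmass w gN (D j) < +oo)%E.
  apply: le_lt_trans (@piece_fin j g mg gfin); exact: nmass_piece_trunc_le.
have mT j : Cmeasurable (T (bad_part j gN)) by exact: (T_measurable hT).
apply: (@le_trans _ _ (nmass w (fun x => \sum_(j < N) T (bad_part j gN) x)%R (~` Omega_star))).
  apply: mass_aele => //.
  - by apply: nnmeas_nmass => //; apply: (T_measurable hT); exact: bcs_bad_piece_trunc.
  - by apply: nnmeas_nmass => //; exact: (Cmeasurable_sum (F := fun j => T (bad_part j gN))).
  apply: filterS (T_sum hT N bb) => x hx _.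
  by rewrite bad_piece_trunc_sum hx.
apply: (le_trans (nmass_sum_le N mO mT)).
apply: (@le_trans _ _ (\sum_(j < N) (Ct * (1 + Cavg))%:E * nmass w g (D j))%E).
  apply: lee_sum => j _; apply: (le_trans (nmass_T_bad_part_le mgN (gNfin j) gNb)).
  by apply: lee_wpmul2l; [rewrite lee_fin|exact: nmass_piece_trunc_le].
rewrite /nmass /Omega mass_bigcup//; last exact: nnmeas_nmass.
rewrite -nneseriesZl; last by move=> j _; exact: nmass_ge0.
rewrite -(big_mkord xpredT (fun j => (Ct * (1 + Cavg))%:E * nmass w g (D j))%E).
apply: nneseries_lim_ge => j _ _; rewrite mule_ge0 ?lee_fin//.
exact: nmass_ge0.
Qed.

End bad.

(** * Exchanging the two norms at the threshold *)

Section real_inequalities.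
Context {R : realType}.
Implicit Types p lam X w v a : R.

(** Together with [threshold_identity_lam] this writes both sides of the threshold
    inequalities with the common factor [X / w^(p-1)], so that their comparison
    reduces to that of [(X w)^(p-1)] with [(lam a)^(p-1)]. *)
Lemma threshold_identity p X w v : 1 < p -> 0 <= X -> 0 < w ->
  X `^ p * v = (X * w) `^ (p - 1) * v * (X / w `^ (p - 1)).
Proof.
move=> p1 X0 w0; have p0 : 0 < p by exact: lt_trans ltr01 p1.
rewrite -(mulr_powRB1 X0 p0) powRM ?(ltW w0)//.
have w1 : w `^ (p - 1) != 0 by rewrite gt_eqF// powR_gt0.
by field.
Qed.

Lemma threshold_identity_lam p lam X w v a : 1 < p -> 0 <= lam -> 0 <= X -> 0 < w ->
  0 <= a -> a `^ (p - 1) * v = w `^ p ->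
  lam `^ (p - 1) * (X * w) = (lam * a) `^ (p - 1) * v * (X / w `^ (p - 1)).
Proof.
move=> p1 lam0 X0 w0 a0 avw; have p0 : 0 < p by exact: lt_trans ltr01 p1.
have w1 : w `^ (p - 1) != 0 by rewrite gt_eqF// powR_gt0.
rewrite powRM// -!mulrA (mulrA (a `^ _)) avw -(mulr_powRB1 (ltW w0) p0).
by field.
Qed.

Lemma below_threshold p lam X w v a : 1 < p -> 0 <= lam -> 0 <= X -> 0 < w ->
  0 <= v -> 0 <= a -> a `^ (p - 1) * v = w `^ p ->
  X * w <= lam * a -> X `^ p * v <= lam `^ (p - 1) * (X * w).
Proof.
move=> p1 lam0 X0 w0 v0 a0 avw h.
rewrite (threshold_identity v p1 X0 w0) (threshold_identity_lam p1 lam0 X0 w0 a0 avw).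
rewrite ler_wpM2r ?divr_ge0 ?powR_ge0// ler_wpM2r//.
by apply: ge0_ler_powR; rewrite ?nnegrE ?mulr_ge0 ?subr_ge0 ?(ltW w0) ?(ltW p1).
Qed.

Lemma above_threshold p lam X w v a : 1 < p -> 0 <= lam -> 0 <= X -> 0 < w ->
  0 <= v -> 0 <= a -> a `^ (p - 1) * v = w `^ p ->
  lam * a <= X * w -> lam `^ (p - 1) * (X * w) <= X `^ p * v.
Proof.
move=> p1 lam0 X0 w0 v0 a0 avw h.
rewrite (threshold_identity v p1 X0 w0) (threshold_identity_lam p1 lam0 X0 w0 a0 avw).
rewrite ler_wpM2r ?divr_ge0 ?powR_ge0// ler_wpM2r//.
by apply: ge0_ler_powR; rewrite ?nnegrE ?mulr_ge0 ?subr_ge0 ?(ltW w0) ?(ltW p1).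
Qed.

(** The estimate of the averaged part on one cube: [m] is the mean, [A], [V] and [W]
    are the masses of the cube, [t] is the mass of the function averaged.  One
    factor [t] is kept and the remaining [t^(p-1)] is absorbed by [A^(p-1)]. *)
Lemma average_power_bound p lam (m A V W t C1 C2 C3 : R) : 1 < p -> 0 <= lam -> 0 <= m ->
  0 < A -> 0 <= V -> 0 < W -> 0 <= t -> 0 <= C1 -> 0 <= C2 ->
  0 <= C3 -> W * m <= C1 * t -> A `^ (p - 1) * V <= C2 * W `^ p -> t <= C3 * lam * A ->
  m `^ p * V <= C2 * C1 `^ p * C3 `^ (p - 1) * (lam `^ (p - 1) * t).
Proof.
move=> p1 lam0 m0 A0 V0 W0 t0 C10 C20 C30 h1 h2 h3.
have p0 : 0 < p by exact: lt_trans ltr01 p1.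
have Ap0 : 0 < A `^ (p - 1) by exact: powR_gt0.
rewrite -(ler_pM2l Ap0).
apply: (@le_trans _ _ (m `^ p * (C2 * W `^ p))).
  by rewrite mulrCA ler_wpM2l ?powR_ge0.
rewrite mulrCA -powRM ?(ltW W0)//.
apply: (@le_trans _ _ (C2 * (C1 * t) `^ p)).
  apply: ler_wpM2l => //; apply: ge0_ler_powR; rewrite ?nnegrE ?(ltW p0) ?mulr_ge0 ?(ltW W0)//.
  by rewrite mulrC.
rewrite powRM// -(mulr_powRB1 t0 p0).
have : t `^ (p - 1) <= C3 `^ (p - 1) * lam `^ (p - 1) * A `^ (p - 1).
  rewrite -!powRM ?(ltW A0) ?mulr_ge0//.
  by apply: ge0_ler_powR; rewrite ?nnegrE ?subr_ge0 ?(ltW p1) ?mulr_ge0 ?(ltW A0).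
move=> h; rewrite (_ : C2 * _ = (C2 * C1 `^ p * t) * t `^ (p - 1)); last by ring.
rewrite [leRHS](_ : _ = (C2 * C1 `^ p * t) * (C3 `^ (p - 1) * lam `^ (p - 1) * A `^ (p - 1))).
  by apply: ler_wpM2l => //; rewrite !mulr_ge0 ?powR_ge0.
by ring.
Qed.

End real_inequalities.

(** * The good part and the dilated cubes *)

Section good.
Context {R : realType} {d : nat}.
Local Notation mu := (lebesgue_rV R d).
Local Notation Rd := 'rV[R]_d.
Local Notation normc := (@Normc.normc R).
Implicit Types (f g h : Rd -> R[i]).

Lemma mass_bigcup_le (phi : Rd -> R) (E : nat -> set Rd) : nnmeas phi ->
  (forall j, measurable (E j)) ->
  (mass mu phi (\bigcup_j E j) <= \sum_(0 <= j <oo) mass mu phi (E j))%E.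
Proof.
move=> nphi mE; apply: (@measure_sigma_subadditive _ _ _ (density_measure mu nphi)) => //.
exact: bigcupT_measurable.
Qed.

Variables (p : R) (w v a : Rd -> R).
Hypotheses (p1 : 1 < p) (Aw : A1 w) (wv : weight v) (wa : weight a).
Hypothesis hpt : {ae mu, forall x, a x `^ (p - 1) * v x = w x `^ p}.
Let ww : weight w := Aw.1.
Let nw : nnmeas w := weight_nnmeas ww.
Let nv : nnmeas v := weight_nnmeas wv.
Let na : nnmeas a := weight_nnmeas wa.

Let ae_good : {ae mu, forall x, 0 < w x /\ a x `^ (p - 1) * v x = w x `^ p}.
Proof. by have [_ _ wp _] := ww; apply: filterS2 wp hpt => x. Qed.

(** At every point one of the two terms on the right dominates, according to the
    side of the threshold. *)
Lemma threshold_split lam g E : 0 < lam -> Cmeasurable g -> measurable E ->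
  (nmass w g E <= lam%:E * mass mu a E + (lam `^ (p - 1))^-1%:E * pmass p v g E)%E.
Proof.
move=> lam0 mg mE; have L0 : 0 < lam `^ (p - 1) by exact: powR_gt0.
have n1 : nnmeas (fun x => lam * a x) by apply: nnmeasZ => //; exact: ltW.
have n2 := nnmeas_pmass p nv mg.
have n3 : nnmeas (fun x => (lam `^ (p - 1))^-1 * (normc (g x) `^ p * v x)).
  by apply: nnmeasZ => //; rewrite invr_ge0 ltW.
rewrite /pmass -massZ ?(ltW lam0)// -massZ ?invr_ge0 ?(ltW L0)// -massD//.
apply: mass_aele => //; [exact: nnmeas_nmass|exact: nnmeasD|].
apply: filterS ae_good => x [wx hx] _.
have [h|/ltW h] := leP (normc (g x) * w x) (lam * a x).
  by rewrite (le_trans h)// lerDl; exact: n3.2.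
apply: (@le_trans _ _ ((lam `^ (p - 1))^-1 * (normc (g x) `^ p * v x))).
  rewrite ler_pdivlMl//; apply: above_threshold (normc_ge0 _) wx _ _ hx h => //.
  - exact: ltW.
  - exact: nv.2.
  - exact: na.2.
by rewrite lerDr; exact: n1.2.
Qed.

Variables (Ca : R) (Ca0 : 0 < Ca).
Hypothesis hA : forall c l E (h : Rd -> R),
  0 < l -> measurable E -> E `<=` cube c l -> nnmeas h ->
  ((cmass w c l)%:E * mass mu h E <= (Ca * l ^+ d)%:E * mass mu (fun x => h x * w x)%R E)%E.
Variables (Cw : R) (Cw0 : 0 < Cw).
Hypothesis hW : forall c l, 0 < l ->
  cmass a c l `^ (p - 1) * cmass v c l <= Cw * cmass w c l `^ p.
Variables (Cz lam : R) (Cz0 : 0 < Cz) (lam0 : 0 < lam).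
Variables (D : nat -> set Rd) (c : nat -> Rd) (l : nat -> R) (b : Rd -> R[i]).
Hypotheses (tD : trivIset setT D) (mb : Cmeasurable b) (bfin : (nmass w b setT < +oo)%E).
Hypothesis mD : forall j, measurable (D j).
Hypothesis l0 : forall j, 0 < l j.
Hypothesis cD : forall j, D j = set0 \/
  [/\ cube (c j) (l j / 2) `<=` D j, D j `<=` cube (c j) (l j),
      (nmass w b (D j) <= (Cz * lam * cmass a (c j) (l j))%:E)%E &
      ((lam * cmass a (c j) (5 * l j))%:E <= Cz%:E * nmass w b (D j))%E].
Hypothesis off : {ae mu, forall x, (~` \bigcup_j D j) x -> normc (b x) * w x <= lam * a x}.

Let cD' j : cube_like (D j) (c j) (l j).
Proof. by split=> //; have [->|[h1 h2 _ _]] := cD j; [left|right]. Qed.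

Let mO : measurable (Omega D). Proof. exact: measurable_Omega cD'. Qed.

Definition Cgood : R := Cw * @Cavg R d Ca `^ p * Cz `^ (p - 1).

Lemma Cgood_ge0 : 0 <= Cgood.
Proof. by rewrite !mulr_ge0 ?powR_ge0// ltW. Qed.

Let bOfin : (nmass w b (Omega D) < +oo)%E.
Proof.
apply: le_lt_trans bfin; apply: mass_sub => //; exact: nnmeas_nmass.
Qed.

Let Cavg0 : 0 < @Cavg R d Ca.
Proof. by rewrite /Cavg !mulr_gt0// exprn_gt0. Qed.

(** Off [Omega] the function is below the threshold; on each [D j] it is a mean, for
    which the comparison of the weights gives the same bound. *)
Lemma pmass_good_le :
  (pmass p v (fun x => b x - bad D b x)%R setT <=
    ((1 + Cgood) * lam `^ (p - 1))%:E * nmass w b setT)%E.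
Proof.
have L0 : 0 < lam `^ (p - 1) by exact: powR_gt0.
have mbad : Cmeasurable (bad D b) by exact: Cmeasurable_bad cD' _ mb.
have mg : Cmeasurable (fun x => b x - bad D b x) by exact: CmeasurableB.
have ng := nnmeas_pmass p nv mg; have nb := nnmeas_nmass nw mb.
have nb0 E : (0 <= nmass w b E)%E by exact: nmass_ge0.
rewrite /pmass (mass_split _ ng measurableT mO) setTI setTD.
rewrite mulrDl mul1r EFinD ge0_muleDl ?lee_fin ?(ltW L0)//; last first.
  by rewrite mulr_ge0 ?Cgood_ge0 ?ltW.
rewrite [X in (_ <= X)%E]addeC; apply: leeD; last first.
  apply: (@le_trans _ _ ((lam `^ (p - 1))%:E * nmass w b (~` Omega D))%E); last first.
    apply: lee_wpmul2l; first by rewrite lee_fin ltW.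
    by apply: mass_sub => //; exact: measurableC.
  rewrite /nmass -massZ ?(ltW L0)//; last exact: measurableC.
  apply: mass_aele => //.
  - by apply: nnmeasZ => //; exact: ltW.
  - exact: measurableC.
  apply: filterS2 off ae_good => x hoff [wx hx] nO.
  rewrite bad_out// subr0; apply: below_threshold (normc_ge0 _) wx _ _ hx _ => //.
  - exact: ltW.
  - exact: nv.2.
  - exact: na.2.
  - exact: hoff.
apply: (@le_trans _ _ ((Cgood * lam `^ (p - 1))%:E * nmass w b (Omega D))%E); last first.
  apply: lee_wpmul2l; first by rewrite lee_fin mulr_ge0 ?Cgood_ge0 ?ltW.
  exact: mass_sub.
rewrite /nmass /Omega !mass_bigcup// -nneseriesZl; last by move=> j _; exact: nb0.
apply: lee_nneseries => [j _ _|j _]; first exact: mass_ge0.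
rewrite -/(nmass w b (D j)).
have [D0|[cDj Djc tle _]] := cD j.
  by rewrite D0 /nmass !mass_set0 mule0.
have Dj : D j !=set0.
  by exists (c j); apply: cDj => i; rewrite subrr normr0 !divr_ge0// ltW.
have tfin : (nmass w b (D j) < +oo)%E by apply: le_lt_trans bfin; exact: mass_sub.
have := avg_le Aw hA cD' Dj mb tfin.
move: tle; have [t t0 ->] := nmass_real Aw (mD j) mb tfin.
rewrite -!EFinM !lee_fin => tle hav.
pose m := normc (avg D j b).
apply: (@le_trans _ _ (m `^ p * cmass v (c j) (l j))%:E).
  rewrite (_ : mass mu _ _ = mass mu (fun x => m `^ p * v x) (D j)); last first.
    apply: eq_mass => x Dx; rewrite (badE tD _ Dx) /m.
    by congr (normc _ `^ _ * _); ring.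
  rewrite massZ ?powR_ge0// EFinM; apply: lee_wpmul2l; first by rewrite lee_fin powR_ge0.
  by rewrite -cmassE//; apply: mass_sub => //; exact: measurable_cube.
rewrite lee_fin -mulrA /Cgood.
apply: (@average_power_bound _ _ _ m (cmass a (c j) (l j)) _ (cmass w (c j) (l j))) => //.
- exact: ltW.
- exact: normc_ge0.
- exact: cmass_gt0.
- exact: cmass_ge0.
- exact: cmass_gt0.
- exact: ltW.
- exact: ltW.
- exact: ltW.
- exact: hW.
Qed.

(** The dilated cubes may overlap, so countable subadditivity is used; each is paid
    for by the mass of [b] on its own piece. *)
Lemma mass_Omega_star_le :
  (lam%:E * mass mu a (Omega_star D c l) <= Cz%:E * nmass w b setT)%E.
Proof.
apply: (@le_trans _ _ (Cz%:E * nmass w b (Omega D))%E); last first.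
  apply: lee_wpmul2l; first by rewrite lee_fin ltW.
  by apply: mass_sub => //; exact: nnmeas_nmass.
rewrite /nmass /Omega [mass mu _ (\bigcup_j D j)]mass_bigcup//; last exact: nnmeas_nmass.
rewrite -nneseriesZl; last by move=> j _; exact: nmass_ge0.
pose S j := [set x | D j !=set0 /\ cube (c j) (5 * l j) x].
have SE j : S j = set0 \/ S j = cube (c j) (5 * l j) /\ D j <> set0.
  have [D0|/set0P Dj] := eqVneq (D j) set0.
    by left; apply/seteqP; split=> // x [[y]]; rewrite D0.
  right; split; last by apply/eqP/set0P.
  by apply/seteqP; split=> x // [].
have mS j : measurable (S j) by have [->//|[-> _]] := SE j; exact: measurable_cube.
apply: (@le_trans _ _ (lam%:E * \sum_(0 <= j <oo) mass mu a (S j))%E).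
  by apply: lee_wpmul2l; [rewrite lee_fin ltW|exact: mass_bigcup_le].
rewrite -nneseriesZl; last by move=> j _; exact: mass_ge0.
apply: lee_nneseries => [j _ _|j _]; first by rewrite mule_ge0 ?mass_ge0// lee_fin ltW.
have [->|[-> Dj]] := SE j.
  by rewrite mass_set0 mule0 mule_ge0 ?lee_fin ?(ltW Cz0)//; exact: nmass_ge0.
have [/Dj//|[_ _ _]] := cD j.
by rewrite cmassE// -EFinM.
Qed.

End good.

(** * The distance to a ball of L^p(v) *)

Section distance.
Context {R : realType} {d : nat}.
Local Notation mu := (lebesgue_rV R d).
Local Notation Rd := 'rV[R]_d.
Implicit Types (f g h : Rd -> R[i]).
Variables (w v : Rd -> R) (p : R).
Hypotheses (ww : weight w) (wv : weight v) (p1 : 1 < p).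
Let nw : nnmeas w := weight_nnmeas ww.
Let nv : nnmeas v := weight_nnmeas wv.
Let p0 : 0 < p := lt_trans ltr01 p1.

Lemma dist_ball_ge0 f s : Cmeasurable f -> (0 <= dist_ball w p v f s)%E.
Proof.
move=> mf; apply: le_ereal_inf_tmp => _ [g /= [mg _] <-].
have m : Cmeasurable (fun x => f x - g x) by exact: CmeasurableB.
by rewrite wLnorm1E//; exact: nmass_ge0.
Qed.

Lemma dist_ball_le f g s : 0 <= s -> Cmeasurable f -> Cmeasurable g ->
  (pmass p v g setT <= (s `^ p)%:E)%E ->
  (dist_ball w p v f s <= nmass w (fun x => f x - g x)%R setT)%E.
Proof.
move=> s0 mf mg hg; apply: ereal_inf_lbound; exists g => /=.
  by split=> //; apply/wLnorm_leP.
by rewrite wLnorm1E//; exact: CmeasurableB.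
Qed.

Lemma dist_ball_lt f s (x : \bar R) : 0 <= s -> Cmeasurable f ->
  (dist_ball w p v f s < x)%E -> exists g, [/\ Cmeasurable g,
    (pmass p v g setT <= (s `^ p)%:E)%E &
    (nmass w (fun x => f x - g x)%R setT < x)%E].
Proof.
move=> s0 mf /ereal_inf_lt[_ [g /= [mg hg] <-]] h; exists g; split=> //.
  exact/wLnorm_leP.
by move: h; rewrite wLnorm1E//; exact: CmeasurableB.
Qed.

Lemma dist_ball_le_norm f s : 0 <= s -> Cmeasurable f ->
  (dist_ball w p v f s <= nmass w f setT)%E.
Proof.
move=> s0 mf; have m0 := @Cmeasurable_cst R d 0.
apply: le_trans (dist_ball_le (g := fun=> 0) s0 mf m0 _) _.
  rewrite /pmass; under eq_mass do rewrite Normc.normc0 powR0 ?gt_eqF// mul0r.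
  by rewrite /mass integral0 lee_fin powR_ge0.
by rewrite /nmass; under eq_mass do rewrite subr0.
Qed.

Lemma dist_ball_fin_num f s : 0 <= s -> Cmeasurable f -> (nmass w f setT < +oo)%E ->
  dist_ball w p v f s \is a fin_num.
Proof.
move=> s0 mf ffin; rewrite ge0_fin_numE; last exact: dist_ball_ge0.
exact: le_lt_trans (dist_ball_le_norm s0 mf) ffin.
Qed.

(** A minimizing sequence converges to [f] in L^1(w), hence almost everywhere along a
    subsequence, and Fatou keeps the limit in the ball. *)
Lemma dist_ball_eq0 f s : 0 <= s -> Cmeasurable f -> dist_ball w p v f s = 0%E ->
  (pmass p v f setT <= (s `^ p)%:E)%E.
Proof.
move=> s0 mf d0.
have /choice[g hg] : forall n : nat, exists g, [/\ Cmeasurable g,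
    (pmass p v g setT <= (s `^ p)%:E)%E &
    (nmass w (fun x => f x - g x)%R setT < (4 ^- n)%:E)%E].
  by move=> n; apply: dist_ball_lt => //; rewrite d0 lte_fin invr_gt0 exprn_gt0.
have mg n : Cmeasurable (g n) by case: (hg n).
have hw : tends0 (fun n => weakL1norm w (fun x => g n x - f x)).
  apply: tends0_le pow4_tends0 => n.
  apply: (le_trans (weak_le_nmass nw _)); first exact: CmeasurableB.
  by rewrite nmassBC; case: (hg n) => _ _ /ltW.
have [k [_ hk]] := weak_ae_subseq ww mg mf hw.
apply: (pmass_fatou p0 nv (h_ := fun n => g (k n))) => //.
  by apply: filterS hk => x hx _.
by move=> n; case: (hg (k n)).
Qed.

End distance.

(** * Approximation from near-minimizers *)

Section core.
Context {R : realType} {d : nat}.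
Local Notation mu := (lebesgue_rV R d).
Local Notation Rd := 'rV[R]_d.
Implicit Types (f g h : Rd -> R[i]).

Lemma CZ_ext_intro (T : (Rd -> R[i]) -> Rd -> R[i]) w (u_ : nat -> Rd -> R[i]) u Tu :
  CZ_operator T -> nnmeas w -> Cmeasurable u -> Cmeasurable Tu ->
  (forall n, bounded_compact_support (u_ n)) ->
  tends0 (fun n => nmass w (fun x => u_ n x - u x) setT) ->
  tends0 (fun n => weakL1norm w (fun x => T (u_ n) x - Tu x)) ->
  CZ_ext T w u Tu.
Proof.
move=> hT nw mu' mTu bu hu hTu; split=> //; exists u_; split=> //.
- have m n : Cmeasurable (fun x => u_ n x - u x).
    by apply: CmeasurableB => //; exact: Cmeasurable_bcs.
  apply/tends0P; first by move=> n; rewrite wLnorm1E//; exact: nmass_ge0.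
  by apply: tends0_le hu => n; rewrite wLnorm1E.
- by apply/tends0P => // n; exact: weak_ge0.
Qed.

(** The construction for given near-minimizers [g] and [h]; only the mass [be] of
    [f - g] enters, so that no attained infimum is required. *)
Lemma stable_approximation (hd : (0 < d)%N) (p q : R) (w v a : Rd -> R)
    (T : (Rd -> R[i]) -> Rd -> R[i]) : 1 < p -> 1 < q -> A1 w -> Ap p v -> Ap q a ->
  {ae mu, forall x, a x `^ (p - 1) * v x = w x `^ p} -> CZ_operator T ->
  exists2 C : R, 0 < C & forall f Tf g h (s be : R), 0 < s -> 0 < be ->
    Cmeasurable f -> (nmass w f setT < +oo)%E -> CZ_ext T w f Tf -> Cmeasurable g -> Cmeasurable h ->
    (pmass p v g setT <= (s `^ p)%:E)%E -> (pmass p v h setT <= (s `^ p)%:E)%E ->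
    nmass w (fun x => f x - g x) setT = be%:E ->
    exists u Tu, [/\ Cmeasurable u, CZ_ext T w u Tu,
      (pmass p v u setT <= (C * s `^ p)%:E)%E,
      (nmass w (fun x => f x - u x)%R setT <= (C * be)%:E)%E &
      (nmass w (fun x => Tf x - Tu x)%R setT <=
        nmass w (fun x => Tf x - h x)%R setT + (C * be)%:E)%E].
Proof.
move=> p1 q1 Aw Av Aa hpt hT.
have p0 : 0 < p by exact: lt_trans ltr01 p1.
have p10 : 0 < p - 1 by rewrite subr_gt0.
have ww := Aw.1; have wv := Av.1; have wa := Aa.1.
have nw := weight_nnmeas ww; have nv := weight_nnmeas wv; have na := weight_nnmeas wa.
have [Ca Ca0 hA] := A1_average Aw.
have [Ct Ct0 hTail] := T_tail hd hT Aw.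
have [Cw Cw0 hW] := weights_comparison p1 q1 ww Av Aa hpt.
have [Cz Cz0 hZ] := cz_decomposition hd q1 Aa.
have [Cs Cs0 hS] := T_strong hT p1 Av.
have Cavg0 : 0 < @Cavg R d Ca by rewrite /Cavg !mulr_gt0// exprn_gt0.
have G0 : 0 <= @Cgood R d p Ca Cw Cz by exact: Cgood_ge0.
pose Cb := 1 + @Cavg R d Ca; have Cb0 : 0 < Cb by rewrite addr_gt0.
have P20 : 0 < 2 `^ p :> R by rewrite powR_gt0.
pose Cu := 2 `^ p * (1 + (1 + @Cgood R d p Ca Cw Cz)).
have Cu0 : 0 < Cu by rewrite mulr_gt0// addr_gt0// ltr_pwDl.
pose Ck := Ct * Cb + Cz + 2 `^ p * (1 + Cs * Cu).
have Ck0 : 0 < Ck by rewrite addr_gt0 ?addr_gt0 ?mulr_gt0// addr_gt0// mulr_gt0.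
exists (Cu + Cb + Ck); first by do 2 apply: addr_gt0 => //.
move=> f Tf g h s be s0 be0 mf ffin hf mg mh hg hh hbe.
have sp0 : 0 < s `^ p by exact: powR_gt0.
pose b x := f x - g x.
have mb : Cmeasurable b by exact: CmeasurableB.
have bfin : (nmass w b setT < +oo)%E by rewrite hbe ltry.
(* The height solving [lam^(p-1) be = s^p]. *)
pose lam := (s `^ p / be) `^ (p - 1)^-1.
have lam0 : 0 < lam by rewrite powR_gt0// divr_gt0.
have lamp : lam `^ (p - 1) = s `^ p / be.
  by rewrite /lam -powRrM mulVf ?gt_eqF// powRr1// divr_ge0// ltW.
have [D [c [l [mD tD l0 cD off]]]] := hZ _ lam (nnmeas_nmass nw mb) bfin lam0.
have cD' j : cube_like (D j) (c j) (l j).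
  by split=> //; have [->|[h1 h2 _ _]] := cD j; [left|right].
have mO : measurable (Omega D) by exact: measurable_Omega cD'.
have bOle : (nmass w b (Omega D) <= be%:E)%E.
  by rewrite -hbe; apply: mass_sub => //; exact: nnmeas_nmass.
have bOfin : (nmass w b (Omega D) < +oo)%E by apply: le_lt_trans bOle _; rewrite ltry.
have mbad : Cmeasurable (bad D b) by exact: Cmeasurable_bad cD' _ mb.
pose u x := g x + (b x - bad D b x).
have mgood : Cmeasurable (fun x => b x - bad D b x) by exact: CmeasurableB.
have mu' : Cmeasurable u by exact: CmeasurableD.
have fuE : (fun x => f x - u x) = bad D b.
  by apply/funext => x; rewrite /u /b; ring.
have hu : (pmass p v u setT <= (Cu * s `^ p)%:E)%E.
  apply: (le_trans (pmassD (ltW p0) nv mg mgood measurableT)).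
  have := pmass_good_le p1 Aw wv wa hpt Ca0 hA Cw0 hW Cz0 lam0 tD mb bfin mD l0 cD off.
  rewrite hbe lamp -EFinM -mulrA divfK ?gt_eqF// => hgood.
  rewrite /Cu -mulrA EFinM; apply: lee_wpmul2l; first by rewrite lee_fin ltW.
  by rewrite mulrDl mul1r EFinD (leeD hg hgood).
have hb : (nmass w (bad D b) setT <= (Cb * be)%:E)%E.
  apply: (le_trans (nmass_bad_le Aw Ca0 hA tD cD' mb bOfin)).
  by rewrite EFinM; apply: lee_wpmul2l => //; rewrite lee_fin ltW.
have ufin : (nmass w u setT < +oo)%E.
  rewrite (_ : u = (fun x => f x - bad D b x)); last first.
    by apply/funext => x; rewrite /u /b; ring.
  apply: le_lt_trans (nmassB nw mf mbad measurableT) _.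
  by apply: lte_add_pinfty => //; apply: le_lt_trans hb _; rewrite ltry.
(* [Tu] is obtained from truncations of [u], whose L^p(v) norms do not exceed
   that of [u]. *)
pose v_ n := cutoff (trunc_set u n) u.
have bv n : bounded_compact_support (v_ n) by exact: bcs_trunc.
have hv : tends0 (fun n => nmass w (fun x => v_ n x - u x) setT).
  have := cutoff_cvg nw mu' (fun n => measurable_trunc_set n mu') measurableT
     (fun x _ => trunc_set_ex u x) ufin.
  by apply: tends0_le => n; rewrite nmassBC.
have [k [Tu [kn mTu hTu]]] := T_limit_exists hT Aw bv mu' hv.
pose u_ n := v_ (k n).
have bu n : bounded_compact_support (u_ n) by exact: bv.
have huu : tends0 (fun n => nmass w (fun x => u_ n x - u x) setT).
  exact: (tends0_sub kn hv).
have extu : CZ_ext T w u Tu by exact: (CZ_ext_intro hT nw mu' mTu bu huu hTu).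
have mTu_ n : Cmeasurable (T (u_ n)) by exact: (T_measurable hT).
have hTup : (pmass p v Tu setT <= (Cs * (Cu * s `^ p))%:E)%E.
  have [m [_ hm]] := weak_ae_subseq ww mTu_ mTu hTu.
  apply: (pmass_fatou p0 nv (h_ := fun n => T (u_ (m n)))) => //.
    by apply: filterS hm => x hx _.
  move=> n; apply: (le_trans (hS _ (bu (m n)))); rewrite EFinM.
  apply: lee_wpmul2l; first by rewrite lee_fin ltW.
  apply: le_trans hu; apply: pmass_cutoff_le => //; exact: measurable_trunc_set.
(* Another approximation of [f - u], adapted to the cubes: its images converge
   to [Tf - Tu] too. *)
pose b_ n := bad D (piece_trunc D b n).
have bb n : bounded_compact_support (b_ n) by exact: bcs_bad_piece_trunc tD cD' _ _ mb.
have hbb : tends0 (fun n => nmass w (fun x => b_ n x - (f x - u x)) setT).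
  have := bad_piece_trunc_cvg Aw Ca0 hA tD cD' mb bOfin.
  by apply: tends0_le => n; rewrite -fuE.
have hTb := CZ_ext_transfer hT Aw hf mf mu' mTu bu bb huu hTu hbb.
have mTf : Cmeasurable Tf by case: hf.
have mdiff : Cmeasurable (fun x => Tf x - Tu x) by exact: CmeasurableB.
have mS := measurable_Omega_star D c l.
have far : (nmass w (fun x => Tf x - Tu x)%R (~` Omega_star D c l) <= (Ct * Cb * be)%:E)%E.
  have mTb n : Cmeasurable (T (b_ n)) by exact: (T_measurable hT).
  have [m [_ hm]] := weak_ae_subseq ww mTb mdiff hTb.
  rewrite nmass_pmass; apply: (pmass_fatou ltr01 nw (h_ := fun n => T (b_ (m n)))) => //.
  - exact: measurableC.
  - by apply: filterS hm => x hx _.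
  move=> n; rewrite -nmass_pmass.
  apply: (le_trans (nmass_T_bad_trunc_le Aw Ca0 hA tD cD' hT Ct0 hTail (m n) mb bOfin)).
  by rewrite [X in (_ <= X)%E]EFinM; apply: lee_wpmul2l => //; rewrite lee_fin mulr_ge0 ?ltW.
have near : (nmass w (fun x => Tf x - Tu x)%R (Omega_star D c l) <=
   nmass w (fun x => Tf x - h x)%R setT + ((Cz + 2 `^ p * (1 + Cs * Cu)) * be)%:E)%E.
  have mTh : Cmeasurable (fun x => Tf x - h x) by exact: CmeasurableB.
  have mhT : Cmeasurable (fun x => h x - Tu x) by exact: CmeasurableB.
  apply: (@le_trans _ _ (nmass w (fun x => Tf x - h x)%R (Omega_star D c l) +
                         nmass w (fun x => h x - Tu x)%R (Omega_star D c l))%E).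
    apply: le_trans (nmassD nw mTh mhT mS).
    rewrite le_eqVlt; apply/orP; left; apply/eqP; apply: eq_mass => x _.
    by rewrite addrA subrK.
  apply: leeD; first by apply: mass_sub => //; exact: nnmeas_nmass.
  apply: (le_trans (threshold_split p1 Aw wv wa hpt lam0 mhT mS)).
  rewrite mulrDl EFinD; apply: leeD.
    have := mass_Omega_star_le Aw wa Cz0 lam0 tD mb mD l0 cD.
    by rewrite hbe -EFinM.
  rewrite lamp invf_div (_ : 2 `^ p * _ * be =
    be / s `^ p * (2 `^ p * (s `^ p + Cs * (Cu * s `^ p)))); last first.
    by field; rewrite gt_eqF.
  rewrite [X in (_ <= X)%E]EFinM; apply: lee_wpmul2l; first by rewrite lee_fin divr_ge0 ?ltW.
  apply: (@le_trans _ _ (pmass p v (fun x => h x + - Tu x)%R setT)).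
    by apply: mass_sub => //; exact: nnmeas_pmass.
  apply: (le_trans (pmassD (ltW p0) nv mh (CmeasurableN mTu) measurableT)).
  rewrite [X in (_ <= X)%E]EFinM; apply: lee_wpmul2l; first by rewrite lee_fin ltW.
  by rewrite [X in (_ <= X)%E]EFinD pmassN; exact: (leeD hh hTup).
exists u, Tu; split=> //.
- by apply: (le_trans hu); rewrite lee_fin ler_pM2r// -addrA lerDl addr_ge0 ?ltW.
- rewrite fuE; apply: (le_trans hb); rewrite lee_fin ler_pM2r//.
  by rewrite (addrC Cu) -addrA lerDl addr_ge0 ?ltW.
- rewrite /nmass (mass_split _ (nnmeas_nmass nw mdiff) measurableT mS) setTI setTD.
  apply: (le_trans (leeD near far)); rewrite -addeA -EFinD; apply: leeD => //.
  rewrite lee_fin -mulrDl ler_pM2r// (_ : _ + Ct * Cb = Ck); last by rewrite /Ck; ring.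
  by rewrite lerDr addr_ge0 ?ltW.
Qed.

End core.

Theorem theorem3 (R : realType) (d : nat) (hd : (0 < d)%N) (p : R) (hp : 1 < p)
    (w v : 'rV[R]_d -> R) (hw : A1 w) (hv : Ap p v)
    (ha : Ainfty (fun x => (w x `^ p / v x) `^ (p - 1)^-1))
    (T : ('rV[R]_d -> R[i]) -> 'rV[R]_d -> R[i]) (hT : CZ_operator T) :
  exists2 C : R, 0 < C &
    forall f Tf : 'rV[R]_d -> R[i],
      inLp 1 w f -> CZ_ext T w f Tf -> inLp 1 w Tf ->
      forall s : R, 0 < s ->
      exists u Tu : 'rV[R]_d -> R[i],
        [/\ inLp 1 w u, CZ_ext T w u Tu,
            (wLnorm p v u <= (C * s)%:E)%E,
            (wLnorm 1 w (fun x => f x - u x)%R <= C%:E * dist_ball w p v f s)%E &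
            (wLnorm 1 w (fun x => Tf x - Tu x)%R <=
               C%:E * (dist_ball w p v f s + dist_ball w p v Tf s))%E].
Proof.
have [q q1 Aq] := ha; have p0 : 0 < p by exact: lt_trans ltr01 hp.
set a := (fun x => _) in Aq.
have ww := hw.1; have wv := hv.1.
have nw := weight_nnmeas ww; have nv := weight_nnmeas wv.
have hpt : {ae lebesgue_rV R d, forall x, a x `^ (p - 1) * v x = w x `^ p}.
  have [_ _ vp _] := wv; apply: filterS vp => x vx.
  rewrite /a -powRrM mulVf ?subr_eq0 ?gt_eqF// powRr1 ?divr_ge0 ?powR_ge0 ?ltW//.
  by rewrite divfK// gt_eqF.
have [K K0 hK] := stable_approximation hd hp q1 hw hv Aq hpt hT.
(* The terms serve the case of distance zero, the L^p(v) bound after taking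
   p-th roots, and the two L^1(w) bounds, where near-minimizers cost a factor 2. *)
pose C := 1 + K `^ p^-1 + 2 * K.
have Kp0 : 0 < K `^ p^-1 by exact: powR_gt0.
have C1 : 1 <= C by rewrite /C -addrA lerDl addr_ge0// ?mulr_ge0// ltW.
have C0 : 0 < C by apply: lt_le_trans C1.
have CK : 1 + 2 * K <= C by rewrite /C; lra.
exists C => // f Tf [mf finf] hf [mTf finTf] s s0.
have sge0 := ltW s0.
rewrite wLnorm1E// in finf; rewrite wLnorm1E// in finTf.
have d10 := dist_ball_ge0 v p ww s mf; have d20 := dist_ball_ge0 v p ww s mTf.
have d1fin := dist_ball_fin_num ww wv hp sge0 mf finf.
have d2fin := dist_ball_fin_num ww wv hp sge0 mTf finTf.
have d1inf := dist_ball_eq0 ww wv hp sge0 mf.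
have d1lb := fun g => @dist_ball_le _ _ w v p ww wv hp f g s sge0 mf.
have d1ub := dist_ball_lt ww wv hp sge0 mf.
have d2ub := dist_ball_lt ww wv hp sge0 mTf.
(* From here on only these properties of the two distances are used. *)
move: (dist_ball w p v f s) (dist_ball w p v Tf s) => d1 d2
  in d10 d20 d1fin d2fin d1inf d1lb d1ub d2ub *.
have [d1E|d1N0] := eqVneq d1 0%E.
  have zero g : wLnorm 1 w (fun x => g x - g x) = 0%E.
    rewrite (_ : (fun x => _) = (fun=> 0)); last by apply/funext => x; rewrite subrr.
    rewrite wLnorm1E; [|exact: nw|exact: Cmeasurable_cst].
    rewrite /nmass; under eq_mass do rewrite Normc.normc0 mul0r.
    by rewrite /mass integral0.
  exists f, Tf; split=> //.
  - by split=> //; rewrite wLnorm1E.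
  - apply/wLnorm_leP => //; first by rewrite mulr_ge0// ltW.
    apply: (le_trans (d1inf d1E)).
    rewrite lee_fin; apply: ge0_ler_powR; rewrite ?nnegrE ?(ltW p0) ?mulr_ge0 ?(ltW C0)//.
    by rewrite ler_peMl.
  - by rewrite zero; apply: mule_ge0 => //; rewrite lee_fin ltW.
  - by rewrite zero; apply: mule_ge0; [rewrite lee_fin ltW|exact: adde_ge0].
have d1p : (0 < d1)%E by rewrite lt_def d1N0.
have d1lt : (d1 < 2%:E * d1)%E.
  rewrite -(fineK d1fin) -EFinM lte_fin.
  have : 0 < fine d1 by rewrite fine_gt0// d1p ltey_eq d1fin.
  lra.
have d2lt : (d2 < d1 + d2)%E by rewrite -[ltLHS]add0e lteD2rE.
have [g [mg hg gle]] := d1ub _ d1lt.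
have [h [mh hh hle]] := d2ub _ d2lt.
have gfin : nmass w (fun x => f x - g x) setT \is a fin_num.
  rewrite ge0_fin_numE; last by apply: nmass_ge0 => //; exact: CmeasurableB.
  by apply: lt_trans gle _; rewrite -(fineK d1fin) -EFinM ltry.
have be0 : 0 < fine (nmass w (fun x => f x - g x) setT).
  rewrite -lte_fin fineK//; apply: (lt_le_trans d1p); exact: d1lb.
have [u [Tu [mu' extu hu hfu hTu]]] :=
  hK f Tf g h s _ s0 be0 mf finf hf mg mh hg hh (esym (fineK gfin)).
have mTu : Cmeasurable Tu by case: extu.
have mfu : Cmeasurable (fun x => f x - u x) by exact: CmeasurableB.
have mTfu : Cmeasurable (fun x => Tf x - Tu x) by exact: CmeasurableB.
have bele : ((K * fine (nmass w (fun x => f x - g x) setT))%:E <= (2 * K)%:E * d1)%E.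
  rewrite EFinM fineK// (mulrC 2) EFinM -muleA; apply: lee_wpmul2l.
    by rewrite lee_fin ltW.
  exact: ltW.
exists u, Tu; split=> //.
- split=> //; rewrite wLnorm1E//.
  have : (nmass w u setT <= nmass w f setT + nmass w (fun x => f x - u x)%R setT)%E.
    apply: le_trans (nmassB nw mf mfu measurableT).
    rewrite le_eqVlt; apply/orP; left; apply/eqP; apply: eq_mass => x _.
    by congr (_ * _); congr (Normc.normc _); ring.
  move=> /le_lt_trans; apply; apply: lte_add_pinfty => //.
  by apply: (le_lt_trans hfu); rewrite ltry.
- apply/wLnorm_leP => //; first by rewrite mulr_ge0// ltW.
  apply: (le_trans hu); rewrite lee_fin powRM ?(ltW C0)// ler_wpM2r ?powR_ge0//.
  rewrite -[leLHS](powRr1 (ltW K0)) -(mulVf (x := p)) ?gt_eqF// powRrM.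
  apply: ge0_ler_powR; rewrite ?nnegrE ?powR_ge0 ?(ltW p0) ?(ltW C0)//.
  by rewrite /C; lra.
- rewrite wLnorm1E//; apply: (le_trans hfu); apply: (le_trans bele).
  by apply: lee_wpmul2r => //; rewrite lee_fin; lra.
- rewrite wLnorm1E//; apply: (le_trans hTu).
  apply: (@le_trans _ _ ((d1 + d2) + (2 * K)%:E * (d1 + d2))%E).
    apply: leeD; first exact: ltW.
    apply: (le_trans bele); apply: lee_wpmul2l; first by rewrite lee_fin mulr_ge0// ltW.
    by rewrite leeDl.
  rewrite -[X in (X + _ <= _)%E]mul1e -ge0_muleDl ?lee_fin ?mulr_ge0 ?(ltW K0)//.
  by apply: lee_wpmul2r; [exact: adde_ge0|rewrite -EFinD lee_fin].
Qed.
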